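(* Assume that the compact set $E\subset\mathbb R$ (of positive Lebesgue measure) satisfies the Craig-type condition and that $(a,b):\mathbb R\to\mathcal J(E)$ is a non-constant solution of the Toda lattice. Fix $j\in I$ and let $\lambda\in\{E_j^-,E_j^+\}$. Then the set $\{t\in\mathbb R:\mu_j(t)=\lambda\}$ is discrete, where $\mu_j(t)$ denotes the Dirichlet datum of $J(a(t),b(t))$ at site $0$ in the $j$-th gap.
   Context: For bounded real sequences $a,b$ on $\mathbb Z$ with $a_n>0$, $J(a,b)$ is the Jacobi operator on $\ell^2(\mathbb Z)$, $(Ju)_n=a_nu_{n+1}+b_nu_n+a_{n-1}u_{n-1}$. The Toda lattice is $\frac{d}{dt}a_n=a_n(b_{n+1}-b_n)$, $\frac{d}{dt}b_n=2(a_n^2-a_{n-1}^2)$, $n\in\mathbb Z$. Write $\underline E=\inf E$, $\overline E=\sup E$ and $E=[\underline E,\overline E]\setminus\bigcup_{j\in I}(E_j^-,E_j^+)$, where $I$ is at most countable and the $(E_j^-,E_j^+)$ are the (distinct) bounded maximal open intervals of $\mathbb R\setminus E$ (gaps). Put $\gamma_j=E_j^+-E_j^-$, $\eta_{j,l}=\min\{|E_j^+-E_l^-|,|E_j^--E_l^+|\}$, $\eta_j=\min\{|E_j^+-\overline E|,|E_j^--\underline E|\}$, and $$C_j=\big((\overline E-\underline E)-\eta_j\big)^{1/2}\exp\Big(\tfrac12\sum_{k\ne j}\frac{\gamma_k}{\eta_{j,k}}\Big).$$ The Craig-type condition on $E$ is $$\sup_{j\in I}\gamma_jC_j<\infty,\qquad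 \sup_{j\in I}\frac{\gamma_j}{\eta_j}C_j<\infty,\qquad \sup_{j\in I}\sum_{k\ne j}\frac{(\gamma_j\gamma_k)^{1/2}}{\eta_{j,k}}C_j<\infty .$$ $J$ is reflectionless on $E$ if for every $n\in\mathbb Z$, $\operatorname{Re}\langle\delta_n,(J-(x+i0))^{-1}\delta_n\rangle=0$ for Lebesgue-a.e. $x\in E$. $\mathcal J(E)$ is the set of pairs $(a,b)$ (identified with $J(a,b)$) with $\sigma(J(a,b))\subset E$ and $J(a,b)$ reflectionless on $E$. For $J\in\mathcal J(E)$ let $r(z)=\langle\delta_0,(J-z)^{-1}\delta_0\rangle$, which is strictly increasing on each gap. The Dirichlet datum $\mu_j$ of $J$ (at site $0$) is the zero of $r$ in $(E_j^-,E_j^+)$ if one exists; $\mu_j=E_j^+$ if $r<0$ on $(E_j^-,E_j^+)$; and $\mu_j=E_j^-$ if $r>0$ on $(E_j^-,E_j^+)$. *)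

(* Defs.v *)
From HB Require Import structures.
From mathcomp Require Import all_boot all_order all_algebra.
From mathcomp Require Import complex.
From mathcomp Require Import all_classical all_reals all_analysis.

Set Implicit Arguments.
Unset Strict Implicit.
Unset Printing Implicit Defensive.

Import Order.TTheory GRing.Theory Num.Theory.
Import numFieldNormedType.Exports.

Local Open Scope classical_set_scope.
Local Open Scope ring_scope.
Local Open Scope complex_scope.

(* The Hilbert space l^2(Z) is the set of u : int -> R[i] with
   l2sq u < +oo; l2sq u is the square of the norm of u. *)

Definition l2sq (R : realType) (u : int -> R[i]) : \bar R :=
  (\esum_(n in [set: int]) (Normc.normc (u n) ^+ 2)%:E)%E.

Definition ell2 (R : realType) : set (int -> R[i]) :=
  [set u | (l2sq u < +oo)%E].

Definition delta (R : realType) (n : int) : int -> R[i] :=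
  fun m => if m == n then 1 else 0.

Definition jacobi (R : realType) (a b : int -> R) (u : int -> R[i])
    : int -> R[i] :=
  fun n => (a n)%:C * u (n + 1) + (b n)%:C * u n + (a (n - 1))%:C * u (n - 1).

Definition jacobi_shift (R : realType) (a b : int -> R) (z : R[i])
    (u : int -> R[i]) : int -> R[i] :=
  fun n => jacobi a b u n - z * u n.

(* J - z is a bijection of l^2(Z) with bounded inverse *)
Definition resolvent_set (R : realType) (a b : int -> R) : set R[i] :=
  [set z |
    (forall u v, ell2 u -> ell2 v ->
       jacobi_shift a b z u = jacobi_shift a b z v -> u = v) /\
    exists M : R, forall f, ell2 f ->
      exists u, [/\ ell2 u, jacobi_shift a b z u = f
                  & (l2sq u <= M%:E * l2sq f)%E] ].

Definition spectrum (R : realType) (a b : int -> R) : set R[i] :=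
  ~` resolvent_set a b.

(* (J - z)^-1 f, meaningful for z in the resolvent set and f in l^2(Z) *)
Definition resolvent (R : realType) (a b : int -> R) (z : R[i])
    (f : int -> R[i]) : int -> R[i] :=
  xget (fun=> 0) [set u | ell2 u /\ jacobi_shift a b z u = f].

(* <delta_n, (J - z)^-1 delta_n>; pairing with delta_n takes the n-th
   coordinate *)
Definition green (R : realType) (a b : int -> R) (n : int) (z : R[i]) : R[i] :=
  resolvent a b z (delta R n) n.

(* The condition Re <delta_n, (J - (x + i0))^-1 delta_n> = 0 for a.e. x in E.
   The boundary value is the limit of green along x + ie as e decreases to 0;
   it exists for a.e. x since green is a Herglotz function. *)
Definition reflectionless (R : realType) (E : set R) (a b : int -> R) : Prop :=
  forall n : int, {ae (@lebesgue_measure R), forall x, E x ->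
    (fun e : R => complex.Re (green a b n (x +i* e))) @ (0 : R)^'+ --> (0 : R)}.

Definition jacobi_coeffs (R : realType) (a b : int -> R) : Prop :=
  [/\ forall n, 0 < a n,
      exists M : R, forall n, `|a n| <= M
    & exists M : R, forall n, `|b n| <= M].

(* the class J(E) *)
Definition reflectionless_class (R : realType) (E : set R)
    : set ((int -> R) * (int -> R)) :=
  [set ab | [/\ jacobi_coeffs ab.1 ab.2,
                spectrum ab.1 ab.2 `<=` [set x%:C | x in E]
              & reflectionless E ab.1 ab.2]].

Definition toda_solution (R : realType) (a b : R -> int -> R) : Prop :=
  forall (t : R) (n : int),
    is_derive t (1 : R) (fun s : R => a s n : R)
      (a t n * (b t (n + 1) - b t n)) /\
    is_derive t (1 : R) (fun s : R => b s n : R)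
      (2 * (a t n ^+ 2 - a t (n - 1) ^+ 2)).

(* ]l, r[ is a bounded maximal open interval of the complement of E *)
Definition is_gap (R : realType) (E : set R) (l r : R) : Prop :=
  [/\ l < r, `]l, r[%classic `<=` ~` E
    & forall U : set R, open U -> is_interval U -> U `<=` ~` E ->
        `]l, r[%classic `<=` U -> U = `]l, r[%classic].

Definition gap_enumeration (R : realType) (E : set R) (I : countType)
    (Em Ep : I -> R) : Prop :=
  [/\ forall j, is_gap E (Em j) (Ep j),
      injective (fun j => (Em j, Ep j))
    & forall l r, is_gap E l r -> exists j, Em j = l /\ Ep j = r].

Definition gap_length (R : realType) (I : Type) (Em Ep : I -> R) (j : I) : R :=
  Ep j - Em j.

Definition gap_dist (R : realType) (I : Type) (Em Ep : I -> R) (j l : I) : R :=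
  Num.min `|Ep j - Em l| `|Em j - Ep l|.

Definition edge_dist (R : realType) (E : set R) (I : Type) (Em Ep : I -> R)
    (j : I) : R :=
  Num.min `|Ep j - sup E| `|Em j - inf E|.

(* Sums, quotients and suprema are taken in the extended reals, so that
   divergent sums are +oo; for x > 0 the quotient x / 0 is +oo (it occurs when
   two gaps, or a gap and an unbounded component of the complement, share an
   endpoint) *)
Definition craig_C (R : realType) (E : set R) (I : countType) (Em Ep : I -> R)
    (j : I) : \bar R :=
  ((Num.sqrt ((sup E - inf E) - edge_dist E Em Ep j))%:E *
   expeR ((2^-1)%:E *
     \esum_(k in [set k | k != j])
        ((gap_length Em Ep k)%:E / (gap_dist Em Ep j k)%:E)))%E.

Definition craig_condition (R : realType) (E : set R) (I : countType)
    (Em Ep : I -> R) : Prop :=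
  [/\ (ereal_sup [set (gap_length Em Ep j)%:E * craig_C E Em Ep j
                  | j in [set: I]] < +oo)%E,
      (ereal_sup [set (gap_length Em Ep j)%:E / (edge_dist E Em Ep j)%:E *
                      craig_C E Em Ep j | j in [set: I]] < +oo)%E
    & (ereal_sup [set \esum_(k in [set k | k != j])
                        ((Num.sqrt (gap_length Em Ep j * gap_length Em Ep k))%:E
                         / (gap_dist Em Ep j k)%:E * craig_C E Em Ep j)
                  | j in [set: I]] < +oo)%E].

(* The order on R[i] is the one for which w < 0 means that w is real and
   negative; green is real on real points of the resolvent set. *)
Definition is_dirichlet_datum (R : realType) (a b : int -> R) (l r : R)
    (mu : R) : Prop :=
  [\/ l < mu < r /\ green a b 0 mu%:C = 0,
      mu = r /\ (forall x, l < x < r -> green a b 0 x%:C < 0)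
    | mu = l /\ (forall x, l < x < r -> 0 < green a b 0 x%:C)].

(* The Dirichlet datum at site 0 in the gap ]l, r[; it exists and is unique for
   (a, b) in J(E) because green a b 0 is continuous and strictly increasing on
   the gap. *)
Definition dirichlet_datum (R : realType) (a b : int -> R) (l r : R) : R :=
  xget l [set mu | is_dirichlet_datum a b l r mu].

Definition discrete_subset (T : topologicalType) (S : set T) : Prop :=
  S `<=` isolated S.

(* Main.v *)
Require Import Defs.
From HB Require Import structures.
From mathcomp Require Import all_boot all_order all_algebra.
From mathcomp Require Import complex.
From mathcomp Require Import all_classical all_reals all_analysis.
From mathcomp Require Import measurable_realfun.
From mathcomp Require Import zify ring lra.

Set Implicit Arguments.
Unset Strict Implicit.
Unset Printing Implicit Defensive.

Import Order.TTheory GRing.Theory Num.Theory.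
Import numFieldNormedType.Exports.

Local Open Scope classical_set_scope.
Local Open Scope ring_scope.

(** Fix a point x of the gap and let y, z be solutions of J u = x u which are
    square summable at the two ends of Z and evolve by the Lax flow u' = P u of
    J' = P J - J P.  Their values at site 0 satisfy the Schroedinger equation
    y'' = q y in time, with q = (x - b_0)^2 - 2 a_0^2 - 2 a_(-1)^2, and the
    diagonal Green function is G = y z up to a constant.  Therefore G, together
    with H = G' / 2 and K = y' z', solves the linear system G' = 2 H,
    H' = q G + K, K' = 2 q H on the level set H^2 - G K = 1
    ([is_derive_greenG], [is_derive_greenH], [is_derive_greenK] and
    [greenH_disc]).  Near a given time q is bounded uniformly in x, since the
    diagonal coefficients stay between inf E and sup E
    ([class_diagonal_bound]) and the off-diagonal ones then grow at most
    exponentially ([toda_offdiagonal_local]).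

    On a short time interval [p, p + T] a solution G of this system is close to
    a quadratic polynomial of discriminant 4; when G is small at both ends, |G|
    is therefore close to T / 2 at the midpoint ([midpoint_bounds]).  If the
    Dirichlet datum sits at the gap edge lam at the times p and p + T, then G
    has one sign on the whole gap and is monotone in x, so that it has a finite
    limit as x tends to lam.  By the dichotomy below this limit is 0 at both
    times, so that at the time p + T / 2 the values of G near lam stay between
    T / 4 and T, with a finite and nonzero limit.  The dichotomy excludes this.

    The dichotomy ([green_edge_dichotomy]): at a gap edge the Green function of
    a reflectionless operator tends to 0 or is unbounded.  Suppose that it has
    a finite limit g <> 0 ([edge_limit_zero]).  The nonnegative harmonic
    function 1/2 - Re (g / (F + i |g|)), where F is the Green function on the
    upper half-plane, is 0 where F = g, and has boundary value 1/2 almost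
    everywhere on E, where F becomes purely imaginary.  By a Poisson inequality
    its value at height c above a gap point at distance c from lam is at least
    a constant times the measure of E near lam divided by c
    ([reflectionless_measure]).  By the Craig condition E has density at least
    1/2 on the outer side of lam ([density_left], [density_right]): the sum of
    the ratios of gap length to gap distance converges, so that nearby gaps are
    short.  Hence this value stays bounded below.  On the other hand G changes
    little between the distances H / 2 and H from lam, so that its derivative
    times c is small at some distance c in between, and F is then close to g also at height c
    ([green_off_axis]), so that the value is small.

    Operator theory enters through elementary resolvent identities on the
    square summable sequences only, and the Poisson inequality through Cauchy's
    theorem on rectangles for functions with two bounded complex derivatives
    ([is_derive_segint], [cauchy_horizontal]). *)

(** * Sums over the integers *)

Lemma esumZl {R : realType} {T : choiceType} (P : set T) (f : T -> \bar R)
    (c : R) : 0 <= c -> (forall n, (0 <= f n)%E) ->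
  (\esum_(n in P) (c%:E * f n) = c%:E * \esum_(n in P) f n)%E.
Proof.
move=> c0 f0; rewrite /esum -ereal_supZl//; last first.
  by apply/set0P; exists (\sum_(i \in set0) f i)%E, set0 => //; exact: fsets_set0.
congr ereal_sup; apply/seteqP; split.
  move=> _ [X FX <-]; exists (\sum_(i \in X) f i)%E; first by exists X.
  by rewrite ge0_mule_fsumr.
move=> _ [_ [X FX <-] <-]; exists X => //.
by rewrite ge0_mule_fsumr.
Qed.

Section Sums.
Context {R : realType}.
Implicit Types f g : int -> R.

Definition summablez f := (\esum_(n in [set: int]) `|f n|%:E < +oo)%E.

Definition psumz f : R := fine (\esum_(n in [set: int]) (f n)%:E).

(** Both families are nonnegative, so that linearity reduces to the additivity
    and homogeneity of sums of nonnegative families. *)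
Definition sumz f : R :=
  psumz (fun n => `|f n| + f n) - psumz (fun n => `|f n|).

Lemma psumzE f : (forall n, 0 <= f n) -> summablez f ->
  (\esum_(n in [set: int]) (f n)%:E)%E = (psumz f)%:E.
Proof.
move=> f0 sf; rewrite fineK// ge0_fin_numE; last first.
  by apply: esum_ge0 => n _; rewrite lee_fin.
apply: le_lt_trans sf; apply: le_esum => n _.
by rewrite lee_fin ler_norm.
Qed.

Lemma summablez_le f g : summablez g -> (forall n, `|f n| <= g n) ->
  summablez f.
Proof.
move=> sg fg; apply: le_lt_trans sg; apply: le_esum => n _.
by rewrite lee_fin (le_trans (fg n))// ler_norm.
Qed.

Lemma summablezD f g : summablez f -> summablez g ->
  summablez (fun n => f n + g n).
Proof.
move=> sf sg.
apply: (@le_lt_trans _ _ (\esum_(n in [set: int]) (`|f n|%:E + `|g n|%:E))%E).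
  by apply: le_esum => n _; rewrite -EFinD lee_fin ler_normD.
by rewrite esumD//; exact: lte_add_pinfty.
Qed.

Lemma summablez_norm f : summablez f -> summablez (fun n => `|f n|).
Proof.
by move=> sf; apply: le_lt_trans sf; apply: le_esum => n _; rewrite normr_id.
Qed.

Lemma psumzD f g : (forall n, 0 <= f n) -> (forall n, 0 <= g n) ->
  summablez f -> summablez g ->
  psumz (fun n => f n + g n) = psumz f + psumz g.
Proof.
move=> f0 g0 sf sg; apply: EFin_inj; rewrite EFinD -!psumzE//.
- rewrite -esumD//; do ?by move=> n _; rewrite lee_fin.
- by move=> n; rewrite addr_ge0.
- exact: summablezD.
Qed.

Lemma le_psumz f g : (forall n, 0 <= f n <= g n) -> summablez g ->
  psumz f <= psumz g.
Proof.
move=> fg sg; rewrite -lee_fin -!psumzE//.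
- by apply: le_esum => n _; rewrite lee_fin; case/andP: (fg n).
- by move=> n; case/andP: (fg n) => /le_trans; apply.
- by move=> n; case/andP: (fg n).
- by apply: (summablez_le sg) => n; case/andP: (fg n) => f0; rewrite ger0_norm.
Qed.

Lemma psumz_ge0 f : (forall n, 0 <= f n) -> 0 <= psumz f.
Proof. by move=> f0; apply: fine_ge0; apply: esum_ge0 => n _; rewrite lee_fin. Qed.

Lemma summablez_normD f : summablez f -> summablez (fun n => `|f n| + f n).
Proof. by move=> sf; apply: summablezD => //; exact: summablez_norm. Qed.

Lemma norm_add_ge0 f n : 0 <= `|f n| + f n.
Proof. by have := ler_norm (- f n); rewrite normrN; lra. Qed.

Lemma sumz_ge0E f : (forall n, 0 <= f n) -> summablez f -> sumz f = psumz f.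
Proof.
move=> f0 sf; have nf := summablez_norm sf.
rewrite /sumz (psumzD (fun n => normr_ge0 (f n)) f0 nf sf); ring.
Qed.

Lemma eq_sumz f g : (forall n, f n = g n) -> sumz f = sumz g.
Proof. by move=> fg; congr sumz; apply/funext. Qed.

Lemma sumzD f g : summablez f -> summablez g ->
  sumz (fun n => f n + g n) = sumz f + sumz g.
Proof.
move=> sf sg; have sfg := summablezD sf sg.
have nf := summablez_norm sf; have ng := summablez_norm sg.
have nfg := summablez_norm sfg.
have pf := summablez_normD sf; have pg := summablez_normD sg.
have pfg := summablez_normD sfg.
have [af ag] := (@norm_add_ge0 f, @norm_add_ge0 g).
have afg := @norm_add_ge0 (fun n => f n + g n).
suff : psumz (fun n => `|f n + g n| + (f n + g n)) +
       (psumz (fun n => `|f n|) + psumz (fun n => `|g n|)) =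
       psumz (fun n => `|f n + g n|) +
       (psumz (fun n => `|f n| + f n) + psumz (fun n => `|g n| + g n)).
  by rewrite /sumz; lra.
rewrite -!psumzD//.
- by congr psumz; apply/funext => n; ring.
all: try by move=> n; rewrite addr_ge0.
all: first [exact: (summablezD nf ng)|exact: (summablezD pf pg)|assumption].
Qed.

Lemma sumz0 : sumz (fun=> 0) = 0.
Proof. by rewrite /sumz normr0 addr0 subrr. Qed.

Lemma summablez0 : summablez (fun=> 0).
Proof. by rewrite /summablez esum1// => n _; rewrite normr0. Qed.

Lemma summablezN f : summablez f -> summablez (fun n => - f n).
Proof. by move=> sf; apply: summablez_le (summablez_norm sf) _ => n; rewrite normrN. Qed.

Lemma sumzN f : summablez f -> sumz (fun n => - f n) = - sumz f.
Proof.
move=> sf; apply/eqP; rewrite -subr_eq0 opprK -sumzD//; last exact: summablezN.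
by apply/eqP; rewrite -[RHS]sumz0; apply: eq_sumz => n; rewrite addNr.
Qed.

Lemma summablezZ (c : R) f : summablez f -> summablez (fun n => c * f n).
Proof.
move=> sf; have sn := summablez_norm sf.
have [k ck] : exists k : nat, `|c| <= k%:R.
  by exists (Num.truncn `|c|).+1; exact/ltW/truncnS_gt.
have H : summablez (fun n => `|f n| *+ k).
  elim: k {ck} => [|k IH].
    by under eq_fun do rewrite mulr0n; exact: summablez0.
  by under eq_fun do rewrite mulrS; exact: summablezD.
by apply: summablez_le H _ => n; rewrite normrM -mulr_natl ler_wpM2r.
Qed.

Lemma psumzZ (c : R) f : 0 <= c -> (forall n, 0 <= f n) -> summablez f ->
  psumz (fun n => c * f n) = c * psumz f.
Proof.
move=> c0 f0 sf; apply: EFin_inj; rewrite EFinM -!psumzE//.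
- exact: (@esumZl _ _ setT (fun n => (f n)%:E)).
- by move=> n; rewrite mulr_ge0.
- exact: summablezZ.
Qed.

Lemma sumzZ (c : R) f : summablez f -> sumz (fun n => c * f n) = c * sumz f.
Proof.
move=> sf.
wlog c0 : c / 0 <= c.
  move=> H; have [/H//|c0] := leP 0 c.
  have := H (- c) ltac:(lra).
  under eq_sumz do rewrite mulNr.
  by rewrite sumzN ?mulNr; [exact: oppr_inj|exact: summablezZ].
rewrite /sumz mulrBr -!psumzZ//.
- congr (psumz _ - psumz _); apply/funext => n; first rewrite mulrDr; by
  rewrite normrM (ger0_norm c0).
- exact: summablez_norm.
- by move=> n; exact: norm_add_ge0.
- exact: summablez_normD.
Qed.

Lemma psumz_shift f (k : int) : psumz (fun n => f (n + k)) = psumz f.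
Proof.
congr fine; rewrite [RHS](@reindex_esum _ _ _ setT _ (fun n => n + k))//.
split => //=; first by move=> ? ? _ _ /addIr.
by move=> n _; exists (n - k) => //; rewrite subrK.
Qed.

Lemma sumz_shift f (k : int) : sumz (fun n => f (n + k)) = sumz f.
Proof.
rewrite /sumz -(psumz_shift (fun n => `|f n| + f n) k).
by rewrite -(psumz_shift (fun n => `|f n|) k).
Qed.

Lemma summablez_shift f (k : int) : summablez f -> summablez (fun n => f (n + k)).
Proof.
rewrite /summablez.
rewrite (@reindex_esum _ _ _ setT _ (fun n => n + k) (fun n => `|f n|%:E))//.
split => //=; first by move=> ? ? _ _ /addIr.
by move=> n _; exists (n - k) => //; rewrite subrK.
Qed.

Lemma ge_psumz f m : (forall n, 0 <= f n) -> summablez f -> f m <= psumz f.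
Proof.
move=> f0 sf; rewrite -lee_fin -psumzE//; apply: esum_ge.
exists [set m]; last by rewrite fsbig_set1.
by split.
Qed.

Lemma sumz_delta f m : (forall n, n != m -> f n = 0) ->
  summablez f /\ sumz f = f m.
Proof.
move=> fm.
have H (g : int -> R) : (forall n, n != m -> g n = 0) -> (forall n, 0 <= g n) ->
    (\esum_(n in [set: int]) (g n)%:E)%E = (g m)%:E.
  move=> gm g0; rewrite -(@esum_set1 _ _ m (fun n => (g n)%:E)) ?lee_fin//.
  rewrite [RHS]esum_mkcond; apply: eq_esum => n _.
  by case: ifPn => //; rewrite notin_setE => /eqP /gm ->.
split.
  rewrite /summablez H ?ltry// => n nm; by rewrite fm ?normr0.
rewrite /sumz /psumz !H//=; first by ring.
- by move=> n nm; rewrite fm ?normr0.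
- by move=> n nm; rewrite fm ?normr0 ?addr0.
- by move=> n; exact: norm_add_ge0.
Qed.

End Sums.

(** * The Hilbert space of square summable sequences *)

Section Ell2.
Context {R : realType}.
Implicit Types (u v w : int -> R[i]) (c x : R) (z : R[i]).

Definition sqc z : R := complex.Re z ^+ 2 + complex.Im z ^+ 2.

Definition rprod z1 z2 : R :=
  complex.Re z1 * complex.Re z2 + complex.Im z1 * complex.Im z2.

(** The real part of the inner product; its imaginary part is recovered by
    multiplying one argument by i. *)
Definition rdot u v : R := sumz (fun n => rprod (u n) (v n)).

Definition nrm2 u : R := rdot u u.

Definition addz u v : int -> R[i] := fun n => u n + v n.
Definition scalez z u : int -> R[i] := fun n => z * u n.
Definition mulz (a : int -> R) u : int -> R[i] := fun n => (a n)%:C%C * u n.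
Definition shiftz (k : int) u : int -> R[i] := fun n => u (n + k).

Lemma sqc_ge0 z : 0 <= sqc z.
Proof. by rewrite addr_ge0 ?sqr_ge0. Qed.

Lemma normc_sqc z : Normc.normc z ^+ 2 = sqc z.
Proof. by case: z => a b; rewrite /= sqr_sqrtr ?addr_ge0 ?sqr_ge0. Qed.

Lemma sqcM z1 z2 : sqc (z1 * z2) = sqc z1 * sqc z2.
Proof. by case: z1 => ? ?; case: z2 => ? ?; rewrite /sqc /=; ring. Qed.

Lemma sqcD_le z1 z2 : sqc (z1 + z2) <= 2 * sqc z1 + 2 * sqc z2.
Proof.
case: z1 => a b; case: z2 => c d; rewrite /sqc /=.
by have := sqr_ge0 (a - c); have := sqr_ge0 (b - d); rewrite !expr2; lra.
Qed.

Lemma sqcN z : sqc (- z) = sqc z.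
Proof. by case: z => a b; rewrite /sqc /= !sqrrN. Qed.

Lemma ell2P u : ell2 u <-> summablez (fun n => sqc (u n)).
Proof.
rewrite /ell2 /summablez /l2sq /=.
suff -> : (\esum_(n in [set: int]) (Normc.normc (u n) ^+ 2)%:E)%E =
  (\esum_(n in [set: int]) (`|sqc (u n)|)%:E)%E by [].
by apply: eq_esum => n _; rewrite normc_sqc ger0_norm// sqc_ge0.
Qed.

Lemma nrm2E u : nrm2 u = sumz (fun n => sqc (u n)).
Proof. by apply: eq_sumz => n; rewrite /rprod /sqc !expr2. Qed.

Lemma l2sqE u : ell2 u -> l2sq u = (nrm2 u)%:E.
Proof.
move=> /ell2P uE; rewrite nrm2E sumz_ge0E//; last by move=> n; exact: sqc_ge0.
rewrite -psumzE//; last by move=> n; exact: sqc_ge0.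
by apply: eq_esum => n _; rewrite normc_sqc.
Qed.

Lemma rprod_le z1 z2 : `|rprod z1 z2| <= sqc z1 + sqc z2.
Proof.
case: z1 => a b; case: z2 => c d; rewrite /rprod /sqc /=.
have := sqr_ge0 (a - c); have := sqr_ge0 (b - d).
have := sqr_ge0 (a + c); have := sqr_ge0 (b + d).
have := sqr_ge0 a; have := sqr_ge0 b; have := sqr_ge0 c; have := sqr_ge0 d.
by rewrite !expr2 ler_norml => *; apply/andP; split; lra.
Qed.

Lemma summablez_rprod u v : ell2 u -> ell2 v ->
  summablez (fun n => rprod (u n) (v n)).
Proof.
move=> /ell2P su /ell2P sv; apply: summablez_le (summablezD su sv) _ => n.
exact: rprod_le.
Qed.

Lemma ell2D u v : ell2 u -> ell2 v -> ell2 (addz u v).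
Proof.
move=> /ell2P su /ell2P sv; apply/ell2P.
apply: summablez_le (summablezD (summablezZ 2 su) (summablezZ 2 sv)) _ => n.
by rewrite ger0_norm ?sqc_ge0// sqcD_le.
Qed.

Lemma ell2Z z u : ell2 u -> ell2 (scalez z u).
Proof.
move=> /ell2P su; apply/ell2P; under eq_fun do rewrite sqcM.
exact: summablezZ.
Qed.

Lemma ell2_shift k u : ell2 u -> ell2 (shiftz k u).
Proof. by move=> /ell2P su; apply/ell2P; exact: summablez_shift su. Qed.

Lemma sqc_real c : sqc c%:C%C = c ^+ 2.
Proof. by rewrite /sqc /= expr0n addr0. Qed.

Lemma mulz_le (a : int -> R) M u n : (forall n, `|a n| <= M) ->
  sqc (mulz a u n) <= M ^+ 2 * sqc (u n).
Proof.
move=> aM; rewrite /mulz sqcM sqc_real ler_wpM2r ?sqc_ge0//.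
rewrite -ler_sqrt ?sqr_ge0// !sqrtr_sqr (le_trans (aM n))// ler_norm //.
Qed.

Lemma ell2_mul (a : int -> R) M u : (forall n, `|a n| <= M) ->
  ell2 u -> ell2 (mulz a u).
Proof.
move=> aM /ell2P su; apply/ell2P; apply: summablez_le (summablezZ (M ^+ 2) su) _.
by move=> n; rewrite ger0_norm ?sqc_ge0 ?mulz_le.
Qed.

Lemma ell2_delta m : ell2 (delta R m).
Proof.
apply/ell2P; have [] := @sumz_delta R (fun n => sqc (delta R m n)) m => // n.
by rewrite /delta => /negbTE ->; rewrite /sqc /= expr0n addr0.
Qed.

Lemma rdotC u v : rdot u v = rdot v u.
Proof. by apply: eq_sumz => n; rewrite /rprod; ring. Qed.

Lemma rdotDl u v w : ell2 u -> ell2 v -> ell2 w ->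
  rdot (addz u v) w = rdot u w + rdot v w.
Proof.
move=> eu ev ew; rewrite -sumzD; try exact: summablez_rprod.
apply: eq_sumz => n; rewrite /addz /rprod.
by case: (u n) => ? ?; case: (v n) => ? ?; case: (w n) => ? ? /=; ring.
Qed.

Lemma rdotDr u v w : ell2 u -> ell2 v -> ell2 w ->
  rdot u (addz v w) = rdot u v + rdot u w.
Proof. by move=> eu ev ew; rewrite rdotC rdotDl// !(rdotC u). Qed.

Lemma rdotZl c u v : ell2 u -> ell2 v ->
  rdot (scalez c%:C%C u) v = c * rdot u v.
Proof.
move=> eu ev; rewrite -sumzZ; last exact: summablez_rprod.
apply: eq_sumz => n; rewrite /scalez /rprod.
by case: (u n) => ? ?; case: (v n) => ? ? /=; ring.
Qed.

Lemma rdotZr c u v : ell2 u -> ell2 v ->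
  rdot u (scalez c%:C%C v) = c * rdot u v.
Proof. by move=> eu ev; rewrite rdotC rdotZl// rdotC. Qed.

Lemma rdot_shift k u v : rdot (shiftz k u) v = rdot u (shiftz (- k) v).
Proof.
rewrite /rdot -[RHS](sumz_shift _ k); apply: eq_sumz => n.
by rewrite /shiftz addrK.
Qed.

Lemma rdot_mul a u v : rdot (mulz a u) v = rdot u (mulz a v).
Proof.
apply: eq_sumz => n; rewrite /mulz /rprod.
by case: (u n) => ? ?; case: (v n) => ? ? /=; ring.
Qed.

Lemma rdot_delta m u : rdot (delta R m) u = complex.Re (u m).
Proof.
have H n : n != m -> rprod (delta R m n) (u n) = 0.
  by rewrite /delta => /negbTE ->; rewrite /rprod /= !mul0r addr0.
have [_ E] := sumz_delta H; rewrite [LHS]E.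
by rewrite /delta eqxx /rprod /= mul0r addr0 mul1r.
Qed.

Lemma nrm2_ge0 u : ell2 u -> 0 <= nrm2 u.
Proof.
move=> /ell2P su; rewrite nrm2E sumz_ge0E//; last by move=> n; exact: sqc_ge0.
by apply: psumz_ge0 => n; exact: sqc_ge0.
Qed.

Lemma sqc_le_nrm2 u n : ell2 u -> sqc (u n) <= nrm2 u.
Proof.
move=> /ell2P su; rewrite nrm2E sumz_ge0E//; last by move=> m; exact: sqc_ge0.
by apply: (@ge_psumz R (fun n => sqc (u n)) n) => // m; exact: sqc_ge0.
Qed.

Lemma nrm2Z z u : ell2 u -> nrm2 (scalez z u) = sqc z * nrm2 u.
Proof.
move=> /ell2P su; rewrite !nrm2E -sumzZ//.
by apply: eq_sumz => n; rewrite -sqcM.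
Qed.

Lemma nrm2_shift k u : nrm2 (shiftz k u) = nrm2 u.
Proof. by rewrite !nrm2E -(sumz_shift (fun n => sqc (u n)) k). Qed.

Lemma nrm2_mul (a : int -> R) M u : (forall n, `|a n| <= M) -> ell2 u ->
  nrm2 (mulz a u) <= M ^+ 2 * nrm2 u.
Proof.
move=> aM eu; rewrite !nrm2E; have /ell2P su := eu.
rewrite -sumzZ// !sumz_ge0E//.
- apply: le_psumz => [n|]; first by rewrite sqc_ge0 mulz_le.
  exact: summablezZ.
- by move=> n; rewrite mulr_ge0 ?sqr_ge0 ?sqc_ge0.
- exact: summablezZ.
- by move=> n; exact: sqc_ge0.
- exact: (proj1 (ell2P _) (ell2_mul aM eu)).
Qed.

Lemma nrm2D u v : ell2 u -> ell2 v ->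
  nrm2 (addz u v) = nrm2 u + 2 * rdot u v + nrm2 v.
Proof.
move=> eu ev; have euv := ell2D eu ev.
by rewrite /nrm2 rdotDl// !rdotDr// (rdotC v u); ring.
Qed.

Lemma nrm2D_le u v : ell2 u -> ell2 v ->
  nrm2 (addz u v) <= 2 * nrm2 u + 2 * nrm2 v.
Proof.
move=> eu ev.
have := nrm2_ge0 (ell2D eu (ell2Z (-1)%:C%C ev)).
rewrite !nrm2D//; last exact: ell2Z.
rewrite rdotZr// nrm2Z// sqc_real; lra.
Qed.

Lemma rdot_CS u v : ell2 u -> ell2 v -> rdot u v ^+ 2 <= nrm2 u * nrm2 v.
Proof.
move=> eu ev.
have Nv := nrm2_ge0 ev; have Nu := nrm2_ge0 eu.
have H c : 0 <= nrm2 u + 2 * c * rdot u v + c ^+ 2 * nrm2 v.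
  have := nrm2_ge0 (ell2D eu (ell2Z c%:C%C ev)).
  by rewrite nrm2D//; [rewrite rdotZr// nrm2Z// sqc_real; lra|exact: ell2Z].
have [v0|v0] := eqVneq (nrm2 v) 0.
  rewrite v0 mulr0; have [->|r0] := eqVneq (rdot u v) 0; first by rewrite expr0n.
  have := H (- (nrm2 u + 1) / (2 * rdot u v)); rewrite v0 mulr0 addr0.
  have -> : 2 * (- (nrm2 u + 1) / (2 * rdot u v)) * rdot u v = - (nrm2 u + 1).
    by field.
  by lra.
have vp : 0 < nrm2 v by rewrite lt_neqAle eq_sym v0.
have := H (- rdot u v / nrm2 v).
have -> : nrm2 u + 2 * (- rdot u v / nrm2 v) * rdot u v +
   (- rdot u v / nrm2 v) ^+ 2 * nrm2 v = (nrm2 u * nrm2 v - rdot u v ^+ 2) / nrm2 v.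
  by field.
by rewrite pmulr_lge0 ?invr_gt0// subr_ge0.
Qed.

(** Multiplication by the imaginary unit is skew-adjoint. *)
Lemma rdot_i u v : ell2 u -> ell2 v ->
  rdot (scalez 'i%C u) v = - rdot u (scalez 'i%C v).
Proof.
move=> eu ev; rewrite -sumzN; last by apply: summablez_rprod => //; exact: ell2Z.
apply: eq_sumz => n; rewrite /scalez /rprod.
by case: (u n) => ? ?; case: (v n) => ? ? /=; ring.
Qed.

End Ell2.
#[global] Opaque sumz ell2.

(** * Jacobi operators and their resolvents *)

Local Open Scope complex_scope.

Definition coeffs_le {R : realType} (a b : int -> R) (M : R) :=
  forall n, `|a n| <= M /\ `|b n| <= M.

Lemma coeffs_le_exists {R : realType} (a b : int -> R) :
  jacobi_coeffs a b -> exists M, coeffs_le a b M.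
Proof.
move=> [_ [A aA] [B bB]]; exists (Num.max A B) => n.
by rewrite !le_max aA bB orbT.
Qed.

Lemma eq_ell2 {R : realType} (u v : int -> R[i]) :
  (forall n, sqc (u n) = sqc (v n)) -> ell2 v -> ell2 u.
Proof.
move=> uv /ell2P sv; apply/ell2P.
by rewrite (_ : (fun n => _) = fun n => sqc (v n))//; apply/funext.
Qed.

Lemma sqc_i {R : realType} : sqc ('i : R[i]) = 1.
Proof. by rewrite /sqc /=; ring. Qed.

Lemma rdot_i0 {R : realType} (u : int -> R[i]) : ell2 u ->
  rdot (scalez 'i u) u = 0.
Proof.
move=> eu; have := rdot_i eu eu.
rewrite (rdotC u); lra.
Qed.

Section Jacobi.
Context {R : realType} (a b : int -> R).
Implicit Types (u v f g : int -> R[i]) (z w : R[i]) (x y : R).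

Notation J := (jacobi a b).
Notation Jz := (jacobi_shift a b).

Lemma jacobiE u :
  J u = addz (addz (mulz a (shiftz 1 u)) (mulz b u)) (shiftz (-1) (mulz a u)).
Proof. by []. Qed.

Lemma jacobiD u v : J (addz u v) = addz (J u) (J v).
Proof. by apply/funext => n; rewrite /jacobi /addz; ring. Qed.

Lemma jacobiZ z u : J (scalez z u) = scalez z (J u).
Proof. by apply/funext => n; rewrite /jacobi /scalez; ring. Qed.

Lemma jacobi_shiftE z u : Jz z u = addz (J u) (scalez (- z) u).
Proof. by apply/funext => n; rewrite /jacobi_shift /addz /scalez mulNr. Qed.

Lemma jacobi_shiftD z u v : Jz z (addz u v) = addz (Jz z u) (Jz z v).
Proof. by apply/funext => n; rewrite /jacobi_shift jacobiD /addz; ring. Qed.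

Lemma jacobi_shiftZ z w u : Jz z (scalez w u) = scalez w (Jz z u).
Proof. by apply/funext => n; rewrite /jacobi_shift jacobiZ /scalez; ring. Qed.

Context (M : R) (abM : coeffs_le a b M).

Let aM n : `|a n| <= M := proj1 (abM n).
Let bM n : `|b n| <= M := proj2 (abM n).

Lemma ell2_jacobi u : ell2 u -> ell2 (J u).
Proof.
move=> eu; rewrite jacobiE; apply: ell2D; first apply: ell2D.
- by apply: ell2_mul aM _; exact: ell2_shift.
- exact: ell2_mul bM eu.
- by apply: ell2_shift; exact: ell2_mul aM eu.
Qed.

Lemma nrm2_jacobi u : ell2 u -> nrm2 (J u) <= 10 * M ^+ 2 * nrm2 u.
Proof.
move=> eu; rewrite jacobiE.
have e1 := ell2_shift 1 eu.
have e2 := ell2_mul aM e1; have e3 := ell2_mul bM eu.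
have e4 := ell2_shift (-1) (ell2_mul aM eu).
have h1 := nrm2D_le (ell2D e2 e3) e4; have h2 := nrm2D_le e2 e3.
have := nrm2_mul aM e1; have := nrm2_mul bM eu; have := nrm2_mul aM eu.
move: h1 h2; rewrite !nrm2_shift; lra.
Qed.

Lemma rdot_jacobi u v : ell2 u -> ell2 v -> rdot (J u) v = rdot u (J v).
Proof.
move=> eu ev; rewrite !jacobiE.
have [u1 v1] := (ell2_shift 1 eu, ell2_shift 1 ev).
have [u2 v2] := (ell2_mul aM u1, ell2_mul aM v1).
have [u3 v3] := (ell2_mul bM eu, ell2_mul bM ev).
have [u4 v4] := (ell2_shift (-1) (ell2_mul aM eu), ell2_shift (-1) (ell2_mul aM ev)).
rewrite (rdotDl (ell2D u2 u3) u4 ev) (rdotDl u2 u3 ev).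
rewrite (rdotDr eu (ell2D v2 v3) v4) (rdotDr eu v2 v3).
rewrite (rdot_shift (-1)) opprK.
have -> : rdot (mulz a (shiftz 1 u)) v = rdot u (shiftz (-1) (mulz a v)).
  by rewrite rdot_mul rdot_shift.
have -> : rdot (mulz a u) (shiftz 1 v) = rdot u (mulz a (shiftz 1 v)).
  by rewrite rdot_mul.
by rewrite (rdot_mul b); ring.
Qed.

Lemma ell2_jacobi_shift z u : ell2 u -> ell2 (Jz z u).
Proof.
move=> eu; rewrite jacobi_shiftE; apply: ell2D; first exact: ell2_jacobi.
exact: ell2Z.
Qed.

Lemma rdot_jacobi_shift x u v : ell2 u -> ell2 v ->
  rdot (Jz x%:C u) v = rdot u (Jz x%:C v).
Proof.
move=> eu ev; rewrite !jacobi_shiftE.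
have -> : - x%:C = (- x)%:C :> R[i] by rewrite rmorphN.
have [Ju Jv] := (ell2_jacobi eu, ell2_jacobi ev).
have [cu cv] := (ell2Z (- x)%:C eu, ell2Z (- x)%:C ev).
rewrite (rdotDl Ju cu ev) (rdotDr eu Jv cv).
by rewrite (rdot_jacobi eu ev) (rdotZl _ eu ev) (rdotZr _ eu ev).
Qed.

Section Resolvent.
Context (z : R[i]) (zR : resolvent_set a b z).
Notation Rz := (resolvent a b z).

Lemma resolventP f : ell2 f -> ell2 (Rz f) /\ Jz z (Rz f) = f.
Proof.
move=> ef; have [_ [K H]] := zR; have [u [eu uf _]] := H _ ef.
by rewrite /resolvent; case: xgetP => [v _ [? ?]//|/(_ u)]; case; split.
Qed.

Lemma ell2_resolvent f : ell2 f -> ell2 (Rz f).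
Proof. by move=> /resolventP[]. Qed.

Lemma resolvent_uniq u f : ell2 u -> Jz z u = f -> u = Rz f.
Proof.
move=> eu uf; have ef : ell2 f by rewrite -uf; exact: ell2_jacobi_shift.
have [er rf] := resolventP ef; have [inj _] := zR.
by apply: inj => //; rewrite uf rf.
Qed.

Lemma resolvent_bounded : exists2 K, 0 < K &
  forall f, ell2 f -> nrm2 (Rz f) <= K * nrm2 f.
Proof.
have [_ [K H]] := zR; exists (`|K| + 1); first by rewrite ltr_pwDr.
move=> f ef; have [u [eu uf uK]] := H _ ef.
rewrite -(resolvent_uniq eu uf); move: uK; rewrite !l2sqE// -EFinM lee_fin.
move=> /le_trans; apply; rewrite ler_wpM2r ?nrm2_ge0//.
by have := ler_norm K; lra.
Qed.

Lemma resolventD f g : ell2 f -> ell2 g -> Rz (addz f g) = addz (Rz f) (Rz g).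
Proof.
move=> ef eg; apply/esym; apply: resolvent_uniq.
  by apply: ell2D; exact: ell2_resolvent.
by rewrite jacobi_shiftD (proj2 (resolventP ef)) (proj2 (resolventP eg)).
Qed.

Lemma resolventZ c f : ell2 f -> Rz (scalez c f) = scalez c (Rz f).
Proof.
move=> ef; apply/esym; apply: resolvent_uniq.
  by apply: ell2Z; exact: ell2_resolvent.
by rewrite jacobi_shiftZ (proj2 (resolventP ef)).
Qed.

Lemma resolventK u : ell2 u -> Rz (Jz z u) = u.
Proof. by move=> eu; rewrite -(resolvent_uniq eu erefl). Qed.

End Resolvent.

Lemma resolvent_identity z w f :
  resolvent_set a b z -> resolvent_set a b w -> ell2 f ->
  resolvent a b w f =
  addz (resolvent a b z f) (scalez (w - z) (resolvent a b w (resolvent a b z f))).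
Proof.
move=> zR wR ef; apply/esym; apply: resolvent_uniq => //.
  apply: ell2D; first exact: ell2_resolvent.
  by apply: ell2Z; apply: ell2_resolvent => //; exact: ell2_resolvent.
have ez := ell2_resolvent zR ef.
rewrite jacobi_shiftD jacobi_shiftZ (proj2 (resolventP wR ez)).
rewrite -[RHS](proj2 (resolventP zR ef)).
by apply/funext => n; rewrite /addz /scalez /jacobi_shift; ring.
Qed.

(** Pairing the equation with i u isolates the imaginary part of z, since J
    is symmetric. *)
Lemma imaginary_pairing x y f : resolvent_set a b (x +i* y) -> ell2 f ->
  rdot (scalez 'i (resolvent a b (x +i* y) f)) f =
  - y * nrm2 (resolvent a b (x +i* y) f).
Proof.
move=> zR ef; set u := resolvent _ _ _ f.
have [eu uf] : ell2 u /\ Jz (x +i* y) u = f by exact: resolventP.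
rewrite -[X in rdot _ X]uf jacobi_shiftE.
have -> : scalez (- (x +i* y)) u =
    addz (scalez (- x)%:C u) (scalez (- y)%:C (scalez 'i u)).
  apply/funext => n; rewrite /scalez /addz; case: (u n) => p q.
  by apply/eqP; rewrite eq_complex /=; apply/andP; split; apply/eqP; ring.
have ei := ell2Z 'i eu; have eJ := ell2_jacobi eu.
have e1 := ell2Z (- x)%:C eu; have e2 := ell2Z (- y)%:C ei.
rewrite (rdotDr ei eJ (ell2D e1 e2)) (rdotDr ei e1 e2).
rewrite (rdotZr _ ei eu) (rdotZr _ ei ei) (rdot_i0 eu) mulr0 add0r.
have -> : rdot (scalez 'i u) (J u) = 0.
  have h1 := rdot_i eu eJ; have h2 := rdot_jacobi eu ei.
  by move: h1 h2; rewrite jacobiZ (rdotC (J u)); move: (rdot _ _) (rdot _ _) => p q; lra.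
by rewrite -/(nrm2 (scalez 'i u)) (nrm2Z _ eu) sqc_i; ring.
Qed.

Lemma resolvent_im_bound x y f : resolvent_set a b (x +i* y) -> ell2 f ->
  y ^+ 2 * nrm2 (resolvent a b (x +i* y) f) <= nrm2 f.
Proof.
move=> zR ef; have eu := ell2_resolvent zR ef.
have := rdot_CS (ell2Z 'i eu) ef; rewrite (imaginary_pairing zR ef) (nrm2Z _ eu) sqc_i mul1r.
set N := nrm2 (resolvent _ _ _ _) => H.
have [N0|N0] := leP N 0.
  by rewrite (@le_trans _ _ 0) ?nrm2_ge0// mulr_ge0_le0 ?sqr_ge0.
by rewrite -(ler_pM2l N0); move: H; rewrite exprMn sqrrN !expr2; lra.
Qed.

Lemma im_resolvent_delta x y n : resolvent_set a b (x +i* y) ->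
  complex.Im (resolvent a b (x +i* y) (delta R n) n) =
  y * nrm2 (resolvent a b (x +i* y) (delta R n)).
Proof.
move=> zR; have := imaginary_pairing zR (ell2_delta n).
rewrite rdotC rdot_delta /scalez.
by case: (resolvent _ _ _ _ n) => p q /=; lra.
Qed.

Definition realz u := forall n, complex.Im (u n) = 0.

Lemma realz_delta n : realz (delta R n).
Proof. by move=> m; rewrite /delta; case: ifP. Qed.

Lemma realzE u n : realz u -> u n = (complex.Re (u n))%:C.
Proof. by move=> /(_ n); case: (u n) => p q /= ->. Qed.

Lemma resolvent_real x f : resolvent_set a b x%:C -> ell2 f -> realz f ->
  realz (resolvent a b x%:C f).
Proof.
move=> xR ef rf; set u := resolvent _ _ _ _.
have [eu uf] : ell2 u /\ Jz x%:C u = f by exact: resolventP.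
suff uc : (fun n => (u n)^*) = u.
  by move=> n; have := congr1 (fun v => v n) uc; case: (u n) => p q /= [] h; lra.
apply: (resolvent_uniq xR).
  by apply: (eq_ell2 _ eu) => n; rewrite /sqc; case: (u n) => p q /=; rewrite sqrrN.
rewrite -uf; apply/funext => n.
have := congr1 (fun v => v n) uf; rewrite /jacobi_shift /jacobi /=.
have := rf n; rewrite -uf /jacobi_shift /jacobi.
case: (u (n + 1)) => p1 q1; case: (u n) => p q; case: (u (n - 1)) => p2 q2 /=.
move=> h _; apply/eqP; rewrite eq_complex /=; apply/andP; split; apply/eqP.
  ring.
by rewrite h; move: h; lra.
Qed.

Lemma rdot_resolvent x f g : resolvent_set a b x%:C -> ell2 f -> ell2 g ->
  rdot (resolvent a b x%:C f) g = rdot f (resolvent a b x%:C g).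
Proof.
move=> xR ef eg.
have [eu uf] := resolventP xR ef; have [ev vg] := resolventP xR eg.
by rewrite -[X in rdot _ X = _]vg -[X in _ = rdot X _]uf rdot_jacobi_shift.
Qed.

End Jacobi.

(** * Dependence of the resolvent on the spectral parameter *)

Lemma is_derive_quadratic {R : realType} (f : R -> R) (x d : R) :
  (exists C e : R, 0 < e /\ forall h, `|h| < e ->
     `|f (x + h) - f x - h * d| <= C * h ^+ 2) ->
  is_derive x (1 : R) f d.
Proof.
move=> [C [e [e0 H]]].
have C0 : 0 <= `|C| + 1 by rewrite addr_ge0.
have L : (fun h : R => h^-1 *: (f (h *: (1 : R) + x) - f x)) @ 0^' --> d.
  apply/cvgrPdist_le => eps eps0.
  near=> h.
  have h0 : h != 0 by near: h; exact: nbhs_dnbhs_neq.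
  have he : `|h| < e.
    by near: h; apply: dnbhs0_lt.
  have hC : `|h| < eps / (`|C| + 1).
    by near: h; apply: dnbhs0_lt; rewrite divr_gt0// ltr_pwDr.
  rewrite /GRing.scale /= mulr1 [h + x]addrC.
  have -> : d - h^-1 * (f (x + h) - f x) = - h^-1 * (f (x + h) - f x - h * d).
    by field.
  rewrite normrM normrN normfV mulrC ler_pdivrMr ?normr_gt0//.
  apply: (le_trans (H _ he)).
  apply: (@le_trans _ _ ((`|C| + 1) * h ^+ 2)).
    by rewrite ler_wpM2r ?sqr_ge0//; have := ler_norm C; lra.
  rewrite -[h ^+ 2]real_normK ?num_real// expr2 mulrA.
  rewrite ler_wpM2r// mulrC -ler_pdivlMr ?ltr_pwDr//; exact: ltW.
apply: DeriveDef; last exact/cvg_lim.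
by apply/cvg_ex; exists d.
Unshelve. all: by end_near.
Qed.

Lemma MVT_is_derive {R : realType} (f df : R -> R) (a b : R) : a < b ->
  (forall x, a <= x <= b -> is_derive x (1 : R) f (df x)) ->
  exists2 c, a < c < b & f b - f a = df c * (b - a).
Proof.
move=> ab H.
have H1 x : x \in `]a, b[%R -> is_derive x (1 : R) f (df x).
  by rewrite in_itv /= => /andP[ax xb]; apply: H; rewrite !ltW.
have H2 : {within `[a, b], continuous f}.
  apply: derivable_within_continuous => x; rewrite in_itv /= => xab.
  by have := H x xab => -[].
have [c cab E] := MVT ab H1 H2.
by exists c => //; move: cab; rewrite in_itv.
Qed.

Section Expansion.
Context {R : realType} (a b : int -> R) (M : R) (abM : coeffs_le a b M).
Implicit Types (f g : int -> R[i]) (z w : R[i]) (x y : R).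

Notation Rs := (resolvent a b).
Notation res := (resolvent_set a b).

Lemma resolvent_identity_l z w f : res z -> res w -> ell2 f ->
  Rs w f = addz (Rs z f) (scalez (w - z) (Rs z (Rs w f))).
Proof.
move=> zR wR ef; have := resolvent_identity abM wR zR ef => E.
rewrite [in RHS]E; apply/funext => n; rewrite /addz /scalez.
by rewrite -(opprB w z); ring.
Qed.

Lemma resolvent_bound_near z w K f : res z -> res w ->
  (forall f, ell2 f -> nrm2 (Rs z f) <= K * nrm2 f) ->
  4 * K * sqc (w - z) <= 1 -> ell2 f -> nrm2 (Rs w f) <= 4 * K * nrm2 f.
Proof.
move=> zR wR HK small ef.
have ew := ell2_resolvent wR ef; have ez := ell2_resolvent zR ef.
have ezw := ell2_resolvent zR ew.
have h1 := nrm2D_le ez (ell2Z (w - z) ezw).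
rewrite -(resolvent_identity_l zR wR ef) (nrm2Z _ ezw) in h1.
have h2 := HK _ ef; have h3 := HK _ ew.
have N0 := nrm2_ge0 ew.
have h4 := ler_wpM2l (sqc_ge0 (w - z)) h3.
have h5 := ler_wpM2r N0 small.
move: h1 h2 h4 h5 N0; move: (nrm2 _) (nrm2 _) (nrm2 _) (nrm2 _) (sqc _).
by move=> p q r s t *; lra.
Qed.

Lemma resolvent_second_order z w f : res z -> res w -> ell2 f ->
  Rs w f = addz (addz (Rs z f) (scalez (w - z) (Rs z (Rs z f))))
    (scalez ((w - z) ^+ 2) (Rs w (Rs z (Rs z f)))).
Proof.
move=> zR wR ef; have ez := ell2_resolvent zR ef.
rewrite {1}(resolvent_identity abM zR wR ef).
rewrite {1}(resolvent_identity abM zR wR ez).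
by apply/funext => n; rewrite /addz /scalez; ring.
Qed.

Lemma rdot_le (u v : int -> R[i]) : ell2 u -> ell2 v ->
  `|rdot u v| <= nrm2 u + nrm2 v.
Proof.
move=> eu ev; have e := ell2Z (-1)%:C ev.
have := nrm2_ge0 (ell2D eu ev); have := nrm2_ge0 (ell2D eu e).
have := nrm2_ge0 eu; have := nrm2_ge0 ev.
rewrite !nrm2D// rdotZr// nrm2Z// sqc_real ler_norml => *.
by apply/andP; split; lra.
Qed.

Lemma rC_sub x y : x%:C - y%:C = (x - y)%:C.
Proof. by rewrite rmorphB. Qed.

Lemma is_derive_resolvent x g f :
  (\forall y \near x, res y%:C) -> ell2 g -> ell2 f ->
  is_derive x (1 : R) (fun y => rdot g (Rs y%:C f))
    (rdot g (Rs x%:C (Rs x%:C f))).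
Proof.
move=> nx eg ef; have xR : res x%:C by exact: nbhs_singleton nx.
have [K K0 HK] := resolvent_bounded abM xR.
have [e /= e0 He] := nx.
have e1 := ell2_resolvent xR ef; have e2 := ell2_resolvent xR e1.
pose e' := Num.min e (Num.min 1 (4 * K)^-1).
apply: is_derive_quadratic.
exists (nrm2 g + 4 * K * nrm2 (Rs x%:C (Rs x%:C f))), e'; split.
  by rewrite !lt_min e0 ltr01 invr_gt0 mulr_gt0.
move=> h; rewrite !lt_min => /and3P[he h1 hK].
have hR : res (x + h)%:C.
  by apply: He; rewrite /= opprD addrA subrr sub0r normrN.
have e3 := ell2_resolvent hR e2; have hE : x + h - x = h by ring.
rewrite (resolvent_second_order xR hR ef) rC_sub hE.
rewrite -rmorphXn/= (rdotDr eg (ell2D e1 (ell2Z _ e2)) (ell2Z _ e3)).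
rewrite (rdotDr eg e1 (ell2Z _ e2)) !rdotZr//.
set p := rdot _ _; set q := rdot _ _; set r := rdot _ _.
have -> : p + h * q + h ^+ 2 * r - p - h * q = r * h ^+ 2 by ring.
rewrite normrM [X in _ * X]ger0_norm ?sqr_ge0// ler_wpM2r ?sqr_ge0//.
apply: (le_trans (rdot_le eg e3)); rewrite lerD2l.
apply: (resolvent_bound_near xR hR HK _ e2).
rewrite rC_sub hE sqc_real.
have K4 : 0 < 4 * K by rewrite mulr_gt0.
rewrite -ler_pdivlMl// mulr1.
rewrite -[h ^+ 2]real_normK ?num_real// expr2 (le_trans _ (ltW hK))//.
by rewrite ler_piMr// ltW.
Qed.

End Expansion.

(** * The diagonal Green function *)

Lemma delta_diag {R : realType} n : delta R n n = 1.
Proof. by rewrite /delta eqxx. Qed.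

Lemma delta_succ {R : realType} n : delta R n (n + 1) = 0.
Proof. by rewrite /delta -[X in _ == X]addr0 (inj_eq (addrI n)). Qed.

Lemma delta_pred {R : realType} n : delta R n (n - 1) = 0.
Proof. by rewrite /delta -[X in _ == X]addr0 (inj_eq (addrI n)). Qed.

Section Green.
Context {R : realType} (a b : int -> R) (M : R) (abM : coeffs_le a b M).
Implicit Types (f g : int -> R[i]) (z w : R[i]) (x y : R).

Notation Rs := (resolvent a b).
Notation res := (resolvent_set a b).

Lemma near_resolvent_set x (e : R) : 0 < e ->
  (forall y, `|y - x| < e -> res y%:C) -> \forall y \near x, res y%:C.
Proof.
by move=> e0 H; apply/nbhs_ballP; exists e => //= y; rewrite /ball /= distrC => /H.
Qed.

Lemma resolvent_large x f : res x%:C -> ell2 f -> 40 * M ^+ 2 <= x ^+ 2 ->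
  x ^+ 2 * nrm2 (Rs x%:C f) <= 4 * nrm2 f.
Proof.
move=> xR ef xM; have [eu uf] := resolventP xR ef.
set u := Rs _ _ in eu uf *.
have E : scalez x%:C u = addz (jacobi a b u) (scalez (-1)%:C f).
  rewrite -[in RHS]uf; apply/funext => n.
  by rewrite /scalez /addz /jacobi_shift rmorphN rmorph1; ring.
have eJ := ell2_jacobi abM eu.
have := nrm2D_le eJ (ell2Z (-1)%:C ef); rewrite -E !nrm2Z// !sqc_real.
have h := nrm2_jacobi abM eu; have N0 := nrm2_ge0 eu.
have := ler_wpM2r N0 xM.
by move: h N0; move: (nrm2 u) (nrm2 _) (nrm2 _) => p q r; lra.
Qed.

(** The form of (J - x)^-1 is increasing in x and vanishes at infinity, hence
    has a sign on a ray of the resolvent set; evaluated on (J - x) delta_n it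
    is the n-th diagonal entry of J - x. *)
Lemma diagonal_bound_ray (s eps : R) n : eps ^+ 2 = 1 ->
  (forall t : R, 0 < t -> res (s + eps * t)%:C) -> eps * (b n - s) <= 0.
Proof.
move=> eps1 H.
apply/ler_addgt0Pr => /= t0 t0pos; rewrite add0r.
pose x0 := s + eps * t0.
have e0 : ell2 (delta R n) by exact: ell2_delta.
pose g := jacobi_shift a b x0%:C (delta R n).
have eg : ell2 g by exact: (ell2_jacobi_shift abM).
pose psi y := rdot g (Rs y%:C g).
pose phi (t : R) := eps * psi (s + eps * t).
have dpsi (t : R) : 0 < t -> is_derive (s + eps * t) (1 : R) psi
    (nrm2 (Rs (s + eps * t)%:C g)).
  move=> tp; set x := s + eps * t.
  have xR : res x%:C by exact: H.
  have nx : \forall y \near x, res y%:C.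
    apply: (near_resolvent_set tp) => y yx.
    have -> : y = s + eps * (eps * (y - s)).
      by rewrite mulrA -expr2 eps1; ring.
    apply: H; have -> : eps * (y - s) = t + eps * (y - x).
      rewrite /x; have -> : t + eps * (y - (s + eps * t)) =
        eps * (y - s) + (1 - eps ^+ 2) * t by ring.
      by rewrite eps1; ring.
    have ne : `|eps * (y - x)| < t.
      have -> : `|eps * (y - x)| = `|y - x|; last by [].
      rewrite normrM; have -> : `|eps| = 1; last by rewrite mul1r.
      by apply/eqP; rewrite -(@eqrXn2 _ 2)// -normrX eps1 normr1 expr1n.
    by move: ne; rewrite ltr_norml => /andP[]; lra.
  have := is_derive_resolvent abM nx eg eg.
  by rewrite -(rdot_resolvent abM xR eg (ell2_resolvent xR eg)).
have dphi (t : R) : 0 < t -> is_derive t (1 : R) phi (nrm2 (Rs (s + eps * t)%:C g)).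
  move=> tp; have d := dpsi _ tp.
  have d1 : is_derive t (1 : R) (fun t => s + eps * t) eps.
    apply: is_derive_quadratic; exists 0, 1; split => // h _.
    have -> : s + eps * (t + h) - (s + eps * t) - h * eps = 0 by ring.
    by rewrite normr0 mul0r.
  have d2 := @is_derive1_comp R psi (fun t => s + eps * t) t _ _ d d1.
  have d3 := is_deriveZ eps d2.
  apply: (is_derive_eq d3).
  rewrite /GRing.scale /=; set N := nrm2 _.
  have -> : eps * (N * eps) = eps ^+ 2 * N by ring.
  by rewrite eps1 mul1r.
have phi_t0 : phi t0 = eps * (b n - x0).
  rewrite /phi /psi -/x0 (resolventK abM (H _ t0pos) e0) rdotC rdot_delta.
  congr (eps * _); rewrite /g /jacobi_shift /jacobi.
  by rewrite delta_succ delta_pred delta_diag /=; ring.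
suff phi_le0 : phi t0 <= 0.
  move: phi_le0; rewrite phi_t0 /x0 => h.
  have -> : eps * (b n - s) = eps * (b n - (s + eps * t0)) + eps ^+ 2 * t0 by ring.
  rewrite eps1; lra.
rewrite leNgt; apply/negP => phipos.
have mono (t : R) : t0 < t -> phi t0 <= phi t.
  move=> t0t.
  have dp (x : R) : t0 <= x <= t ->
      is_derive x (1 : R) phi (nrm2 (Rs (s + eps * x)%:C g)).
    by move=> /andP[h _]; apply: dphi; lra.
  have [c cab E] := MVT_is_derive t0t dp.
  rewrite -subr_ge0 E mulr_ge0//; last by rewrite subr_ge0 ltW.
  have c0 : 0 < c by case/andP: cab => h _; exact: lt_trans t0pos h.
  exact: nrm2_ge0 (ell2_resolvent (H _ c0) eg).
have small (t : R) : 0 < t -> 40 * M ^+ 2 <= (s + eps * t) ^+ 2 ->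
    (s + eps * t) ^+ 2 * phi t ^+ 2 <= 4 * nrm2 g ^+ 2.
  move=> tp hM; have xR := H _ tp.
  have h1 := resolvent_large xR eg hM.
  have h2 := rdot_CS eg (ell2_resolvent xR eg).
  rewrite /phi exprMn eps1 mul1r /psi.
  apply: (le_trans (ler_wpM2l (sqr_ge0 _) h2)).
  have := ler_wpM2l (nrm2_ge0 eg) h1; rewrite !expr2.
  by move: (nrm2 _) (nrm2 _) => p q; lra.
have N0 := nrm2_ge0 eg; move: (nrm2 g) N0 small => N N0 small.
clear dphi dpsi phi_t0; clearbody phi.
pose q := 3 * N / phi t0.
have q0 : 0 <= q by apply: divr_ge0 (ltW phipos); rewrite mulr_ge0.
have m0 := normr_ge0 M.
have s0 : 0 <= eps * s + `|s|.
  have -> : `|s| = `|eps * s|.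
    rewrite normrM; have -> : `|eps| = 1; last by rewrite mul1r.
    by apply/eqP; rewrite -(@eqrXn2 _ 2)// -normrX eps1 normr1 expr1n.
  by have := ler_norm (- (eps * s)); rewrite normrN; lra.
pose X := `|s| + t0 + 7 * `|M| + 1 + q.
have X0 : t0 < X by have := normr_ge0 s; rewrite /X; move: m0 q0; clear; lra.
have sX : (7 * `|M| + 1 + q) ^+ 2 <= (s + eps * X) ^+ 2.
  have -> : (s + eps * X) ^+ 2 = (eps * s + X) ^+ 2.
    have -> : (eps * s + X) ^+ 2 = eps ^+ 2 * s ^+ 2 + 2 * eps * s * X + X ^+ 2 by ring.
    have -> : (s + eps * X) ^+ 2 = s ^+ 2 + 2 * eps * s * X + eps ^+ 2 * X ^+ 2 by ring.
    by rewrite eps1; ring.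
  by rewrite ler_pXn2r ?nnegrE//; rewrite /X; move: s0 m0 q0 t0pos; clear; lra.
have Xp : 0 < X by exact: lt_trans t0pos X0.
have hM : 40 * M ^+ 2 <= (s + eps * X) ^+ 2.
  apply: le_trans sX; rewrite -(real_normK (num_real M)).
  move: m0 q0; clear; clearbody q; move: `|M| => m m0 q0.
  have := mulr_ge0 m0 q0; have := sqr_ge0 q; have := sqr_ge0 m; rewrite !expr2; lra.
have h1 : phi t0 <= phi X by exact: mono.
have h2 : (1 + q) ^+ 2 <= (s + eps * X) ^+ 2.
  apply: le_trans sX; rewrite ler_pXn2r ?nnegrE//; move: m0 q0; clear; lra.
have h3 : (1 + q) * phi t0 = phi t0 + 3 * N.
  by rewrite /q mulrDl mul1r divfK ?gt_eqF.
have h4 : phi t0 ^+ 2 <= phi X ^+ 2.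
  by rewrite ler_pXn2r ?nnegrE//; [exact: ltW|exact: le_trans (ltW phipos) h1].
have := small _ Xp hM; apply/negP; rewrite -ltNge.
apply: (@lt_le_trans _ _ ((1 + q) ^+ 2 * phi t0 ^+ 2)).
  rewrite -exprMn h3; move: N0 phipos (sqr_ge0 N) (mulr_gt0 phipos phipos).
  move: (phi t0) => p; clear => N0 p0; have := mulr_ge0 N0 (ltW p0).
  by rewrite !expr2; lra.
by apply: ler_pM; rewrite ?sqr_ge0.
Qed.

Definition greenR x : R := complex.Re (green a b 0 x%:C).

Lemma green_real x : res x%:C -> green a b 0 x%:C = (greenR x)%:C.
Proof.
move=> xR; rewrite /greenR; apply: realzE.
exact: (resolvent_real abM xR (ell2_delta 0) (@realz_delta R 0)).
Qed.

Lemma is_derive_green x : (\forall y \near x, res y%:C) ->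
  is_derive x (1 : R) greenR (nrm2 (Rs x%:C (delta R 0))).
Proof.
move=> nx; have xR : res x%:C by exact: nbhs_singleton nx.
have e0 := @ell2_delta R 0.
have := is_derive_resolvent abM nx e0 e0.
rewrite -(rdot_resolvent abM xR e0 (ell2_resolvent xR e0)) -/(nrm2 _).
by rewrite (_ : (fun y => _) = greenR)//; apply/funext => y; rewrite rdot_delta.
Qed.

Lemma im_green x y : res (x +i* y) ->
  complex.Im (green a b 0 (x +i* y)) = y * nrm2 (Rs (x +i* y) (delta R 0)).
Proof. exact: im_resolvent_delta. Qed.

(** With u = (J - x)^-1 delta_0 and v = (J - z)^-1 u, the difference is i y v_0,
    and moving J - x across the pairing turns v_0 into the pairing of u with
    u + i y v, where i y v is at most as long as u. *)
Lemma green_off_axis x y : res x%:C -> res (x +i* y) ->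
  sqc (green a b 0 (x +i* y) - green a b 0 x%:C) <=
  5 * y ^+ 2 * nrm2 (Rs x%:C (delta R 0)) ^+ 2.
Proof.
move=> xR zR; have e0 := @ell2_delta R 0.
set z := x +i* y in zR *; set d := delta R 0 in e0 *.
have [eu uf] := resolventP xR e0; set u := Rs x%:C d in eu uf *.
have [ev vf] := resolventP zR eu; set v := Rs z u in ev vf *.
have -> : green a b 0 z - green a b 0 x%:C = (y *i) * v 0.
  rewrite /green (resolvent_identity abM xR zR e0) /addz /scalez -/u -/v.
  have -> : z - x%:C = y *i by apply/eqP; rewrite eq_complex /= subrr subr0 !eqxx.
  by ring.
rewrite sqcM {1}/sqc /= expr0n /= add0r -mulrA mulrCA ler_wpM2l ?sqr_ge0//.
pose w := scalez (y *i) v.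
have ew : ell2 w by exact: ell2Z.
have Jv : jacobi_shift a b x%:C v = addz u w.
  rewrite -[u in RHS]vf; apply/funext => n; rewrite /jacobi_shift /addz /w /scalez /z.
  have -> : x +i* y = x%:C + y *i by apply/eqP; rewrite eq_complex /= addr0 add0r !eqxx.
  ring.
have Nw : nrm2 w <= nrm2 u.
  rewrite nrm2Z// /sqc /= expr0n /= add0r.
  exact: (resolvent_im_bound abM zR eu).
have N0 := nrm2_ge0 eu.
have re : complex.Re (v 0) = nrm2 u + rdot u w.
  by rewrite -rdot_delta -/d -uf (rdot_jacobi_shift abM _ eu ev) Jv (rdotDr eu eu ew).
have ei := ell2Z 'i eu.
have im : complex.Im (v 0) = rdot (scalez 'i u) w.
  have -> : complex.Im (v 0) = rdot (scalez 'i d) v.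
    rewrite (rdot_i e0 ev) rdot_delta /scalez.
    by case: (v 0) => p q /=; ring.
  have -> : scalez 'i d = jacobi_shift a b x%:C (scalez 'i u).
    by rewrite jacobi_shiftZ uf.
  by rewrite (rdot_jacobi_shift abM _ ei ev) Jv (rdotDr ei eu ew) rdot_i0// add0r.
have h1 := rdot_CS eu ew; have h2 := rdot_CS ei ew.
rewrite (nrm2Z _ eu) sqc_i mul1r in h2.
have h3 := ler_wpM2l N0 Nw.
rewrite /sqc re im.
move: h1 h2 h3 N0; move: (nrm2 u) (rdot _ _) (rdot _ _) (nrm2 w) => p q r s.
have := sqr_ge0 (p - q); have := sqr_ge0 (p - r); rewrite !expr2; lra.
Qed.

End Green.

(** * Cauchy's theorem on horizontal lines *)

Section Line.
Context {R : realType}.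
Implicit Types (f g F : R -> R) (p q : R).

Definition segint f p q : R :=
  (\int[@lebesgue_measure R]_(x in `[p, q]) f x)%R.

Lemma lipschitz_continuous f (C : R) :
  (forall x y, `|f y - f x| <= C * `|y - x|) -> continuous f.
Proof.
move=> H x; apply/cvgrPdist_le => e e0.
have C0 : 0 < `|C| + 1 by rewrite ltr_pwDr.
near=> y; rewrite distrC; apply: (le_trans (H x y)).
apply: (@le_trans _ _ ((`|C| + 1) * `|y - x|)).
  by rewrite ler_wpM2r//; have := ler_norm C; lra.
rewrite mulrC -ler_pdivlMr// distrC.
near: y; apply: cvgr_dist_le; last by rewrite divr_gt0.
exact: cvg_id.
Unshelve. all: by end_near.
Qed.

Lemma continuous_integrable f p q : continuous f ->
  (@lebesgue_measure R).-integrable `[p, q] (EFin \o f).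
Proof.
move=> cf; apply: continuous_compact_integrable; first exact: segment_compact.
exact: continuous_subspaceT.
Qed.

Lemma segintB f g p q : continuous f -> continuous g ->
  segint (fun x => f x - g x) p q = segint f p q - segint g p q.
Proof.
by move=> cf cg; apply: RintegralB => //; exact: continuous_integrable.
Qed.

Lemma segintZ (c : R) f p q : continuous f ->
  segint (fun x => c * f x) p q = c * segint f p q.
Proof. by move=> cf; apply: RintegralZl => //; exact: continuous_integrable. Qed.

Lemma le_segint f g p q : continuous f -> continuous g ->
  (forall x, p <= x <= q -> f x <= g x) -> segint f p q <= segint g p q.
Proof.
move=> cf cg fg; apply: le_Rintegral => //; exact: continuous_integrable.
Qed.

Lemma segint_cst (c : R) p q : p <= q -> segint (fun=> c) p q = c * (q - p).
Proof.
move=> pq; rewrite /segint Rintegral_cst//.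
have -> : fine (lebesgue_measure `[p, q]) = q - p; last by [].
rewrite lebesgue_measure_itv/= lte_fin.
by have [_//|qp] := ltP p q; rewrite (_ : q = p) ?subrr//; apply/le_anti/andP.
Qed.

Lemma normr_segint_le f (C : R) p q : p <= q -> continuous f ->
  (forall x, p <= x <= q -> `|f x| <= C) -> `|segint f p q| <= C * (q - p).
Proof.
move=> pq cf fC; rewrite ler_norml -mulNr -!segint_cst//.
have cc (c : R) : continuous (fun _ : R => c) by move=> x; exact: cvg_cst.
by apply/andP; split; apply: le_segint => // x /fC; rewrite ler_norml => /andP[].
Qed.

Lemma segint_FTC f F p q : p < q -> continuous f ->
  (forall x, is_derive x (1 : R) F (f x)) -> segint f p q = F q - F p.
Proof.
move=> pq cf dF; rewrite /segint /Rintegral.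
have cF : continuous F.
  by move=> x; apply/differentiable_continuous/derivable1_diffP; case: (dF x).
rewrite (@continuous_FTC2 _ _ F)//.
- exact: continuous_subspaceT.
- split; first by move=> x _; case: (dF x).
  + by apply: cvg_at_right_filter; exact: cF.
  + by apply: cvg_at_left_filter; exact: cF.
- by move=> x _; rewrite derive1E; exact: derive_val.
Qed.

End Line.

Section Smooth.
Context {R : realType}.
Implicit Types (z w : R[i]) (f g : R[i] -> R[i]) (s C B c : R).

Notation nc := Normc.normc.

Lemma nc_ge0 z : 0 <= nc z.
Proof. by case: z => a b; rewrite sqrtr_ge0. Qed.

Lemma ncD z w : nc (z + w) <= nc z + nc w.
Proof. exact: le_normcD. Qed.

Lemma ncM z w : nc (z * w) = nc z * nc w.
Proof. exact: Normc.normcM. Qed.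

Lemma ncN z : nc (- z) = nc z.
Proof. exact: normcN. Qed.

Lemma Re_le_nc z : `|complex.Re z| <= nc z.
Proof.
case: z => a b /=; rewrite -sqrtr_sqr ler_wsqrtr//.
by rewrite lerDl sqr_ge0.
Qed.

Lemma Im_le_nc z : `|complex.Im z| <= nc z.
Proof.
case: z => a b /=; rewrite -sqrtr_sqr ler_wsqrtr//.
by rewrite lerDr sqr_ge0.
Qed.

Lemma nc_real (x : R) : nc x%:C = `|x|.
Proof. by rewrite /= expr0n addr0 sqrtr_sqr. Qed.

(** A quantitative form of analyticity with bounded second derivative on the
    half-plane Im z >= s. *)
Definition smooth_above s f f' C := 0 <= C /\ forall z w,
  s <= complex.Im z -> s <= complex.Im w ->
  [/\ nc (f' z) <= C, nc (f w - f z) <= C * nc (w - z) &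
      nc (f w - f z - (w - z) * f' z) <= C * nc (w - z) ^+ 2].

Definition bounded_above s f B := 0 <= B /\
  forall z, s <= complex.Im z -> nc (f z) <= B.

Lemma smooth_mul s f f' g g' C B C' B' :
  smooth_above s f f' C -> bounded_above s f B ->
  smooth_above s g g' C' -> bounded_above s g B' ->
  smooth_above s (fun z => f z * g z) (fun z => f' z * g z + f z * g' z)
    (B * C' + C * B' + C * C').
Proof.
move=> [C0 sf] [B0 bf] [C'0 sg] [B'0 bg]; split; first by rewrite !addr_ge0 ?mulr_ge0.
move=> z w hz hw; have [f1 f2 f3] := sf _ _ hz hw; have [g1 g2 g3] := sg _ _ hz hw.
have [bz bw] := (bf _ hz, bf _ hw); have [cz cw] := (bg _ hz, bg _ hw).
set H := nc (w - z) in f2 f3 g2 g3 *.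
have H0 : 0 <= H by exact: nc_ge0.
split.
- apply: (le_trans (ncD _ _)); rewrite !ncM.
  have := ler_pM (nc_ge0 _) (nc_ge0 _) f1 cz.
  have := ler_pM (nc_ge0 _) (nc_ge0 _) bz g1.
  by have := mulr_ge0 C0 C'0; lra.
- have -> : f w * g w - f z * g z = f w * (g w - g z) + (f w - f z) * g z by ring.
  apply: (le_trans (ncD _ _)); rewrite !ncM.
  have := ler_pM (nc_ge0 _) (nc_ge0 _) f2 cz.
  have := ler_pM (nc_ge0 _) (nc_ge0 _) bw g2.
  by have := mulr_ge0 (mulr_ge0 C0 C'0) H0; lra.
- have -> : f w * g w - f z * g z - (w - z) * (f' z * g z + f z * g' z) =
    f w * (g w - g z - (w - z) * g' z) + (f w - f z - (w - z) * f' z) * g z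
    + (f w - f z) * ((w - z) * g' z) by ring.
  apply: (le_trans (ncD _ _)); apply: (le_trans (lerD (ncD _ _) (lexx _))).
  rewrite !ncM -/H.
  have h1 := ler_pM (nc_ge0 _) (nc_ge0 _) bw g3.
  have h2 := ler_pM (nc_ge0 _) (nc_ge0 _) f3 cz.
  have h4 := ler_wpM2l H0 g1.
  have h3 := ler_pM (nc_ge0 _) (mulr_ge0 H0 (nc_ge0 _)) f2 h4.
  by apply: (le_trans (lerD (lerD h1 h2) h3)); rewrite expr2; lra.
Qed.

Lemma bounded_mul s f B g B' : bounded_above s f B -> bounded_above s g B' ->
  bounded_above s (fun z => f z * g z) (B * B').
Proof.
move=> [B0 bf] [B'0 bg]; split; first by rewrite mulr_ge0.
by move=> z hz; rewrite ncM; apply: ler_pM; rewrite ?nc_ge0 ?bf ?bg.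
Qed.

Lemma smooth_scale s f f' C : smooth_above s f f' C ->
  forall k, smooth_above s (fun z => k * f z) (fun z => k * f' z) (nc k * C).
Proof.
move=> [C0 sf] k; split; first by rewrite mulr_ge0 ?nc_ge0.
move=> z w hz hw; have [f1 f2 f3] := sf _ _ hz hw; split.
- by rewrite ncM ler_wpM2l ?nc_ge0.
- by rewrite -mulrBr ncM -mulrA ler_wpM2l ?nc_ge0.
- by rewrite mulrCA -!mulrBr ncM -mulrA ler_wpM2l ?nc_ge0.
Qed.

Lemma smooth_inv s f f' C c : 0 < c -> smooth_above s f f' C ->
  (forall z, s <= complex.Im z -> c <= nc (f z)) ->
  smooth_above s (fun z => (f z)^-1) (fun z => - (f' z * (f z)^-1 ^+ 2))
    (C * c^-1 ^+ 2 + C ^+ 2 * c^-1 ^+ 3).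
Proof.
move=> c0 [C0 sf] fc; set k := c^-1.
have k0 : 0 <= k by rewrite invr_ge0 ltW.
split; first by rewrite addr_ge0 ?mulr_ge0 ?exprn_ge0.
move=> z w hz hw; have [f1 f2 f3] := sf _ _ hz hw.
have inv v : s <= complex.Im v -> f v != 0 /\ nc (f v)^-1 <= k.
  move=> /fc cv; have v0 := lt_le_trans c0 cv; split.
    by apply: contraTneq v0 => ->; rewrite Normc.normc0 ltxx.
  by rewrite Normc.normcV lef_pV2.
have [z0 kz] := inv _ hz; have [w0 kw] := inv _ hw.
have za : f z * (f z)^-1 = 1 by rewrite divff.
have wb : f w * (f w)^-1 = 1 by rewrite divff.
set a := (f z)^-1 in za kz *; set b := (f w)^-1 in wb kw *.
set H := nc (w - z) in f2 f3 *; have H0 : 0 <= H by exact: nc_ge0.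
have na := nc_ge0 a; have nb := nc_ge0 b.
have ab : nc a * nc b <= k ^+ 2 by rewrite expr2 ler_pM.
have aa : nc a * nc a <= k ^+ 2 by rewrite expr2 ler_pM.
have aab : nc a * nc a * nc b <= k ^+ 3.
  by rewrite exprSr ler_pM// mulr_ge0.
have k20 : 0 <= k ^+ 2 by rewrite sqr_ge0.
have t0 : 0 <= C ^+ 2 * k ^+ 3 by rewrite mulr_ge0 ?exprn_ge0.
split.
- rewrite ncN ncM expr2 ncM.
  have := ler_pM (nc_ge0 _) (mulr_ge0 na na) f1 aa; lra.
- have -> : b - a = (f z - f w) * (a * b).
    have -> : (f z - f w) * (a * b) = (f z * a) * b - (f w * b) * a by ring.
    by rewrite za wb; ring.
  rewrite ncM -opprB ncN (ncM a).
  have := ler_pM (nc_ge0 _) (mulr_ge0 na nb) f2 ab.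
  by have := mulr_ge0 t0 H0; lra.
- have -> : b - a - (w - z) * - (f' z * a ^+ 2) =
    - ((f w - f z - (w - z) * f' z) * (a * b)) +
    (w - z) * (f' z * (f w - f z)) * (a * a * b).
    have -> : b - a = (f z - f w) * (a * b).
      have -> : (f z - f w) * (a * b) = (f z * a) * b - (f w * b) * a by ring.
      by rewrite za wb; ring.
    have -> : (w - z) * - (f' z * a ^+ 2) = - (w - z) * f' z * a ^+ 2 * (f w * b).
      by rewrite wb; ring.
    have -> : (w - z) * (f' z * (f w - f z)) * (a * a * b) =
      (w - z) * f' z * (f w * b) * (a * a) - (w - z) * f' z * (f z * a) * (a * b) by ring.
    by rewrite za wb; ring.
  apply: (le_trans (ncD _ _)); rewrite ncN !ncM -/H.
  have h1 := ler_pM (nc_ge0 _) (mulr_ge0 na nb) f3 ab.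
  have h2 := ler_pM (nc_ge0 _) (nc_ge0 _) f1 f2.
  have h3 := ler_wpM2l H0 h2.
  have h4 : H * (nc (f' z) * nc (f w - f z)) * (nc a * nc a * nc b) <=
            H * (C * (C * H)) * k ^+ 3.
    by apply: ler_pM => //; rewrite ?mulr_ge0 ?nc_ge0.
  by apply: (le_trans (lerD h1 h4)); rewrite !expr2; lra.
Qed.

Lemma smooth_affine s (w : R[i]) : smooth_above s (fun z => z - w) (fun=> 1) 1.
Proof.
split => // z v _ _; have E : v - w - (z - w) = v - z by ring.
rewrite E mul1r mulr1 subrr Normc.normc0 Normc.normc1 mul1r.
by split => //; rewrite sqr_ge0.
Qed.

Lemma smooth_derivative_lip s f f' C z w : smooth_above s f f' C ->
  s <= complex.Im z -> s <= complex.Im w ->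
  nc (f' w - f' z) <= 2 * C * nc (w - z).
Proof.
move=> [C0 sf] hz hw; have [_ _ f1] := sf _ _ hz hw; have [_ _ f2] := sf _ _ hw hz.
have [->|zw] := eqVneq w z; first by rewrite !subrr Normc.normc0 mulr0.
have H0 : 0 < nc (w - z).
  rewrite lt_neqAle nc_ge0 andbT eq_sym; apply: contraNneq zw => /Normc.eq0_normc.
  by move/eqP; rewrite subr_eq0.
rewrite -(ler_pM2r H0) -ncM.
have -> : (f' w - f' z) * (w - z) = (f w - f z - (w - z) * f' z) +
   (f z - f w - (z - w) * f' w) by ring.
apply: (le_trans (ncD _ _)); apply: (le_trans (lerD f1 f2)).
by rewrite -[z - w]opprB ncN expr2; lra.
Qed.

End Smooth.

(** * A Poisson inequality *)

Lemma eqW_le {R : realType} (x y : R) : x = y -> x <= y.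
Proof. by move->. Qed.

Section Horizontal.
Context {R : realType}.
Implicit Types (D : R[i] -> R[i]).

Notation nc := Normc.normc.

Lemma continuous_Re_line D D' s0 C s : smooth_above s0 D D' C -> s0 <= s ->
  continuous (fun x : R => complex.Re (D (x +i* s))).
Proof.
move=> [C0 sD] ss; apply: (@lipschitz_continuous _ _ C) => x y.
have [_ h _] := sD (x +i* s) (y +i* s) ss ss.
have := Re_le_nc (D (y +i* s) - D (x +i* s)).
rewrite (_ : complex.Re (_ - _) = complex.Re (D (y +i* s)) - complex.Re (D (x +i* s))); last first.
  by case: (D _) => ? ?; case: (D _) => ? ?.
move=> /le_trans; apply; apply: (le_trans h).
by rewrite /= subrr expr0n addr0 sqrtr_sqr.
Qed.

(** Differentiating under the integral and the Cauchy-Riemann equations leave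
    the boundary terms. *)
Lemma is_derive_segint D D' s0 C p q s : smooth_above s0 D D' C -> p < q ->
  s0 < s ->
  is_derive s (1 : R) (fun t => segint (fun x => complex.Re (D (x +i* t))) p q)
    (complex.Im (D (p +i* s)) - complex.Im (D (q +i* s))).
Proof.
move=> sD pq ss; have [C0 H] := sD.
pose k x := - complex.Im (D' (x +i* s)).
have ck : continuous k.
  apply: (@lipschitz_continuous _ _ (2 * C)) => x y.
  have h := smooth_derivative_lip (z := x +i* s) (w := y +i* s) sD (ltW ss) (ltW ss).
  have := Im_le_nc (D' (y +i* s) - D' (x +i* s)).
  rewrite (_ : complex.Im (_ - _) = complex.Im (D' (y +i* s)) - complex.Im (D' (x +i* s))); last first.
    by case: (D' _) => ? ?; case: (D' _) => ? ?.
  have -> : `|k y - k x| = `|complex.Im (D' (y +i* s)) - complex.Im (D' (x +i* s))|.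
    by rewrite /k -normrN; congr `| _ |; ring.
  move=> /le_trans; apply; apply: (le_trans h).
  by rewrite /= subrr expr0n addr0 sqrtr_sqr.
have dF (x : R) : is_derive x (1 : R) (fun x => - complex.Im (D (x +i* s))) (k x).
  apply: is_derive_quadratic; exists C, 1; split => // h _.
  have [_ _ H3] := H (x +i* s) ((x + h) +i* s) (ltW ss) (ltW ss).
  have E : ((x + h) +i* s) - (x +i* s) = h%:C.
    by apply/eqP; rewrite eq_complex /=; apply/andP; split; apply/eqP; ring.
  rewrite E nc_real real_normK ?num_real// in H3.
  apply: le_trans H3; apply: le_trans (Im_le_nc _); rewrite -normrN /k.
  case: (D _) => ? ?; case: (D _) => ? ?; case: (D' _) => ? ? /=.
  by apply: eqW_le; congr `| _ |; ring.
have -> : complex.Im (D (p +i* s)) - complex.Im (D (q +i* s)) = segint k p q.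
  by rewrite (segint_FTC pq ck dF); ring.
apply: is_derive_quadratic; exists (C * (q - p)), (s - s0); split.
  by rewrite subr_gt0.
move=> h hs.
have sh : s0 <= s + h by move: hs; rewrite ltr_norml; lra.
have c1 := continuous_Re_line sD sh; have c2 := continuous_Re_line sD (ltW ss).
have chk : continuous (fun x => h * k x).
  by move=> x; apply: cvgM; [exact: cvg_cst|exact: ck].
have c12 : continuous (fun x : R => complex.Re (D (x +i* (s + h))) - complex.Re (D (x +i* s))).
  by move=> x; apply: cvgB; [exact: c1|exact: c2].
rewrite -(segintB _ _ c1 c2) -(segintZ _ _ _ ck) -(segintB _ _ c12 chk).
rewrite mulrAC; apply: normr_segint_le; first exact: ltW.
  by move=> x; apply: cvgB; [exact: c12|exact: chk].
move=> x _.
have [_ _ H3] := H (x +i* s) (x +i* (s + h)) (ltW ss) sh.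
have E : (x +i* (s + h)) - (x +i* s) = h *i.
  by apply/eqP; rewrite eq_complex /=; apply/andP; split; apply/eqP; ring.
have E2 : nc (h *i) = `|h| by rewrite /= expr0n add0r sqrtr_sqr.
rewrite E E2 real_normK ?num_real// in H3.
apply: le_trans H3; apply: le_trans (Re_le_nc _); rewrite /k.
case: (D _) => ? ?; case: (D _) => ? ?; case: (D' _) => ? ? /=.
by apply: eqW_le; congr `| _ |; ring.
Qed.

(** The integral over a horizontal segment of length 2 L changes by O(1/L)
    when the segment is pushed up by y + L, and is O(1/L) there. *)
Lemma cauchy_horizontal D D' s0 C eps y x0 L : smooth_above s0 D D' C ->
  s0 < eps -> 0 < y -> y <= L ->
  (forall z, eps <= complex.Im z ->
     nc (D z) * (nc (z - (x0 +i* (eps + y))) * nc (z - (x0 +i* (eps - y)))) <= 2) ->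
  `|segint (fun x => complex.Re (D (x +i* eps))) (x0 - L) (x0 + L)| <= 12 / L.
Proof.
move=> sD se y0 yL dec; have L0 : 0 < L by exact: lt_le_trans yL.
have far z : eps <= complex.Im z -> L <= nc (z - (x0 +i* (eps + y))) ->
    L <= nc (z - (x0 +i* (eps - y))) -> nc (D z) <= 2 / L ^+ 2.
  move=> hz h1 h2; rewrite ler_pdivlMr ?exprn_gt0//.
  apply: le_trans (dec _ hz); rewrite ler_wpM2l ?nc_ge0// expr2.
  by apply: ler_pM => //; exact: ltW.
have side (sg : R) s : `|sg| = L -> eps <= s -> nc (D ((x0 + sg) +i* s)) <= 2 / L ^+ 2.
  move=> sgL es; apply: far => //.
    apply: le_trans (Re_le_nc _); rewrite /= -sgL.
    by apply: eqW_le; congr `| _ |; ring.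
  apply: le_trans (Re_le_nc _); rewrite /= -sgL.
  by apply: eqW_le; congr `| _ |; ring.
pose I s := segint (fun x => complex.Re (D (x +i* s))) (x0 - L) (x0 + L).
have top : `|I (eps + y + L)| <= 2 / L ^+ 2 * (x0 + L - (x0 - L)).
  apply: normr_segint_le; first lra.
    by apply: continuous_Re_line sD _; lra.
  move=> x _; apply: (le_trans (Re_le_nc _)); apply: far; first by rewrite /=; lra.
    apply: le_trans (Im_le_nc _); rewrite /=.
    by rewrite -[leLHS](ger0_norm (ltW L0)); apply: eqW_le; congr `| _ |; ring.
  apply: le_trans (Im_le_nc _); rewrite /= ger0_norm; lra.
pose dI s := complex.Im (D ((x0 - L) +i* s)) - complex.Im (D ((x0 + L) +i* s)).
have dD s : eps <= s <= eps + y + L -> is_derive s (1 : R) I (dI s).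
  by move=> /andP[es _]; apply: is_derive_segint sD _ _; lra.
have lt1 : eps < eps + y + L by lra.
have [c /andP[c1 c2] E] := MVT_is_derive lt1 dD.
have dIc : `|dI c| <= 4 / L ^+ 2.
  apply: (le_trans (ler_normB _ _)).
  have h1 := le_trans (Im_le_nc _) (side (- L) c ltac:(by rewrite normrN gtr0_norm) (ltW c1)).
  have h2 := le_trans (Im_le_nc _) (side L c ltac:(by rewrite gtr0_norm) (ltW c1)).
  by have := lerD h1 h2; lra.
rewrite -/(I eps).
have -> : I eps = I (eps + y + L) - dI c * (y + L).
  by have := E; rewrite (_ : eps + y + L - eps = y + L); [lra|ring].
apply: (le_trans (ler_normB _ _)); rewrite normrM (ger0_norm (x := y + L)); last lra.
have yL0 : 0 <= y + L by lra.
have h := ler_wpM2r yL0 dIc.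
have h2 : 4 / L ^+ 2 * (y + L) <= 4 / L ^+ 2 * (L + L).
  by rewrite ler_wpM2l ?lerD2r// divr_ge0// ltW// exprn_gt0.
apply: (le_trans (lerD top (le_trans h h2))).
apply: eqW_le; field; exact: lt0r_neq0.
Qed.

Lemma poisson_kernel_continuous (x0 y : R) : 0 < y ->
  continuous (fun x : R => ((x - x0) ^+ 2 + y ^+ 2)^-1).
Proof.
move=> y0 x; apply: cvgV.
  by rewrite gt_eqF// ltr_wpDl ?sqr_ge0// exprn_gt0.
apply: cvgD; last exact: cvg_cst.
have c1 : (fun x : R => x - x0) @ x --> x - x0.
  by apply: cvgB; [exact: cvg_id|exact: cvg_cst].
exact: (cvgM c1 c1).
Qed.

Lemma poisson_kernel_mass (x0 y L : R) : 0 < y -> 0 < L ->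
  segint (fun x => ((x - x0) ^+ 2 + y ^+ 2)^-1) (x0 - L) (x0 + L) <= 4 / y.
Proof.
move=> y0 L0.
have dF (x : R) : is_derive x (1 : R) (fun x => y^-1 * atan ((x - x0) / y))
    (((x - x0) ^+ 2 + y ^+ 2)^-1).
  have d1 : is_derive x (1 : R) (fun x => (x - x0) / y) y^-1.
    apply: is_derive_quadratic; exists 0, 1; split => // h _.
    have -> : (x + h - x0) / y - (x - x0) / y - h * y^-1 = 0 by ring.
    by rewrite normr0 mul0r.
  have d2 := @is_derive1_comp R (@atan R) (fun x => (x - x0) / y) x _ _ (is_derive1_atan _) d1.
  have d3 := is_deriveZ y^-1 d2.
  apply: (is_derive_eq d3); rewrite /GRing.scale /=.
  have yn : y != 0 by rewrite gt_eqF.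
  set u := x - x0; have q0 : u ^+ 2 + y ^+ 2 != 0.
    by rewrite gt_eqF// ltr_wpDl ?sqr_ge0// exprn_gt0.
  have -> : 1 + (u / y) ^+ 2 = (u ^+ 2 + y ^+ 2) / y ^+ 2 by field.
  by rewrite invf_div; field; apply/andP; split.
have LL : x0 - L < x0 + L by lra.
rewrite (segint_FTC LL (@poisson_kernel_continuous x0 y y0) dF).
rewrite -mulrBr mulrC ler_pM2r ?invr_gt0//.
have p2 := @pihalf_lt2 R.
have := @atan_ltpi2 R ((x0 + L - x0) / y).
have := @atan_gtNpi2 R ((x0 - L - x0) / y).
lra.
Qed.

End Horizontal.

(** * Reflectionless operators at a gap edge *)

Section Herglotz.
Context {R : realType} (a b : int -> R) (M : R) (abM : coeffs_le a b M).
Implicit Types (z w : R[i]).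

Notation nc := Normc.normc.
Notation Rs := (resolvent a b).
Notation res := (resolvent_set a b).

Context (upper : forall z, 0 < complex.Im z -> res z).

Notation F := (green a b 0).

Definition norm2 (u : int -> R[i]) : R := Num.sqrt (nrm2 u).

Lemma norm2_ge0 u : 0 <= norm2 u.
Proof. exact: sqrtr_ge0. Qed.

Lemma nc_le_norm2 u n : ell2 u -> nc (u n) <= norm2 u.
Proof.
move=> eu; rewrite -[leLHS](ger0_norm (nc_ge0 _)) -sqrtr_sqr normc_sqc.
by rewrite ler_wsqrtr// sqc_le_nrm2.
Qed.

Lemma norm2_resolvent s z f : 0 < s -> s <= complex.Im z -> ell2 f ->
  norm2 (Rs z f) <= s^-1 * norm2 f.
Proof.
move=> s0; case: z => x y /= sy ef; have y0 : 0 < y by exact: lt_le_trans sy.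
have zR : res (x +i* y) by exact: upper.
have h := resolvent_im_bound abM zR ef.
have N0 := nrm2_ge0 (ell2_resolvent zR ef).
rewrite ler_pdivlMl// -[leLHS](ger0_norm (mulr_ge0 (ltW s0) (norm2_ge0 _))).
rewrite -sqrtr_sqr exprMn (sqr_sqrtr N0).
rewrite ler_wsqrtr//; apply: le_trans h.
rewrite (ler_wpM2r N0)//.
by rewrite ler_pXn2r ?nnegrE// ltW.
Qed.

Lemma smooth_resolvent_entry s f m : 0 < s -> ell2 f ->
  smooth_above s (fun z => Rs z f m) (fun z => Rs z (Rs z f) m)
    (s^-1 ^+ 2 * norm2 f + s^-1 ^+ 3 * norm2 f) /\
  bounded_above s (fun z => Rs z f m) (s^-1 * norm2 f).
Proof.
move=> s0 ef; have k0 : 0 <= s^-1 by rewrite invr_ge0 ltW.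
have n0 := norm2_ge0 f.
have pos z : s <= complex.Im z -> res z.
  by move=> /(lt_le_trans s0) /upper.
have b1 z g : s <= complex.Im z -> ell2 g -> norm2 (Rs z g) <= s^-1 * norm2 g.
  by move=> hz eg; exact: norm2_resolvent.
have b2 z w g : s <= complex.Im z -> s <= complex.Im w -> ell2 g ->
    norm2 (Rs w (Rs z g)) <= s^-1 ^+ 2 * norm2 g.
  move=> hz hw eg; apply: (le_trans (b1 _ _ hw (ell2_resolvent (pos _ hz) eg))).
  by rewrite expr2 -mulrA ler_wpM2l// b1.
have p2 : 0 <= s^-1 ^+ 2 * norm2 f by rewrite mulr_ge0 ?exprn_ge0.
have p3 : 0 <= s^-1 ^+ 3 * norm2 f by rewrite mulr_ge0 ?exprn_ge0.
split; last first.
  split; first by rewrite mulr_ge0.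
  by move=> z hz; apply: (le_trans (nc_le_norm2 m (ell2_resolvent (pos _ hz) ef))); exact: b1.
split; first by rewrite addr_ge0.
move=> z w hz hw.
have ez := ell2_resolvent (pos _ hz) ef; have ezz := ell2_resolvent (pos _ hz) ez.
have ewz := ell2_resolvent (pos _ hw) ez; have ewzz := ell2_resolvent (pos _ hw) ezz.
have H0 := nc_ge0 (w - z).
split.
- apply: (le_trans (nc_le_norm2 m ezz)); apply: (le_trans (b2 _ _ _ hz hz ef)); lra.
- rewrite (resolvent_identity abM (pos _ hz) (pos _ hw) ef) /addz /scalez.
  rewrite addrC addKr ncM mulrC ler_wpM2r//.
  apply: (le_trans (nc_le_norm2 m ewz)); apply: (le_trans (b2 _ _ _ hz hw ef)); lra.
- rewrite (resolvent_second_order abM (pos _ hz) (pos _ hw) ef) /addz /scalez.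
  set A := Rs z f m; set B := Rs z (Rs z f) m; set Q := Rs w _ m.
  have -> : A + (w - z) * B + (w - z) ^+ 2 * Q - A - (w - z) * B = (w - z) ^+ 2 * Q by ring.
  rewrite ncM expr2 ncM -expr2 mulrC ler_wpM2r ?sqr_ge0//.
  apply: (le_trans (nc_le_norm2 m ewzz)); apply: (le_trans (b2 _ _ _ hz hw ez)).
  apply: (@le_trans _ _ (s^-1 ^+ 3 * norm2 f)); last lra.
  by rewrite [in leRHS]exprSr -mulrA ler_wpM2l ?exprn_ge0// b1.
Qed.

Lemma im_green_ge0 z : 0 < complex.Im z -> 0 <= complex.Im (F z).
Proof.
case: z => x y /= y0; have zR : res (x +i* y) by exact: upper.
rewrite (im_green abM zR); apply: mulr_ge0 (ltW y0) _.
exact: nrm2_ge0 (ell2_resolvent zR (ell2_delta 0)).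
Qed.

Context (g : R) (g0 : g != 0).

Let k0 : 0 < `|g|. Proof. by rewrite normr_gt0. Qed.

(** For a Herglotz function F, Re Phi attains its maximum 1/2 exactly where
    F = g, and vanishes where F is purely imaginary. *)
Definition Phi z : R[i] := g%:C / (F z + `|g| *i).

(** Harmonic and nonnegative on the upper half-plane. *)
Definition defect z : R := 1 / 2 - complex.Re (Phi z).

Lemma den_bound z : 0 < complex.Im z -> `|g| <= nc (F z + `|g| *i).
Proof.
move=> hz; have := im_green_ge0 hz; case: (F z) => p q /= q0.
rewrite -[leLHS](ger0_norm (normr_ge0 g)) -sqrtr_sqr ler_wsqrtr//.
apply: (@le_trans _ _ ((q + `|g|) ^+ 2)); last by rewrite lerDr sqr_ge0.
by rewrite ler_pXn2r ?nnegrE ?addr_ge0// lerDr.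
Qed.

Lemma den_neq0 z : 0 < complex.Im z -> F z + `|g| *i != 0.
Proof.
move=> /den_bound; apply: contraTneq => ->.
by rewrite Normc.normc0 -ltNge.
Qed.

Lemma nc_Phi z : 0 < complex.Im z -> nc (Phi z) <= 1.
Proof.
move=> hz; rewrite ncM Normc.normcV nc_real ler_pdivrMr ?mul1r ?den_bound//.
exact: lt_le_trans (den_bound hz).
Qed.

Lemma Re_PhiE z : complex.Re (Phi z) =
  g * complex.Re (F z) / (complex.Re (F z) ^+ 2 + (complex.Im (F z) + `|g|) ^+ 2).
Proof.
rewrite /Phi; case: (F z) => p q /=; rewrite addr0 mul0r subr0 mulrA.
by [].
Qed.

Lemma den2_gt0 z : 0 < complex.Im z ->
  0 < complex.Re (F z) ^+ 2 + (complex.Im (F z) + `|g|) ^+ 2.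
Proof.
move=> hz; rewrite ltr_wpDl ?sqr_ge0// exprn_gt0// ltr_wpDl//.
exact: im_green_ge0.
Qed.

Lemma defectE z : 0 < complex.Im z -> defect z =
  ((complex.Re (F z) - g) ^+ 2 + complex.Im (F z) ^+ 2 + 2 * complex.Im (F z) * `|g|) /
  (2 * (complex.Re (F z) ^+ 2 + (complex.Im (F z) + `|g|) ^+ 2)).
Proof.
move=> hz; rewrite /defect Re_PhiE.
have := den2_gt0 hz; set p := complex.Re _; set q := complex.Im _ => h.
have g2 : `|g| ^+ 2 = g ^+ 2 by rewrite real_normK ?num_real.
have -> : (p - g) ^+ 2 + q ^+ 2 + 2 * q * `|g| =
  p ^+ 2 + (q + `|g|) ^+ 2 - 2 * (g * p) by rewrite sqrrB -g2; ring.
set d := _ + _ ^+ 2 in h *; field; exact: lt0r_neq0.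
Qed.

Lemma defect_ge0 z : 0 < complex.Im z -> 0 <= defect z.
Proof.
move=> hz; rewrite defectE// divr_ge0 ?mulr_ge0 ?(ltW (den2_gt0 hz))//.
by rewrite !addr_ge0 ?sqr_ge0// !mulr_ge0// im_green_ge0.
Qed.

Lemma defect_le z : 0 < complex.Im z ->
  defect z <= (sqc (F z - g%:C) + 2 * nc (F z - g%:C) * `|g|) / `|g| ^+ 2.
Proof.
move=> hz; have q0 := im_green_ge0 hz; rewrite defectE//.
have h := Im_le_nc (F z - g%:C).
have -> : sqc (F z - g%:C) = (complex.Re (F z) - g) ^+ 2 + complex.Im (F z) ^+ 2.
  by rewrite /sqc; case: (F z) => p q /=; rewrite oppr0 addr0.
have {}h : complex.Im (F z) <= nc (F z - g%:C).
  apply: le_trans h; case: (F z) => p q /=; rewrite oppr0 addr0; exact: ler_norm.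
have h1 : 2 * complex.Im (F z) * `|g| <= 2 * nc (F z - g%:C) * `|g|.
  by rewrite ler_wpM2r// ler_wpM2l.
have h2 : `|g| ^+ 2 <= 2 * (complex.Re (F z) ^+ 2 + (complex.Im (F z) + `|g|) ^+ 2).
  have : `|g| ^+ 2 <= (complex.Im (F z) + `|g|) ^+ 2.
    by rewrite ler_pXn2r ?nnegrE ?addr_ge0// lerDr.
  by have := sqr_ge0 (complex.Re (F z)); have := sqr_ge0 `|g|; lra.
have kk : 0 < `|g| ^+ 2 by rewrite exprn_gt0.
apply: ler_pM.
- by rewrite !addr_ge0 ?sqr_ge0// !mulr_ge0.
- by rewrite invr_ge0 (le_trans (ltW kk)).
- by rewrite lerD2l.
- by rewrite lef_pV2 ?posrE// (lt_le_trans kk).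
Qed.

Lemma Re_Phi_bound z : 0 < complex.Im z ->
  `|complex.Re (Phi z)| <= `|complex.Re (F z)| / `|g|.
Proof.
move=> hz; rewrite Re_PhiE normrM normrM normfV.
rewrite (gtr0_norm (den2_gt0 hz)) mulrC mulrA mulrC ler_wpM2l//.
rewrite mulrC ler_pdivrMr ?den2_gt0// mulrC ler_pdivlMr//.
have q0 := im_green_ge0 hz; have h := sqr_ge0 (complex.Re (F z)).
have h1 := mulr_ge0 q0 (normr_ge0 g); have h2 := sqr_ge0 (complex.Im (F z)).
by rewrite sqrrD expr2; lra.
Qed.

Lemma Phi_sub z w : 0 < complex.Im z -> 0 < complex.Im w ->
  Phi z - Phi w = - g%:C * (F z - F w) * (F z + `|g| *i)^-1 * (F w + `|g| *i)^-1.
Proof.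
move=> hz hw; rewrite /Phi; have z0 := den_neq0 hz; have w0 := den_neq0 hw.
set p := F z + _ in z0 *; set q := F w + _ in w0 *.
have -> : F z - F w = p - q by rewrite /p /q; ring.
by field; rewrite z0 w0.
Qed.

(** Let w = x0 + i (eps + y), and let ws be its reflection in the line
    Im z = eps.  The analytic function (Phi z - Phi w) / ((z - w) (z - ws)) has
    no pole above that line and decays quadratically, so that its integral
    along the line vanishes; there the denominator is (x - x0)^2 + y^2 and the
    real part of the numerator is defect w - defect z. *)
Lemma poisson_kernel_bound (x0 y L eps : R) : 0 < eps -> eps <= y -> y <= L ->
  segint (fun x => defect (x +i* eps) * ((x - x0) ^+ 2 + y ^+ 2)^-1) (x0 - L) (x0 + L)
  <= 12 / L + 4 / y * defect (x0 +i* (eps + y)).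
Proof.
move=> e0 ey yL; have y0 : 0 < y by exact: lt_le_trans ey.
have L0 : 0 < L by exact: lt_le_trans yL.
pose s := eps / 2; have s0 : 0 < s by rewrite divr_gt0.
have se : s < eps by rewrite /s; lra.
pose w := x0 +i* (eps + y); pose ws := x0 +i* (eps - y).
have hw : 0 < complex.Im w by rewrite /= addr_gt0.
have pos z : s <= complex.Im z -> 0 < complex.Im z by exact: lt_le_trans.
have wR := upper hw; have ew := ell2_resolvent wR (@ell2_delta R 0).
have [sK bK] := smooth_resolvent_entry 0 s0 ew.
have [sF _] := smooth_resolvent_entry 0 s0 (@ell2_delta R 0).
set CF := _ + _ in sF.
have sA0 : smooth_above s (fun z => F z + `|g| *i) (fun z => Rs z (Rs z (delta R 0)) 0) CF.
  have [C0 H] := sF; split => // z v hz hv.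
  have E : F v + `|g| *i - (F z + `|g| *i) = F v - F z by ring.
  by rewrite E; exact: H.
have sA := smooth_inv k0 sA0 (fun z hz => den_bound (pos z hz)).
have bA : bounded_above s (fun z => (F z + `|g| *i)^-1) `|g|^-1.
  split; first by rewrite invr_ge0.
  move=> z hz; rewrite Normc.normcV lef_pV2 ?posrE ?den_bound ?pos//.
  by apply: lt_le_trans (den_bound (pos _ hz)).
have farB z : s <= complex.Im z -> y / 2 <= nc (z - ws).
  move=> hz; apply: le_trans (Im_le_nc _); apply: le_trans (ler_norm _).
  by move: hz; rewrite /ws /s; case: z => p q /=; lra.
have y2 : 0 < y / 2 by rewrite divr_gt0.
have sB := smooth_inv y2 (smooth_affine s ws) farB.
have bB : bounded_above s (fun z => (z - ws)^-1) (y / 2)^-1.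
  split; first by rewrite invr_ge0 ltW.
  move=> z hz; rewrite Normc.normcV lef_pV2 ?posrE ?farB//.
  by apply: lt_le_trans (farB _ hz).
have sAB := smooth_mul sA bA sB bB; have bAB := bounded_mul bA bB.
have sD := smooth_scale (smooth_mul sK bK sAB bAB) (- g%:C * (F w + `|g| *i)^-1).
move: sD; set D := (fun z => _ * (_ * _)) => sD.
have DE z : s <= complex.Im z -> D z * (z - w) * (z - ws) = Phi z - Phi w.
  move=> hz; rewrite (Phi_sub (pos _ hz) hw).
  have -> : F z - F w = (z - w) * Rs z (Rs w (delta R 0)) 0.
    rewrite /green (resolvent_identity abM wR (upper (pos _ hz)) (@ell2_delta R 0)).
    by rewrite /addz /scalez; ring.
  have zs : z - ws != 0.
    have := lt_le_trans y2 (farB _ hz); apply: contraTneq => ->.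
    by rewrite Normc.normc0 ltxx.
  rewrite /D; move: (Rs z _ _) => K; move: (F z + _)^-1 (F w + _)^-1 => A B.
  by field.
have dec z : eps <= complex.Im z -> nc (D z) * (nc (z - w) * nc (z - ws)) <= 2.
  move=> hz; rewrite -!ncM mulrA DE; last by rewrite (le_trans (ltW se)).
  apply: (le_trans (ncD _ _)); rewrite ncN.
  have h1 := nc_Phi (lt_le_trans e0 hz); have h2 := nc_Phi hw; lra.
have cauchy := cauchy_horizontal sD se y0 yL dec.
pose k x := ((x - x0) ^+ 2 + y ^+ 2)^-1.
have ck : continuous k by exact: (@poisson_kernel_continuous _ x0 y y0).
have kp x : 0 < (x - x0) ^+ 2 + y ^+ 2 by rewrite ltr_wpDl ?sqr_ge0// exprn_gt0.
have DR x : complex.Re (D (x +i* eps)) = defect w * k x - defect (x +i* eps) * k x.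
  have := DE (x +i* eps) (ltW se); rewrite -mulrA.
  have -> : (x +i* eps - w) * (x +i* eps - ws) = ((x - x0) ^+ 2 + y ^+ 2)%:C.
    by apply/eqP; rewrite eq_complex /=; apply/andP; split; apply/eqP; ring.
  move=> /(congr1 (@complex.Re R)).
  have -> : complex.Re (D (x +i* eps) * ((x - x0) ^+ 2 + y ^+ 2)%:C) =
      complex.Re (D (x +i* eps)) * ((x - x0) ^+ 2 + y ^+ 2).
    by case: (D _) => p q /=; ring.
  have -> : complex.Re (Phi (x +i* eps) - Phi w) = defect w - defect (x +i* eps).
    by rewrite /defect; case: (Phi _) => ? ?; case: (Phi _) => ? ? /=; ring.
  rewrite -mulrBl /k => <-; rewrite mulfK//; exact: lt0r_neq0.
have cD : continuous (fun x => complex.Re (D (x +i* eps))).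
  exact: continuous_Re_line sD (ltW se).
have cwk : continuous (fun x => defect w * k x).
  by move=> x; apply: cvgM; [exact: cvg_cst|exact: ck].
have -> : (fun x => defect (x +i* eps) * ((x - x0) ^+ 2 + y ^+ 2)^-1) =
    (fun x => defect w * k x - complex.Re (D (x +i* eps))).
  by apply/funext => x; rewrite DR /k; ring.
rewrite (segintB _ _ cwk cD) (segintZ _ _ _ ck).
have h1 := poisson_kernel_mass x0 y0 L0.
have h2 := ler_wpM2l (defect_ge0 hw) h1.
move: cauchy; rewrite ler_norml => /andP[h3 _].
by rewrite -/w; move: h2 h3; move: (segint _ _ _) (segint _ _ _) => p q; lra.
Qed.

End Herglotz.

Section Edge.
Context {R : realType} (a b : int -> R) (M : R) (abM : coeffs_le a b M).
Implicit Types (z w : R[i]) (x y : R).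

Notation nc := Normc.normc.
Notation Rs := (resolvent a b).
Notation res := (resolvent_set a b).
Notation F := (green a b 0).
Notation mu := (@lebesgue_measure R).

Context (upper : forall z, 0 < complex.Im z -> res z).

Section Measure.
Context (g : R) (g0 : g != 0).

Notation defect := (defect a b g).

Lemma defect_lipschitz s : 0 < s -> exists C, forall z w,
  s <= complex.Im z -> s <= complex.Im w ->
  `|defect w - defect z| <= C * nc (w - z).
Proof.
move=> s0; have k0 : 0 < `|g| by rewrite normr_gt0.
have [[C0 H] _] := smooth_resolvent_entry abM upper 0 s0 (@ell2_delta R 0).
move: C0 H; set CF := _ + _ => C0 H.
have pos z : s <= complex.Im z -> 0 < complex.Im z by exact: lt_le_trans.
exists (CF / `|g|) => z w hz hw.
have [_ h _] := H z w hz hw.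
have -> : `|defect w - defect z| = `|complex.Re (Phi a b g z - Phi a b g w)|.
  rewrite /defect; case: (Phi _ _ _ _) => ? ?; case: (Phi _ _ _ _) => ? ? /=.
  by congr `| _ |; ring.
apply: (le_trans (Re_le_nc _)).
rewrite (Phi_sub abM upper g0 (pos _ hz) (pos _ hw)).
rewrite !ncM ncN nc_real !Normc.normcV.
have d1 := den_bound abM upper g (pos _ hz).
have d2 := den_bound abM upper g (pos _ hw).
rewrite -opprB ncN.
move: h; rewrite -[Rs w _ 0]/(F w) -[Rs z _ 0]/(F z) => h.
set n := nc (F w - F z) in h *; have n0 : 0 <= n by exact: nc_ge0.
have i1 : (nc (F z + `|g| *i))^-1 <= `|g|^-1.
  by rewrite lef_pV2 ?posrE// (lt_le_trans k0).
have i2 : (nc (F w + `|g| *i))^-1 <= `|g|^-1.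
  by rewrite lef_pV2 ?posrE// (lt_le_trans k0).
apply: (@le_trans _ _ (`|g| * n * `|g|^-1 * `|g|^-1)).
  apply: ler_pM => //; rewrite ?invr_ge0 ?mulr_ge0 ?invr_ge0 ?nc_ge0//.
  by apply: ler_pM; rewrite ?mulr_ge0 ?invr_ge0 ?nc_ge0.
have -> : `|g| * n * `|g|^-1 * `|g|^-1 = n / `|g|.
  by field; exact: lt0r_neq0.
by rewrite mulrAC ler_wpM2r// invr_ge0 ltW.
Qed.

Lemma defect_line_continuous (eps : R) : 0 < eps ->
  continuous (fun x : R => defect (x +i* eps)).
Proof.
move=> /defect_lipschitz[C H]; apply: (@lipschitz_continuous _ _ C) => x y.
apply: (le_trans (H (x +i* eps) (y +i* eps) (lexx _) (lexx _))).
by rewrite /= subrr expr0n addr0 sqrtr_sqr.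
Qed.

(** The Poisson kernel of a point at height y is at least 1 / (5 y^2) on the
    interval of radius 2 y. *)
Lemma defect_integral_le (A : set R) x0 y eps : measurable A -> 0 < eps ->
  eps <= y -> A `<=` `[x0 - 2 * y, x0 + 2 * y] ->
  (\int[mu]_(x in A) (defect (x +i* eps))%:E <=
   (20 * y * defect (x0 +i* (eps + y)))%:E)%E.
Proof.
move=> mA e0 ey Ay; have y0 : 0 < y by exact: lt_le_trans ey.
have cd := defect_line_continuous e0.
have d0 x : 0 <= defect (x +i* eps) by exact: (defect_ge0 abM upper g0).
apply/lee_addgt0Pr => e ep.
pose L := 2 * y + 60 * y ^+ 2 / e.
have L0 : 0 < 60 * y ^+ 2 / e by rewrite divr_gt0// mulr_gt0// exprn_gt0.
have yL : 2 * y <= L by rewrite /L; lra.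
have yL1 : y <= L by lra.
pose k (x : R) := ((x - x0) ^+ 2 + y ^+ 2)^-1.
have ck : continuous k by exact: (@poisson_kernel_continuous _ x0 y y0).
have kp x : 0 < (x - x0) ^+ 2 + y ^+ 2 by rewrite ltr_wpDl ?sqr_ge0// exprn_gt0.
pose f x := 5 * y ^+ 2 * (defect (x +i* eps) * k x).
have cdk : continuous (fun x => defect (x +i* eps) * k x).
  by move=> x; apply: cvgM; [exact: cd|exact: ck].
have cf : continuous f by move=> x; apply: cvgM; [exact: cvg_cst|exact: cdk].
have f0 x : 0 <= f x.
  by rewrite /f !mulr_ge0 ?exprn_ge0 ?(ltW y0)// invr_ge0 ltW.
have mf D : measurable_fun D (EFin \o f).
  by apply/measurable_EFinP; apply: measurable_funTS; exact: continuous_measurable_fun.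
have md D : measurable_fun D (EFin \o (fun x => defect (x +i* eps))).
  by apply/measurable_EFinP; apply: measurable_funTS; exact: continuous_measurable_fun.
apply: (@le_trans _ _ (\int[mu]_(x in A) (f x)%:E)%E).
  apply: ge0_le_integral => //.
  - by move=> x _; rewrite lee_fin.
  - exact: md.
  - exact: mf.
  move=> x /Ay; rewrite /= in_itv /= => /andP[h1 h2]; rewrite lee_fin /f.
  rewrite mulrCA ler_peMr// /k ler_pdivlMr// mul1r.
  have : 0 <= (2 * y - (x - x0)) * (2 * y + (x - x0)) by apply: mulr_ge0; lra.
  rewrite !expr2; lra.
apply: (@le_trans _ _ (\int[mu]_(x in `[(x0 - L)%R, (x0 + L)%R]) (f x)%:E)%E).
  apply: ge0_subset_integral => //.
  - exact: mf.
  - by move=> x _; rewrite lee_fin.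
  move=> x /Ay; rewrite /= !in_itv /= => /andP[h1 h2]; apply/andP; split; lra.
have intf := @continuous_integrable R f (x0 - L) (x0 + L) cf.
have -> : (\int[mu]_(x in `[(x0 - L)%R, (x0 + L)%R]) (f x)%:E)%E =
    (segint f (x0 - L) (x0 + L))%:E.
  by rewrite fineK//; exact: integrable_fin_num.
rewrite -EFinD lee_fin.
rewrite (segintZ _ _ _ cdk).
have h := poisson_kernel_bound abM upper g0 x0 e0 ey yL1.
have y20 : 0 <= 5 * y ^+ 2 by rewrite mulr_ge0// exprn_ge0// ltW.
apply: (le_trans (ler_wpM2l y20 h)).
have -> : 5 * y ^+ 2 * (12 / L + 4 / y * defect (x0 +i* (eps + y))) =
    60 * y ^+ 2 / L + 20 * y * defect (x0 +i* (eps + y)).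
  by field; apply/andP; split; rewrite gt_eqF//; lra.
rewrite addrC lerD2l ler_pdivrMr; last lra.
rewrite /L mulrDr [e * (_ / e)]mulrC divfK ?gt_eqF// lerDr.
by rewrite !mulr_ge0// ltW.
Qed.

(** As eps decreases to 0 the defect at height eps tends to 1/2 almost
    everywhere on E, boundedly. *)
Lemma reflectionless_measure (E A : set R) x0 y : measurable A -> 0 < y ->
  A `<=` E -> A `<=` `[x0 - 2 * y, x0 + 2 * y] ->
  {ae mu, forall x, E x ->
    (fun e : R => complex.Re (F (x +i* e))) @ (0 : R)^'+ --> (0 : R)} ->
  (mu A <= (40 * y * defect (x0 +i* y))%:E)%E.
Proof.
move=> mA y0 AE Ay refl.
have k0 : 0 < `|g| by rewrite normr_gt0.
pose e_ (n : nat) : R := y * harmonic n.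
have e0 n : 0 < e_ n by rewrite mulr_gt0// harmonic_gt0.
have ey n : e_ n <= y.
  by rewrite /e_ ger_pMr// invf_le1// ler1n.
have e_cvg : e_ @ \oo --> (0 : R).
  rewrite -(mulr0 y); apply: cvgM; [exact: cvg_cst|exact: cvg_harmonic].
pose f_ n x := defect (x +i* e_ n).
have muA : (mu A < +oo)%E.
  apply: (@le_lt_trans _ _ (mu `[(x0 - 2 * y)%R, (x0 + 2 * y)%R])).
    by apply: le_measure => //; rewrite inE.
  by rewrite lebesgue_measure_itv/=; case: ifP => _; rewrite ?ltry// -EFinD ltry.
have mf n : measurable_fun A (EFin \o f_ n).
  apply/measurable_EFinP; apply: measurable_funTS; apply: continuous_measurable_fun.
  exact: defect_line_continuous (e0 n).
have icst (c : R) : mu.-integrable A (EFin \o cst c).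
  apply/integrableP; split; first exact/measurable_EFinP.
  under eq_integral do rewrite /=.
  by rewrite integral_cst//= lte_mul_pinfty// ?lee_fin.
have ae1 : {ae mu, forall x, A x -> (fun n => (f_ n x)%:E) @ \oo --> (1 / 2 : R)%:E}.
  apply: (@filterS _ _ (ae_filter_ringOfSetsType mu)) refl => x xE /AE /xE {xE} cx.
  apply: cvg_EFin; first by near=> n.
  have cr : (fun n => complex.Re (F (x +i* e_ n))) @ \oo --> (0 : R).
    by move/cvg_at_rightP : cx; apply; split.
  have cp : (fun n => complex.Re (Phi a b g (x +i* e_ n))) @ \oo --> (0 : R).
    apply/cvgr0Pnorm_le => eps eps0.
    have /cvgr0_norm_le/(_ (eps * `|g|)) := cr.
    rewrite mulr_gt0// => /(_ isT); apply: filterS => n hn.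
    apply: (le_trans (Re_Phi_bound abM upper g0 (z := x +i* e_ n) (e0 n))).
    by rewrite ler_pdivrMr.
  rewrite -[1 / 2]subr0; apply: cvgB; [exact: cvg_cst|exact: cp].
have ae2 : {ae mu, forall x n, A x -> (`|(EFin \o f_ n) x| <= (3 / 2 : R)%:E)%E}.
  apply: aeW => x n _; rewrite /= lee_fin /f_.
  have h := nc_Phi abM upper g0 (z := (x : R) +i* e_ n) (e0 n).
  have := le_trans (Re_le_nc _) h; rewrite /defect !ler_norml => /andP[h1 h2].
  by apply/andP; split; lra.
have mh : measurable_fun A (EFin \o cst (1 / 2 : R)) by exact/measurable_EFinP.
have [_ _ cvgI] := dominated_convergence (mu := mu) mA mf mh ae1 (icst (3 / 2)) ae2.
have dlim : (fun n => defect (x0 +i* (e_ n + y))) @ \oo --> defect (x0 +i* y).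
  have [C H] := defect_lipschitz y0.
  apply/cvgrPdist_le => e ep.
  have C0 : 0 < `|C| + 1 by rewrite ltr_pwDr.
  have /cvgr0_norm_le/(_ (e / (`|C| + 1))) := e_cvg.
  rewrite divr_gt0// => /(_ isT); apply: filterS => n hn; rewrite distrC.
  have yn : y <= complex.Im (x0 +i* (e_ n + y)) by rewrite /= lerDr ltW.
  apply: (le_trans (H (x0 +i* y) (x0 +i* (e_ n + y)) (lexx _) yn)).
  have -> : nc (x0 +i* (e_ n + y) - x0 +i* y) = `|e_ n|.
    by rewrite /= subrr expr0n add0r addrK sqrtr_sqr.
  apply: (@le_trans _ _ ((`|C| + 1) * `|e_ n|)).
    by rewrite ler_wpM2r//; have := ler_norm C; lra.
  by rewrite mulrC -ler_pdivlMr.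
have : (\int[mu]_(x in A) (1 / 2)%:E <= (20 * y * defect (x0 +i* y))%:E)%E.
  apply/lee_addgt0Pr => e ep.
  have : \forall n \near \oo, (\int[mu]_(x in A) (EFin \o f_ n) x <=
      (20 * y * defect (x0 +i* y) + e)%:E)%E.
    have h : (fun n => 20 * y * defect (x0 +i* (e_ n + y))) @ \oo -->
        20 * y * defect (x0 +i* y).
      by apply: cvgM; [exact: cvg_cst|exact: dlim].
    have : 20 * y * defect (x0 +i* y) < 20 * y * defect (x0 +i* y) + e by lra.
    move/(cvgr_lt _ h); apply: filterS => n hn.
    apply: (le_trans (defect_integral_le mA (e0 n) (ey n) Ay)).
    by rewrite lee_fin ltW.
  exact: cvge_to_le cvgI.
rewrite integral_cst//= => h.
have -> : mu A = (2%:E * ((1 / 2)%:E * mu A))%E.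
  by rewrite muleA -EFinM (_ : 2 * (1 / 2) = 1) ?mul1e//; field.
apply: (le_trans (lee_wpmul2l _ h)); first by rewrite lee_fin.
by rewrite -EFinM lee_fin; apply: eqW_le; ring.
Unshelve. all: by end_near.
Qed.

End Measure.
End Edge.

(** If the Green function had a finite nonzero limit g at a gap edge, its
    derivative would be o(1/h) at suitable distances h from the edge, so that
    the defect would tend to 0 at height h above these points; but the set E,
    which is not thin near the edge, keeps it above a constant. *)
Lemma edge_limit_zero {R : realType} (a b : int -> R) (M : R) (E : set R)
    (lam sg g d0 : R) :
  coeffs_le a b M ->
  (forall z, 0 < complex.Im z -> resolvent_set a b z) ->
  {ae @lebesgue_measure R, forall x, E x ->
    (fun e : R => complex.Re (green a b 0 (x +i* e))) @ (0 : R)^'+ --> (0 : R)} ->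
  sg ^+ 2 = 1 -> 0 < d0 ->
  (forall h, 0 < h < d0 -> resolvent_set a b (lam - sg * h)%:C) ->
  (forall h, 0 < h < d0 -> exists A : set R, [/\ measurable A, A `<=` E,
     A `<=` `[lam - h, lam + h] & ((h / 2)%:E <= lebesgue_measure A)%E]) ->
  (forall e, 0 < e -> exists2 d, 0 < d & forall h, 0 < h < d ->
     `|greenR a b (lam - sg * h) - g| <= e) ->
  g = 0.
Proof.
move=> abM upper refl sg1 d0p gap dense limg.
apply/eqP; apply/negP => /negP g0.
have k0 : 0 < `|g| by rewrite normr_gt0.
have nsg : `|sg| = 1.
  by apply/eqP; rewrite -(@eqrXn2 _ 2)// -normrX sg1 normr1 expr1n.
(* F will be within 10 eta of g, which makes the defect at most 1/90, below
   the lower bound 1/80 that comes from the measure of E near the edge *)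
pose eta := `|g| / 100 / 20.
have eta0 : 0 < eta by rewrite !divr_gt0.
have [d dp limd] := limg _ eta0.
pose H := Num.min d d0 / 2.
have m0 : 0 < Num.min d d0 by rewrite lt_min dp d0p.
have H0 : 0 < H by rewrite divr_gt0.
have [Hd Hd0] : H < d /\ H < d0.
  have : H < Num.min d d0 by rewrite /H; lra.
  by rewrite lt_min => /andP.
pose N t := nrm2 (resolvent a b (lam - sg * t)%:C (delta R 0)).
have df t : H / 2 <= t <= H ->
    is_derive t (1 : R) (fun t => greenR a b (lam - sg * t)) (- sg * N t).
  move=> /andP[t1 t2].
  pose e := Num.min t (d0 - t).
  have e0 : 0 < e by rewrite lt_min; apply/andP; split; lra.
  have nx : \forall y \near (lam - sg * t), resolvent_set a b y%:C.
    apply: (near_resolvent_set e0) => y ye.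
    have -> : y = lam - sg * (sg * (lam - y)).
      by rewrite mulrA -expr2 sg1; ring.
    apply: gap; have -> : sg * (lam - y) = t - sg * (y - (lam - sg * t)).
      have -> : t - sg * (y - (lam - sg * t)) = sg * (lam - y) + (1 - sg ^+ 2) * t by ring.
      by rewrite sg1; ring.
    have : `|sg * (y - (lam - sg * t))| < e by rewrite normrM nsg mul1r.
    by rewrite lt_min !ltr_norml => /andP[/andP[h1 h2] /andP[h3 h4]]; apply/andP; split; lra.
  have d1 := is_derive_green abM nx.
  have d2 : is_derive t (1 : R) (fun t => lam - sg * t) (- sg).
    apply: is_derive_quadratic; exists 0, 1; split => // h _.
    have -> : lam - sg * (t + h) - (lam - sg * t) - h * - sg = 0 by ring.
    by rewrite normr0 mul0r.
  have d3 := @is_derive1_comp R (greenR a b) (fun t => lam - sg * t) t _ _ d1 d2.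
  by apply: (is_derive_eq d3); rewrite mulrC.
have H2 : H / 2 < H by lra.
have [c /andP[c1 c2] Ec] := MVT_is_derive H2 df.
have cp : 0 < c by lra.
have cH : 0 < c < d0 by apply/andP; split; lra.
have lim_at t : H / 2 <= t <= H -> `|greenR a b (lam - sg * t) - g| <= eta.
  by move=> /andP[t1 t2]; apply: limd; apply/andP; split; lra.
have lH := lim_at H ltac:(apply/andP; split; lra).
have lH2 := lim_at (H / 2) ltac:(apply/andP; split; lra).
have lc := lim_at c ltac:(apply/andP; split; lra).
have xR := gap _ cH.
have N0 : 0 <= N c by exact: nrm2_ge0 (ell2_resolvent xR (ell2_delta 0)).
have cN : c * N c <= 4 * eta.
  apply: (@le_trans _ _ (H * N c)); first by rewrite ler_wpM2r// ltW.
  have : `|- sg * N c * (H - H / 2)| <= 2 * eta.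
    rewrite -Ec; move: lH lH2; rewrite !ler_norml.
    move=> /andP[? ?] /andP[? ?]; apply/andP; split; lra.
  rewrite !normrM normrN nsg mul1r (ger0_norm N0) ger0_norm; lra.
pose x := lam - sg * c; pose w := x +i* c.
have wR : resolvent_set a b w by apply: upper.
have off := green_off_axis abM xR wR.
have Fw : Normc.normc (green a b 0 w - g%:C) <= 10 * eta.
  have -> : green a b 0 w - g%:C = (green a b 0 w - green a b 0 x%:C) + (greenR a b x - g)%:C.
    by rewrite (green_real abM xR) rmorphB /=; ring.
  apply: (le_trans (ncD _ _)); rewrite nc_real.
  have h1 : Normc.normc (green a b 0 w - green a b 0 x%:C) <= 9 * eta.
    rewrite -[leLHS](ger0_norm (nc_ge0 _)) -sqrtr_sqr normc_sqc.
    have e9 : 0 <= 9 * eta by rewrite mulr_ge0// ltW.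
    rewrite -[leRHS](ger0_norm e9) -sqrtr_sqr ler_wsqrtr//.
    apply: (le_trans off).
    have cN0 : 0 <= c * N c by rewrite mulr_ge0// ltW.
    have h : (c * N c) ^+ 2 <= (4 * eta) ^+ 2.
      by rewrite ler_pXn2r ?nnegrE// mulr_ge0// ltW.
    have -> : 5 * c ^+ 2 * nrm2 (resolvent a b x%:C (delta R 0)) ^+ 2 =
      5 * (c * N c) ^+ 2 by rewrite /N -/x; ring.
    apply: (le_trans (ler_wpM2l (ler0n R 5) h)); move: (sqr_ge0 eta).
    by rewrite !expr2; clear; move: eta => e; lra.
  apply: (le_trans (lerD h1 lc)); clear; lra.
have dw : defect a b g w <= 1 / 90.
  apply: (le_trans (defect_le abM upper g0 (z := w) cp)).
  have e10 : 0 <= 10 * eta by rewrite mulr_ge0// ltW.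
  rewrite -normc_sqc ler_pdivrMr ?exprn_gt0//.
  set n := Normc.normc _ in Fw *; have n0 : 0 <= n by exact: nc_ge0.
  have {}Fw : n <= `|g| / 200 by move: Fw; rewrite /eta; clear; lra.
  move: n n0 Fw k0; clear; move: `|g| => k n n0 nk k0.
  have h1 := ler_wpM2l n0 nk; have h2 := ler_wpM2r (ltW k0) nk.
  have h3 := mulr_gt0 k0 k0; rewrite !expr2.
  lra.
have [A [mA AE Ac muA]] := dense _ cH.
have Ax : A `<=` `[x - 2 * c, x + 2 * c].
  move=> y /Ac; rewrite /= !in_itv /= => /andP[y1 y2].
  have : `|sg * c| <= c by rewrite normrM nsg mul1r ger0_norm// ltW.
  by rewrite /x ler_norml => /andP[s1 s2]; apply/andP; split; lra.
have := le_trans muA (reflectionless_measure abM upper g0 mA cp AE Ax refl).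
rewrite lee_fin -/w => h.
have := ler_wpM2l (x := 40 * c) _ dw; rewrite mulr_ge0 ?(ltW cp)// => /(_ isT).
by move: h; set D := defect _ _ _ _; lra.
Qed.

(** * Density of the spectrum at a gap edge *)

Section Gaps.
Context {R : realType} (E : set R).
Implicit Types (x y l r : R).

Lemma gap_avoids l r : closed E -> is_gap E l r -> E l /\ E r.
Proof.
move=> cE [lr lrE maxi].
have oE : open (~` E) by exact: closed_openC.
have oitv : open `]l, r[%classic by exact: interval_open.
have H p : ~ E p -> l <= p <= r -> (p = l \/ p = r) -> False.
  move=> Ep /andP[lp pr] plr.
  have [e /= e0 He] : nbhs p (~` E) by exact: open_nbhs_nbhs.
  pose U := `]l, r[%classic `|` `]p - e, p + e[%classic.
  have UE : U = `]l, r[%classic.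
    apply: maxi.
    - by apply: openU => //; exact: interval_open.
    - have pe1 : p - e < p by rewrite gtrBl.
      have pe2 : p < p + e by rewrite ltrDl.
      move=> x y; rewrite /U /= !in_itv /= => hx hy z /andP[xz zy]; rewrite !in_itv /=.
      have [zp|zp|zp] := ltgtP z p; last by right; apply/andP; split; lra.
        have [zl|zl] := ltP (p - e) z.
          by right; apply/andP; split; lra.
        by left; case: hx => /andP[x1 x2]; apply/andP; split; lra.
      have [zl|zl] := ltP z (p + e).
        by right; apply/andP; split; lra.
      by left; case: hy => /andP[y1 y2]; apply/andP; split; lra.
    - move=> x [/lrE//|]; rewrite /= in_itv /= => /andP[x1 x2].
      by apply: He; rewrite /ball /= ltr_norml; apply/andP; split; lra.
    - by move=> x; left.
  have : U p by right; rewrite /= in_itv /= gtrBl ltrDl e0.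
  rewrite UE /= in_itv /= => /andP[p1 p2].
  by case: plr => pe; move: p1 p2; rewrite pe ltxx.
split; apply: contrapT => Ep; apply: (H _ Ep); rewrite ?lexx ?(ltW lr)//.
  by left.
by right.
Qed.

Lemma exists_gap x : closed E -> ~ E x -> (exists2 y, E y & y < x) ->
  (exists2 y, E y & x < y) -> exists l r, is_gap E l r /\ l < x < r.
Proof.
move=> cE nEx [y Ey yx] [z Ez xz].
have H1 : has_sup (E `&` [set u | u < x]).
  by split; [exists y | exists x => u [_ /ltW]].
have H2 : has_inf (E `&` [set u | x < u]).
  by split; [exists z | exists x => u [_ /ltW]].
pose l := sup (E `&` [set u | u < x]); pose r := inf (E `&` [set u | x < u]).
have El : E l.
  apply: contrapT => nEl.
  have [e /= e0 He] : nbhs l (~` E) by apply: open_nbhs_nbhs; split => //; exact: closed_openC.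
  have [u [Eu ux] lu] := sup_adherent e0 H1.
  apply: (He u) => //; rewrite /ball /= ltr_norml.
  have := sup_upper_bound H1 (conj Eu ux); rewrite -/l in lu * => ul.
  by apply/andP; split; lra.
have Er : E r.
  apply: contrapT => nEr.
  have [e /= e0 He] : nbhs r (~` E) by apply: open_nbhs_nbhs; split => //; exact: closed_openC.
  have [u [Eu xu] ru] := inf_adherent e0 H2.
  apply: (He u) => //; rewrite /ball /= ltr_norml.
  have := ge_inf H2.2 (conj Eu xu); rewrite -/r in ru * => ul.
  by apply/andP; split; lra.
have lx : l < x.
  rewrite lt_neqAle; apply/andP; split.
    by apply: contra_not_neq nEx => <-.
  by apply: ge_sup; [exists y|move=> u [_ /ltW]].
have xr : x < r.
  rewrite lt_neqAle; apply/andP; split.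
    by apply: contra_not_neq nEx => ->.
  by apply: lb_le_inf; [exists z|move=> u [_ /ltW]].
exists l, r; split; last by rewrite lx xr.
split; first exact: lt_trans xr.
  move=> u; rewrite /= in_itv /= => /andP[lu ur] Eu.
  have [ux|ux|uE] := ltgtP u x; last by apply: nEx; rewrite -uE.
    by have := sup_upper_bound H1 (conj Eu ux); rewrite leNgt lu.
  by have := ge_inf H2.2 (conj Eu ux); rewrite leNgt ur.
move=> U oU iU UE lrU; apply/seteqP; split => // u Uu.
have Ux : U x by apply: lrU; rewrite /= in_itv /= lx xr.
rewrite /= in_itv /=; apply/andP; split; rewrite ltNge; apply/negP => h.
  by apply: (UE l) => //; apply: (iU u x) => //; rewrite h ltW.
by apply: (UE r) => //; apply: (iU x u) => //; rewrite h ltW.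
Qed.

End Gaps.

Section Craig.
Context {R : realType} (E : set R) (I : countType) (Em Ep : I -> R).
Context (cE : compact E) (gaps : gap_enumeration E Em Ep).
Context (craig : craig_condition E Em Ep).
Implicit Types (j k : I).

Notation gl := (gap_length Em Ep).
Notation gd := (gap_dist Em Ep).

Let clE : closed E.
Proof. by apply: compact_closed => //; exact: Rhausdorff. Qed.

Lemma gap_edges_in j : E (Em j) /\ E (Ep j).
Proof. by have [H _ _] := gaps; exact: gap_avoids (H j). Qed.

Lemma gap_lt j : Em j < Ep j.
Proof. by have [H _ _] := gaps; case: (H j). Qed.

Lemma gap_notin j x : Em j < x < Ep j -> ~ E x.
Proof. by have [H _ _] := gaps; case: (H j) => _ sub _ h; apply: sub; rewrite /= in_itv. Qed.

Lemma gl_gt0 j : 0 < gl j.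
Proof. by rewrite subr_gt0 gap_lt. Qed.

Lemma E_bounds x : E x -> inf E <= x <= sup E.
Proof.
move=> Ex; have E0 : E !=set0 by exists x.
have [M [_ /(_ (M + 1))]] := compact_bounded cE; rewrite ltrDl ltr01 => /(_ isT) HM.
apply/andP; split.
  apply: ge_inf => //; exists (- (M + 1)) => y /HM /=; rewrite ler_norml => /andP[] //.
apply: ub_le_sup => //; exists (M + 1) => y /HM /=; rewrite ler_norml => /andP[] //.
Qed.

Lemma craig_ratio_ge0 j k : (0 <= (gl k)%:E / (gd j k)%:E)%E.
Proof.
apply: mule_ge0; first by rewrite lee_fin ltW// gl_gt0.
by rewrite inve_ge0 lee_fin le_min !normr_ge0.
Qed.

Lemma edge_dist_lt j : edge_dist E Em Ep j < sup E - inf E.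
Proof.
have [e1 e2] := gap_edges_in j; have lt := gap_lt j.
have /andP[b1 b2] := E_bounds e1; have /andP[b3 b4] := E_bounds e2.
rewrite /edge_dist; apply: (@le_lt_trans _ _ `|Em j - inf E|).
  by rewrite ge_min lexx orbT.
by rewrite ger0_norm; lra.
Qed.

Lemma craig_sum_fin j :
  (\esum_(k in [set k | k != j]) ((gl k)%:E / (gd j k)%:E) < +oo)%E.
Proof.
have [h1 _ _] := craig; rewrite ltNge; apply/negP; rewrite leye_eq => /eqP S.
have : ((gl j)%:E * craig_C E Em Ep j < +oo)%E.
  by apply: le_lt_trans h1; apply: ereal_sup_ubound; exists j.
rewrite /craig_C S gt0_muley ?lte_fin// -[expeR +oo]/(+oo%E).
rewrite !gt0_muley ?lte_fin ?gl_gt0// sqrtr_gt0 subr_gt0.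
exact: edge_dist_lt.
Qed.

(** Gaps sharing an edge would contribute an infinite term to the sum. *)
Lemma gap_dist_gt0 j k : k != j -> 0 < gd j k.
Proof.
move=> kj; rewrite lt_neqAle le_min !normr_ge0 !andbT; apply/eqP => /esym d0.
have := craig_sum_fin j; apply/negP; rewrite -leNgt.
apply: esum_ge; exists [set k].
  by split => // _ ->.
rewrite fsbig_set1 d0 inve0 gt0_muley// lte_fin; exact: gl_gt0.
Qed.

Lemma edge_dist_gt0 j : 0 < edge_dist E Em Ep j.
Proof.
rewrite lt_neqAle le_min !normr_ge0 !andbT; apply/eqP => /esym d0.
have [_ h2 _] := craig; move: h2; apply/negP; rewrite -leNgt leye_eq.
apply/eqP; apply/eqP; rewrite -leye_eq; apply: ereal_sup_ge.
exists ((gl j)%:E / (edge_dist E Em Ep j)%:E * craig_C E Em Ep j)%E; first by exists j.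
rewrite d0 inve0 gt0_muley ?lte_fin ?gl_gt0// gt0_mulye//.
rewrite /craig_C d0 subr0 mule_gt0//.
  by rewrite lte_fin sqrtr_gt0 -(d0) ; exact: edge_dist_lt.
apply: expeR_gt0; apply: (@lt_le_trans _ _ 0%E); first exact: ltNy0.
apply: mule_ge0; first by rewrite lee_fin.
by apply: esum_ge0 => k _; exact: craig_ratio_ge0.
Qed.

End Craig.

Section Density.
Context {R : realType} (E : set R) (I : countType) (Em Ep : I -> R).
Context (cE : compact E) (gaps : gap_enumeration E Em Ep).
Context (craig : craig_condition E Em Ep).
Implicit Types (j k : I).

Notation gl := (gap_length Em Ep).
Notation gd := (gap_dist Em Ep).

Lemma finite_lower_bound (T : eqType) (f : T -> R) (s : seq T) :
  (forall x, x \in s -> 0 < f x) ->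
  exists2 d, 0 < d & forall x, x \in s -> d < f x.
Proof.
elim: s => [|x0 s IH] H; first by exists 1.
have Hs x : x \in s -> 0 < f x by move=> xs; apply: H; rewrite inE xs orbT.
have [d d0 Hd] := IH Hs.
have f0 : 0 < f x0 by apply: H; rewrite mem_head.
exists (Num.min d (f x0 / 2)); first by rewrite lt_min d0 divr_gt0.
move=> x; rewrite inE => /orP[/eqP ->|/Hd]; rewrite gt_min; last by move->.
by apply/orP; right; lra.
Qed.

Definition near_gaps j (h : R) : set I := [set k | k != j /\ gd j k <= h].

(** For small h the gaps within distance h avoid the finitely many terms that
    carry all but 1/2 of the convergent sum of gap_length / gap_dist. *)
Lemma near_gaps_short j : exists2 d : R, 0 < d & forall h : R, 0 < h <= d ->
  (\esum_(k in near_gaps j h) (gl k)%:E <= (h / 2)%:E)%E.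
Proof.
pose r k := ((gl k)%:E / (gd j k)%:E)%E.
have r0 k : (0 <= r k)%E by exact: (craig_ratio_ge0 gaps).
have S : (\esum_(k in [set k | k != j]) r k < +oo)%E.
  exact: craig_sum_fin cE gaps craig j.
have [X [[fX XP] Xsum]] : exists X, fsets [set k | k != j] X /\
    (\esum_(k in [set k | k != j]) r k <= \sum_(k \in X) r k + (1 / 2)%:E)%E.
  have Sfin : (\esum_(k in [set k | k != j]) r k)%E \is a fin_num.
    by rewrite ge0_fin_numE// esum_ge0.
  have lt : (\esum_(k in [set k | k != j]) r k - (1 / 2)%:E <
      \esum_(k in [set k | k != j]) r k)%E.
    by rewrite lteBlDr// lteDl// lte_fin; lra.
  have [_ [X XP <-] h] := ereal_sup_gt lt.
  by exists X; split => //; rewrite -leeBlDr// ltW.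
have /finite_seqP[s Xs] := fX.
have Hs k : k \in s -> 0 < gd j k.
  by move=> ks; apply: (gap_dist_gt0 cE gaps craig); apply: XP; rewrite Xs.
have [d d0 Hd] := finite_lower_bound Hs.
exists d => // h /andP[h0 hd].
pose T := near_gaps j h.
have TX : T `&` X = set0.
  rewrite -subset0 => k [[_ kh]]; rewrite Xs /= => /Hd.
  by rewrite ltNge (le_trans kh hd).
have Tsum : (\esum_(k in T) r k <= (1 / 2)%:E)%E.
  have e1 : (\esum_(k in [set k | k != j]) r k =
      \esum_(k in [set k | k != j] `&` X) r k + \esum_(k in [set k | k != j] `&` ~` X) r k)%E.
    exact: esumID.
  have e2 : [set k | k != j] `&` X = X by apply/setIidr.
  have eX : (\esum_(k in X) r k = \sum_(k \in X) r k)%E by exact: esum_fset.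
  rewrite e2 eX in e1.
  have e3 : (\esum_(k in T) r k <= \esum_(k in [set k | k != j] `&` ~` X) r k)%E.
    apply: ge_ereal_sup => _ [Y [fY YT] <-]; apply: ereal_sup_ubound; exists Y => //.
    split => // k /[dup] Yk /YT [kj kh]; split => // Xk.
    by have : (T `&` X) k by []; rewrite TX.
  apply: (le_trans e3).
  have Xfin : (\sum_(k \in X) r k)%E \is a fin_num.
    rewrite ge0_fin_numE; last by apply: fsume_ge0 => // k _.
    apply: le_lt_trans S; rewrite e1 leeDl// esum_ge0//.
  by move: Xsum; rewrite e1 leeD2lE.
have hT : (\esum_(k in T) (gl k)%:E <= \esum_(k in T) (h%:E * r k))%E.
  apply: le_esum => k [kj kh]; have dk := gap_dist_gt0 cE gaps craig kj.
  rewrite /r inver gt_eqF// -!EFinM lee_fin mulrA ler_pdivlMr// mulrC.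
  by rewrite ler_wpM2r// ltW// (gl_gt0 gaps).
apply: (le_trans hT); rewrite esumZl ?(ltW h0)//.
apply: (le_trans (lee_wpmul2l _ Tsum)); first by rewrite lee_fin ltW.
by rewrite -EFinM lee_fin mulrA mulr1.
Qed.

(** An interval whose part outside E is covered by gaps near gap j meets E in
    at least half its length. *)
Lemma interval_density j p q h : q - p = h -> 0 < h ->
  (\esum_(k in near_gaps j h) (gl k)%:E <= (h / 2)%:E)%E ->
  (forall x, p <= x <= q -> ~ E x ->
     exists k, [/\ k != j, gd j k <= h & Em k < x < Ep k]) ->
  ((h / 2)%:E <= lebesgue_measure (E `&` `[p, q]))%E.
Proof.
move=> qp h0 hsum cover.
pose T := near_gaps j h.
pose G k := if k \in T then `]Em k, Ep k[%classic else set0.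
pose F n := if pickle_inv n is Some k then G k else set0.
have mG k : measurable (G k) by rewrite /G; case: ifP => // _; exact: measurable_itv.
have mF n : measurable (F n) by rewrite /F; case: (pickle_inv n).
have mE : measurable E by exact: compact_measurable.
have mEI : measurable (E `&` `[p, q]) by exact: measurableI.
have sub : `[p, q] `<=` (E `&` `[p, q]) `|` \bigcup_n F n.
  move=> x xpq; have [Ex|nEx] := pselect (E x); first by left.
  right; move: (xpq); rewrite /= in_itv /= => xpq'.
  have [k [kj kh xk]] := cover _ xpq' nEx.
  have kT : k \in T by rewrite inE.
  exists (pickle k) => //; rewrite /F pickleK_inv /G kT.
  by rewrite /= in_itv.
have muF n : lebesgue_measure (F n) =
   (if pickle_inv n is Some k then if k \in T then (gl k)%:E else 0 else 0)%E.
  rewrite /F; case: (pickle_inv n) => [k|]; last by rewrite measure0.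
  rewrite /G; case: ifP => _; last by rewrite measure0.
  rewrite lebesgue_measure_itv /= lte_fin (gap_lt gaps) -EFinB.
  by [].
have gl0 k : 0 <= gl k by rewrite ltW// (gl_gt0 gaps).
have sumF : (\sum_(n <oo) lebesgue_measure (F n) <= (h / 2)%:E)%E.
  apply: le_trans hsum; rewrite nneseries_esumT; last by move=> n; exact: measure_ge0.
  have inj : set_inj T (@pickle I) by move=> x y _ _; exact: (pcan_inj pickleK).
  have -> : (\esum_(k in T) (gl k)%:E = \esum_(k in T) lebesgue_measure (F (pickle k)))%E.
    by apply: eq_esum => k kT; rewrite muF pickleK_inv mem_set.
  rewrite -(esum_image T pickle (fun n => lebesgue_measure (F n)) inj).
  rewrite [leRHS]esum_mkcond; apply: le_esum => n _.
  case: ifPn => // nT; rewrite muF; case En : (pickle_inv n) => [k|//].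
  case: ifPn => // kT; move: nT; rewrite notin_setE => -[].
  exists k; first by rewrite inE in kT.
  by have := @pickle_invK I n; rewrite En.
have muI : lebesgue_measure `[p, q]%classic = h%:E.
  by rewrite lebesgue_measure_itv /= lte_fin ifT; [rewrite -EFinB qp|lra].
have mFU : measurable (\bigcup_n F n) by exact: bigcup_measurable.
have le1 : (h%:E <= lebesgue_measure (E `&` `[p, q]) + lebesgue_measure (\bigcup_n F n))%E.
  rewrite -muI; apply: (@le_trans _ _ (lebesgue_measure ((E `&` `[p, q]) `|` \bigcup_n F n))).
    by apply: le_measure => //; rewrite inE//; exact: measurableU.
  exact: measureU2.
have le2 : (lebesgue_measure (\bigcup_n F n) <= (h / 2)%:E)%E.
  by apply: le_trans sumF; apply: measure_sigma_subadditive.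
have := le_trans le1 (leeD2l _ le2).
rewrite -leeBlDr// => /(le_trans _); apply.
by rewrite -EFinB lee_fin; lra.
Qed.

Lemma gaps_disjoint j k : k != j -> Ep k <= Em j \/ Ep j <= Em k.
Proof.
move=> kj; have [ltj ltk] := (gap_lt gaps j, gap_lt gaps k).
have [[Ej1 Ej2] [Ek1 Ek2]] := (gap_edges_in cE gaps j, gap_edges_in cE gaps k).
have [h1|h1] := leP (Ep k) (Em j); first by left.
have [h2|h2] := leP (Ep j) (Em k); first by right.
have [_ inj _] := gaps; move/eqP: kj; case; apply: inj.
have em : Em k = Em j.
  apply/le_anti/andP; split; rewrite leNgt; apply/negP => h.
    by apply: (gap_notin gaps (j := j) (x := Em k)) => //; rewrite h h2.
  by apply: (gap_notin gaps (j := k) (x := Em j)) => //; rewrite h h1.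
have ep : Ep k = Ep j.
  apply/le_anti/andP; split; rewrite leNgt; apply/negP => h.
    by apply: (gap_notin gaps (j := k) (x := Ep j)) => //; rewrite h em ltj.
  by apply: (gap_notin gaps (j := j) (x := Ep k)) => //; rewrite h -em ltk.
by rewrite em ep.
Qed.

Lemma exists_gap_index x : inf E < x < sup E -> ~ E x ->
  exists k, Em k < x < Ep k.
Proof.
move=> /andP[ix xs] nEx; have clE : closed E by exact: compact_closed.
have [h|E0] := pselect (E !=set0); last first.
  have E00 : E = set0 by apply/eqP/negPn/negP => /set0P.
  by move: ix xs; rewrite E00 inf0 sup0; lra.
have hi : has_inf E.
  by split => //; exists (inf E) => y /(E_bounds cE) /andP[].
have hs : has_sup E.
  by split => //; exists (sup E) => y /(E_bounds cE) /andP[].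
have [y Ey yx] := @inf_adherent _ E (x - inf E) ltac:(by rewrite subr_gt0) hi.
have [z Ez xz] := @sup_adherent _ E (sup E - x) ltac:(by rewrite subr_gt0) hs.
have [l [r [glr xlr]]] : exists l r, is_gap E l r /\ l < x < r.
  by apply: exists_gap => //; [exists y => //; lra|exists z => //; lra].
have [_ _ H] := gaps; have [k [kl kr]] := H _ _ glr.
by exists k; rewrite kl kr.
Qed.

Lemma density_right j : exists2 d : R, 0 < d & forall h : R, 0 < h < d ->
  ((h / 2)%:E <= lebesgue_measure (E `&` `[Ep j, (Ep j + h)%R]))%E.
Proof.
have [d d0 short] := near_gaps_short j.
have := edge_dist_gt0 cE gaps craig j; rewrite lt_min => /andP[e1 _].
have [Ej1 Ej2] := gap_edges_in cE gaps j.
have /andP[ei es] := E_bounds cE Ej2; have /andP[ei' es'] := E_bounds cE Ej1.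
have eps : Ep j < sup E.
  by move: e1; rewrite normr_gt0 subr_eq0 lt_neqAle es andbT.
exists (Num.min d (sup E - Ep j)); first by rewrite lt_min d0 subr_gt0.
move=> h /andP[h0]; rewrite lt_min => /andP[hd hs].
apply: (@interval_density j) => //; [by ring|by apply: short; rewrite h0 ltW|].
move=> x /andP[x1 x2] nEx; have ltj := gap_lt gaps j.
have [|k /andP[k1 k2]] := @exists_gap_index x _ nEx; first by apply/andP; split; lra.
have kj : k != j.
  by apply/eqP => kj; move: x1; rewrite -kj leNgt k2.
exists k; split => //; last by rewrite k1.
have [h1|h1] := gaps_disjoint kj.
  by have := gap_lt gaps j; lra.
by rewrite ge_min distrC ger0_norm; [apply/orP; left; lra|lra].
Qed.

Lemma density_left j : exists2 d : R, 0 < d & forall h : R, 0 < h < d ->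
  ((h / 2)%:E <= lebesgue_measure (E `&` `[(Em j - h)%R, Em j]))%E.
Proof.
have [d d0 short] := near_gaps_short j.
have := edge_dist_gt0 cE gaps craig j; rewrite lt_min => /andP[_ e1].
have [Ej1 Ej2] := gap_edges_in cE gaps j.
have /andP[ei es] := E_bounds cE Ej2; have /andP[ei' es'] := E_bounds cE Ej1.
have eps : inf E < Em j.
  by move: e1; rewrite normr_gt0 subr_eq0 lt_neqAle ei' andbT eq_sym.
exists (Num.min d (Em j - inf E)); first by rewrite lt_min d0 subr_gt0.
move=> h /andP[h0]; rewrite lt_min => /andP[hd hs].
apply: (@interval_density j) => //; [by ring|by apply: short; rewrite h0 ltW|].
move=> x /andP[x1 x2] nEx; have ltj := gap_lt gaps j.
have [|k /andP[k1 k2]] := @exists_gap_index x _ nEx; first by apply/andP; split; lra.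
have kj : k != j.
  by apply/eqP => kj; move: x2; rewrite -kj leNgt k1.
exists k; split => //; last by rewrite k1.
have [h1|h1] := gaps_disjoint kj; last by have := gap_lt gaps j; lra.
by rewrite ge_min; apply/orP; right; rewrite ger0_norm; lra.
Qed.

End Density.

(** * A third-order linear system *)

Section System.
Context {R : realType}.
Implicit Types (f df : R -> R).

Lemma derive_bound_le f df (C p q : R) : p <= q ->
  (forall t, p <= t <= q -> is_derive t (1 : R) f (df t)) ->
  (forall t, p <= t <= q -> `|df t| <= C) -> `|f q - f p| <= C * (q - p).
Proof.
move=> pq H B; have [pq'|qp] := ltP p q; last first.
  by rewrite (_ : q = p) ?subrr ?normr0 ?mulr0//; apply/le_anti/andP.
have [c /andP[c1 c2] ->] := MVT_is_derive pq' H.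
rewrite normrM (ger0_norm (x := q - p)) ?subr_ge0//.
by rewrite ler_wpM2r ?subr_ge0// B// !ltW.
Qed.

Lemma is_derive_continuous f (t d : R) : is_derive t (1 : R) f d ->
  {for t, continuous f}.
Proof. by move=> [h _]; apply/differentiable_continuous/derivable1_diffP. Qed.

(** The arithmetic of [midpoint_bounds] in rescaled variables: g, h, k are the
    initial values, g1 and gm the final and middle values of G / T. *)
Lemma midpoint_arith (g h k g1 gm S u e : R) :
  0 <= e -> 100 * e <= 1 -> 0 <= u -> 400 * u <= S ->
  `|g| <= e -> `|g1| <= e -> h ^+ 2 - g * k = 1 ->
  S <= `|g| + 3 * `|h| + 3 * `|k| + 11 * u ->
  `|g1 - (g + 2 * h + k)| <= 6 * u ->
  `|gm - (g + 2 * h * (1 / 2) + k * (1 / 2) ^+ 2)| <= 6 * u ->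
  1 / 4 <= `|gm| <= 1.
Proof.
move=> e0 e1 u0 u400 ge g1e dd Sle end1 mid.
have kh : `|k + 2 * h| <= 2 * e + 6 * u.
  have -> : k + 2 * h = g1 - g - (g1 - (g + 2 * h + k)) by ring.
  apply: (le_trans (ler_normB _ _)).
  have := ler_normB (g1) g; lra.
have ku : `|k| <= 2 * `|h| + 2 * e + 6 * u.
  have := ler_normB (k + 2 * h) (2 * h); rewrite addrK.
  rewrite [`|2 * h|]normrM (ger0_norm (ler0n R 2)); lra.
have S1 : S <= 11 * `|h| + 9 * e by lra.
have k1 : `|k| <= 3 * `|h| + 3 * e by lra.
have gk : `|g * k| <= e * (3 * `|h| + 3 * e) by rewrite normrM; apply: ler_pM.
have gk2 : `|g * k| <= (3 * `|h| + 3 * e) / 100.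
  apply: (le_trans gk); rewrite mulrC ler_wpM2l//; last lra.
  by rewrite addr_ge0 ?mulr_ge0.
have nh0 := normr_ge0 h.
have hh : `|h| ^+ 2 = h ^+ 2 by rewrite real_normK ?num_real.
have h1 : `|h| <= 51 / 50.
  rewrite leNgt; apply/negP => hgt.
  have : 51 / 50 * `|h| <= `|h| ^+ 2 by rewrite expr2 ler_wpM2r// ltW.
  rewrite hh; move: gk2; rewrite ler_norml => /andP[_ gk2]; lra.
have h2 : 49 / 50 <= `|h|.
  rewrite leNgt; apply/negP => hlt.
  have : `|h| ^+ 2 <= 49 / 50 * `|h| by rewrite expr2 ler_wpM2r// ltW.
  rewrite hh; move: gk2; rewrite ler_norml => /andP[gk2 _]; lra.
have main : `|gm - h / 2| <= 6 * u + `|g| + (2 * e + 6 * u) / 4.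
  have -> : gm - h / 2 =
    gm - (g + 2 * h * (1 / 2) + k * (1 / 2) ^+ 2) + (g + (k + 2 * h) / 4).
    by field.
  apply: (le_trans (ler_normD _ _)).
  have n4 : `|(k + 2 * h) / 4| <= (2 * e + 6 * u) / 4.
    by rewrite normrM (@ger0_norm _ 4^-1) ?invr_ge0// ler_wpM2r// invr_ge0.
  by have := ler_normD g ((k + 2 * h) / 4); lra.
have n2 : `|h / 2| = `|h| / 2 by rewrite normrM (@ger0_norm _ 2^-1)// invr_ge0.
have x1 : `|gm| <= 1.
  by have := ler_normD (gm - h / 2) (h / 2); rewrite subrK n2; lra.
have x2 : 1 / 4 <= `|gm|.
  have := ler_normB gm (gm - h / 2); rewrite (_ : gm - (gm - h / 2) = h / 2); last by ring.
  by rewrite n2; lra.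
by rewrite x1 x2.
Qed.

(** The system is satisfied by G = y z, H = (y z)' / 2, K = y' z' for two
    solutions y, z of the Schroedinger equation y'' = q y, and H^2 - G K is a
    quarter of the squared Wronskian.  On a short interval G is close to a
    quadratic polynomial of discriminant 4; when it is small at both ends its
    value at the midpoint is therefore close to T / 2 up to sign. *)
Lemma midpoint_bounds (G H K q : R -> R) (t0 T Q e : R) :
  0 < T -> 0 <= Q -> 400 * (Q * T ^+ 2) <= 1 -> 0 <= e -> 100 * e <= 1 ->
  (forall t, t0 <= t <= t0 + T -> is_derive t (1 : R) G (2 * H t)) ->
  (forall t, t0 <= t <= t0 + T -> is_derive t (1 : R) H (q t * G t + K t)) ->
  (forall t, t0 <= t <= t0 + T -> is_derive t (1 : R) K (2 * q t * H t)) ->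
  (forall t, t0 <= t <= t0 + T -> `|q t| <= Q) ->
  H t0 ^+ 2 - G t0 * K t0 = 1 ->
  `|G t0| <= e * T -> `|G (t0 + T)| <= e * T ->
  T / 4 <= `|G (t0 + T / 2)| <= T.
Proof.
move=> T0 Q0 QT e0 e1 dG dH dK qQ disc G0e G1e.
(* the three terms scale alike in T; the deviations of K, H and G from their
   Taylor polynomials at t0 are bounded below through the maximum S of m *)
pose m t := `|G t| / T + `|H t| + T * `|K t|.
have tT : t0 <= t0 + T by rewrite lerDl ltW.
have cm : {within `[t0, t0 + T], continuous m}.
  apply: continuous_in_subspaceT => t /[!inE] /=; rewrite in_itv /= => tt.
  have cG := is_derive_continuous (dG t tt).
  have cH := is_derive_continuous (dH t tt).
  have cK := is_derive_continuous (dK t tt).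
  apply: cvgD; first apply: cvgD.
  - by apply: cvgM; [exact: cvg_norm cG|exact: cvg_cst].
  - exact: cvg_norm cH.
  - by apply: cvgM; [exact: cvg_cst|exact: cvg_norm cK].
have [c /[!in_itv]/= cin cmax] := EVT_max tT cm.
pose S := m c.
have mS t : t0 <= t <= t0 + T -> m t <= S.
  by move=> tt; apply: cmax; rewrite in_itv.
have S0 : 0 <= S by rewrite /S /m !addr_ge0 ?mulr_ge0 ?invr_ge0 ?(ltW T0).
have bG t : t0 <= t <= t0 + T -> `|G t| <= T * S.
  move=> /mS; rewrite /m => h.
  rewrite mulrC -ler_pdivrMr//.
  by have := mulr_ge0 (ltW T0) (normr_ge0 (K t)); have := normr_ge0 (H t); lra.
have bH t : t0 <= t <= t0 + T -> `|H t| <= S.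
  move=> /mS; rewrite /m => h.
  have := mulr_ge0 (ltW T0) (normr_ge0 (K t)).
  have : 0 <= `|G t| / T by rewrite divr_ge0// ltW.
  lra.
pose th := Q * T ^+ 2.
have th0 : 0 <= th by rewrite mulr_ge0// sqr_ge0.
have thS : 400 * (th * S) <= S by rewrite mulrA ler_piMl.
have thS0 : 0 <= th * S by rewrite mulr_ge0.
have sub t s : t0 <= t <= t0 + T -> t0 <= s <= t -> t0 <= s <= t0 + T.
  by move=> /andP[_ h1] /andP[h2 h3]; rewrite h2 (le_trans h3).
have eK t : t0 <= t <= t0 + T -> T * `|K t - K t0| <= 2 * (th * S).
  move=> tt; have /andP[t1 t2] := tt.
  have h : `|K t - K t0| <= (2 * Q * S) * (t - t0).
    apply: derive_bound_le => // [s st|s st]; first exact: dK (sub _ _ tt st).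
    have ss := sub _ _ tt st.
    rewrite !normrM (ger0_norm (ler0n R 2)) -!mulrA ler_wpM2l//.
    by apply: ler_pM => //; [exact: qQ|exact: bH].
  apply: (le_trans (ler_wpM2l (ltW T0) h)).
  have h2 : 2 * Q * S * (t - t0) <= 2 * Q * S * T.
    by rewrite ler_wpM2l ?mulr_ge0//; lra.
  apply: (le_trans (ler_wpM2l (ltW T0) h2)); rewrite /th expr2.
  by apply: eqW_le; ring.
have eH t : t0 <= t <= t0 + T -> `|H t - H t0 - K t0 * (t - t0)| <= 3 * (th * S).
  move=> tt; have /andP[t1 t2] := tt.
  pose f s := H s - K t0 * (s - t0).
  have -> : H t - H t0 - K t0 * (t - t0) = f t - f t0 by rewrite /f; ring.
  apply: (@le_trans _ _ (3 * (th * S) / T * (t - t0))); last first.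
    have : 3 * (th * S) / T * (t - t0) <= 3 * (th * S) / T * T.
      by rewrite ler_wpM2l ?divr_ge0 ?mulr_ge0 ?(ltW T0)//; lra.
    by rewrite divfK// gt_eqF.
  apply: (@derive_bound_le f (fun s => q s * G s + K s - K t0)) => // s st.
    have d1 := dH _ (sub _ _ tt st).
    have d2 : is_derive s (1 : R) (fun s => K t0 * (s - t0)) (K t0).
      apply: is_derive_quadratic; exists 0, 1; split => // h _.
      have -> : K t0 * (s + h - t0) - K t0 * (s - t0) - h * K t0 = 0 by ring.
      by rewrite normr0 mul0r.
    exact: is_deriveB d1 d2.
  have ss := sub _ _ tt st.
  rewrite ler_pdivlMr// mulrC -{1}(gtr0_norm T0) -normrM mulrDr mulrDr mulrN.
  have -> : T * (q s * G s) + T * K s - T * K t0 = T * (q s * G s) + T * (K s - K t0) by ring.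
  apply: (le_trans (ler_normD _ _)); rewrite !normrM (gtr0_norm T0).
  have h1 := eK s ss.
  have h2 : `|q s| * `|G s| <= Q * (T * S) by apply: ler_pM => //; [exact: qQ|exact: bG].
  have h3 := ler_wpM2l (ltW T0) h2.
  have h4 : T * (Q * (T * S)) = th * S by rewrite /th expr2; ring.
  by rewrite h4 in h3; lra.
have eG t : t0 <= t <= t0 + T ->
    `|G t - G t0 - 2 * H t0 * (t - t0) - K t0 * (t - t0) ^+ 2| <= 6 * (th * S) * T.
  move=> tt; have /andP[t1 t2] := tt.
  pose f s := G s - (2 * H t0 * (s - t0) + K t0 * (s - t0) ^+ 2).
  have -> : G t - G t0 - 2 * H t0 * (t - t0) - K t0 * (t - t0) ^+ 2 = f t - f t0.
    by rewrite /f; ring.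
  apply: (@le_trans _ _ (6 * (th * S) * (t - t0))); last first.
    by rewrite ler_wpM2l ?mulr_ge0//; lra.
  apply: (@derive_bound_le f (fun s => 2 * H s - (2 * H t0 + 2 * K t0 * (s - t0)))) => // s st.
    have d1 := dG _ (sub _ _ tt st).
    have d2 : is_derive s (1 : R) (fun s => 2 * H t0 * (s - t0) + K t0 * (s - t0) ^+ 2)
        (2 * H t0 + 2 * K t0 * (s - t0)).
      apply: is_derive_quadratic; exists `|K t0|, 1; split => // h _.
      have -> : 2 * H t0 * (s + h - t0) + K t0 * (s + h - t0) ^+ 2 -
          (2 * H t0 * (s - t0) + K t0 * (s - t0) ^+ 2) -
          h * (2 * H t0 + 2 * K t0 * (s - t0)) = K t0 * h ^+ 2 by ring.
      by rewrite normrM (ger0_norm (sqr_ge0 h)).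
    exact: is_deriveB d1 d2.
  have -> : 2 * H s - (2 * H t0 + 2 * K t0 * (s - t0)) =
    2 * (H s - H t0 - K t0 * (s - t0)) by ring.
  rewrite normrM (ger0_norm (ler0n R 2)).
  by have := eH _ (sub _ _ tt st); lra.
clear dG dH dK qQ cm cmax sub bG bH Q0 QT ; pose g := G t0 / T; pose k := T * K t0; pose h := H t0; pose u := th * S.
have T0' : T != 0 by rewrite gt_eqF.
have ge : `|g| <= e by rewrite /g normrM normfV (gtr0_norm T0) ler_pdivrMr.
have nT x : `|x / T| = `|x| / T by rewrite normrM normfV (gtr0_norm T0).
have eG' (r : R) : 0 <= r <= 1 ->
    `|G (t0 + r * T) / T - (g + 2 * h * r + k * r ^+ 2)| <= 6 * u.
  move=> /andP[r0 r1].
  have rT : t0 <= t0 + r * T <= t0 + T.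
    by rewrite lerDl mulr_ge0 ?(ltW T0)// lerD2l ler_piMl// ltW.
  have := eG _ rT; rewrite -ler_pdivrMr// -nT.
  congr (_ <= _); congr `| _ |; rewrite /g /k /h; field; exact: T0'.
have g1e : `|G (t0 + T) / T| <= e.
  by rewrite nT ler_pdivrMr.
have end1 := eG' 1; rewrite mul1r ler01 lexx expr1n !mulr1 in end1.
have {}end1 := end1 isT.
have mid := eG' (1 / 2) ltac:(apply/andP; split; lra).
rewrite (_ : 1 / 2 * T = T / 2) in mid; last by field.
have u400 : 400 * u <= S by [].
have Sle : S <= `|g| + 3 * `|h| + 3 * `|k| + 11 * u.
  have /andP[c1 c2] := cin; clear mS eG mid end1 g1e G1e G0e disc.
  pose r := (c - t0) / T.
  have r01 : 0 <= r <= 1.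
    by rewrite divr_ge0 ?subr_ge0 ?(ltW T0)// ler_pdivrMr// mul1r; lra.
  have cE : c = t0 + r * T by rewrite /r divfK//; ring.
  clearbody r; have /andP[r0 r1] := r01.
  have k1 : `|G c| / T <= `|g| + 2 * `|h| + `|k| + 6 * u.
    have := eG' r r01; rewrite -cE => h1.
    rewrite -nT.
    have : `|g + 2 * h * r + k * r ^+ 2| <= `|g| + 2 * `|h| + `|k|.
      apply: (le_trans (ler_normD _ _)); apply: lerD.
        apply: (le_trans (ler_normD _ _)); rewrite lerD2l !normrM (ger0_norm (ler0n R 2)).
        by rewrite (ger0_norm r0) ler_piMr// mulr_ge0.
      by rewrite normrM (ger0_norm (sqr_ge0 r)) ler_piMr// exprn_ile1.
    have := ler_normD (G c / T - (g + 2 * h * r + k * r ^+ 2)) (g + 2 * h * r + k * r ^+ 2).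
    by rewrite subrK; lra.
  have k2 : `|H c| <= `|h| + `|k| + 3 * u.
    have := eH c cin; set X := H c - H t0 - _ => h1.
    have -> : H c = X + (h + K t0 * (c - t0)) by rewrite /X /h; ring.
    apply: (le_trans (ler_normD _ _)).
    have := ler_normD h (K t0 * (c - t0)).
    have : `|K t0 * (c - t0)| <= `|k|.
      rewrite /k !normrM mulrC ler_wpM2r// (gtr0_norm T0) ger0_norm; lra.
    rewrite -/u in h1; lra.
  have k3 : T * `|K c| <= `|k| + 2 * u.
    have := eK c cin; rewrite -/u => h1.
    have : `|K c| <= `|K c - K t0| + `|K t0|.
      by have := ler_normD (K c - K t0) (K t0); rewrite subrK.
    move/(ler_wpM2l (ltW T0)); rewrite mulrDr /k normrM (gtr0_norm T0); lra.
  by rewrite /S /m; lra.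
have dd : h ^+ 2 - g * k = 1 by rewrite -disc /g /k /h; field.
have GT : `|G (t0 + T / 2)| = `|G (t0 + T / 2) / T| * T by rewrite nT divfK.
have /andP[x2 x1] := midpoint_arith e0 e1 thS0 u400 ge g1e dd Sle end1 mid.
rewrite GT; apply/andP; split.
  by apply: le_trans (ler_wpM2r (ltW T0) x2); rewrite mul1r mulrC.
by apply: (le_trans (ler_wpM2r (ltW T0) x1)); rewrite mul1r.
Qed.

End System.

(** * Evolution of the Green function under the Toda flow *)

Section Perturbation.
Context {R : realType}.
Implicit Types (a b : int -> R) (u f g : int -> R[i]).

(** Second resolvent identity. *)
Lemma resolvent_perturbation a b M a1 b1 M1 z f :
  coeffs_le a b M -> coeffs_le a1 b1 M1 ->
  resolvent_set a b z -> resolvent_set a1 b1 z -> ell2 f ->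
  resolvent a1 b1 z f = addz (resolvent a b z f)
    (scalez (-1) (resolvent a b z (jacobi (fun n => a1 n - a n)
      (fun n => b1 n - b n) (resolvent a1 b1 z f)))).
Proof.
move=> abM abM1 zR zR1 ef; have [e1 f1] := resolventP zR1 ef.
set v := resolvent a1 b1 z f in e1 f1 *.
have dM : coeffs_le (fun n => a1 n - a n) (fun n => b1 n - b n) (M1 + M).
  move=> n; have [h1 h2] := abM n; have [h3 h4] := abM1 n.
  by split; apply: (le_trans (ler_normB _ _)); lra.
have ed := ell2_jacobi dM e1.
rewrite -(resolventZ abM zR _ ed) -(resolventD abM zR ef (ell2Z (-1) ed)).
apply: (resolvent_uniq abM zR e1).
rewrite -[in RHS]f1; apply/funext => n.
rewrite /jacobi_shift /addz /scalez /jacobi !rmorphB /=; ring.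
Qed.

End Perturbation.

Lemma perturbation_arith1 {R : realType} (K C N h : R) :
  40 * K * C * h * N <= 1 * N -> K * (10 * C * N) * h <= N / 4.
Proof. by lra. Qed.

Lemma perturbation_arith2 {R : realType} (N N0 D K Nf : R) :
  N <= 2 * N0 + 2 * D -> N0 <= K * Nf -> D <= N / 4 -> N <= 4 * K * Nf.
Proof. by lra. Qed.

Lemma perturbation_arith3 {R : realType} (A B k l h : R) :
  h * A <= h * (k * h) -> B <= l * h ^+ 2 ->
  2 * (h * A) + 2 * B <= (2 * k + 2 * l) * h ^+ 2.
Proof. by rewrite !expr2; lra. Qed.

Section TimeDerivative.
Context {R : realType} (a b a' b' : R -> int -> R) (s x M C tau : R).
Implicit Types (u f g : int -> R[i]).

Notation Rs t := (resolvent (a t) (b t) x%:C).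

Context (tau0 : 0 < tau).
Context (abM : forall t, `|t - s| < tau -> coeffs_le (a t) (b t) M).
Context (abM' : coeffs_le (a' s) (b' s) M).
Context (abC : forall t, `|t - s| < tau ->
  coeffs_le (fun n => a t n - a s n) (fun n => b t n - b s n) (C * `|t - s|)).
Context (abC2 : forall t, `|t - s| < tau ->
  coeffs_le (fun n => a t n - a s n - (t - s) * a' s n)
    (fun n => b t n - b s n - (t - s) * b' s n) (C * (t - s) ^+ 2)).
Context (xR : forall t, resolvent_set (a t) (b t) x%:C).

Lemma is_derive_resolvent_time f g : ell2 f -> ell2 g ->
  is_derive s (1 : R) (fun t => rdot g (Rs t f))
    (- rdot g (Rs s (jacobi (a' s) (b' s) (Rs s f)))).
Proof.
move=> ef eg.
have ss : `|s - s| < tau by rewrite subrr normr0.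
have abs := abM ss.
have [K K0 HK] := resolvent_bounded abs (xR s).
have es := ell2_resolvent (xR s) ef.
have C20 : 0 <= C ^+ 2 by exact: sqr_ge0.
pose e1 := Num.min tau (Num.min 1 (40 * K * (C ^+ 2 + 1))^-1).
have D0 : 0 < 40 * K * (C ^+ 2 + 1) by rewrite !mulr_gt0// ltr_wpDl.
pose V : R := 4 * K * nrm2 f.
pose W : R := K * (10 * C ^+ 2 * V).
pose Z : R := 2 * (K * (10 * M ^+ 2 * W)) + 2 * (K * (10 * C ^+ 2 * V)).
apply: is_derive_quadratic; exists (Num.sqrt (nrm2 g * Z)), e1; split.
  by rewrite !lt_min tau0 ltr01 invr_gt0.
move=> h; rewrite !lt_min => /and3P[ht h1 hK].
have sh : `|s + h - s| < tau by rewrite addrAC subrr add0r.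
have hE : s + h - s = h by ring.
have eh := ell2_resolvent (xR (s + h)) ef.
set v := Rs (s + h) f in eh *; set v0 := Rs s f in es *.
have pert := resolvent_perturbation abs (abM sh) (xR s) (xR (s + h)) ef.
rewrite -/v -/v0 in pert.
have cC := abC sh; rewrite hE in cC; have cC2 := abC2 sh; rewrite hE in cC2.
have ed := ell2_jacobi cC eh; have ed2 := ell2_jacobi cC2 eh.
have eRd := ell2_resolvent (xR s) ed; have eRd2 := ell2_resolvent (xR s) ed2.
have hh : `|h| ^+ 2 = h ^+ 2 by rewrite real_normK ?num_real.
have h2 : h ^+ 2 <= `|h|.
  by rewrite -hh expr2 ler_piMr// ltW.
have Nv0 := nrm2_ge0 eh; have Nf := nrm2_ge0 ef.
have nd : nrm2 (Rs s (jacobi (fun n => a (s + h) n - a s n)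
    (fun n => b (s + h) n - b s n) v)) <= K * (10 * C ^+ 2 * nrm2 v) * h ^+ 2.
  apply: (le_trans (HK _ ed)); rewrite -mulrA ler_wpM2l ?(ltW K0)//.
  apply: (le_trans (nrm2_jacobi cC eh)); rewrite exprMn hh.
  by apply: eqW_le; ring.
have Nv : nrm2 v <= V.
  have h3 := nrm2D_le es (ell2Z (-1) eRd); rewrite -pert (nrm2Z _ eRd) in h3.
  have s1 : sqc (-1 : R[i]) = 1 by rewrite sqcN /sqc /=; ring.
  rewrite s1 mul1r in h3.
  have h4 := HK _ ef; rewrite -/v0 in h4.
  have h5 : K * (10 * C ^+ 2 * nrm2 v) * h ^+ 2 <= nrm2 v / 4.
    have h6 : 40 * K * (C ^+ 2 + 1) * h ^+ 2 <= 1.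
      rewrite -ler_pdivlMl// mulr1; exact: le_trans h2 (ltW hK).
    have h7 : 40 * K * C ^+ 2 * h ^+ 2 <= 1.
      apply: le_trans h6; rewrite ler_wpM2r ?sqr_ge0// ler_wpM2l ?mulr_ge0 ?(ltW K0)//.
      by rewrite lerDl.
    exact: perturbation_arith1 (ler_wpM2r Nv0 h7).
  exact: perturbation_arith2 h3 h4 (le_trans nd h5).
have ND : nrm2 (addz v (scalez (-1) v0)) <= W * h ^+ 2.
  have -> : addz v (scalez (-1) v0) = scalez (-1) (Rs s (jacobi
    (fun n => a (s + h) n - a s n) (fun n => b (s + h) n - b s n) v)).
    by rewrite {1}pert; apply/funext => n; rewrite /addz /scalez; ring.
  have s1 : sqc (-1 : R[i]) = 1 by rewrite sqcN /sqc /=; ring.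
  rewrite (nrm2Z _ eRd) s1 mul1r; apply: (le_trans nd).
  rewrite ler_wpM2r ?sqr_ge0// /W ler_wpM2l ?(ltW K0)// ler_wpM2l// mulr_ge0//.
set w := addz v (scalez (-1) v0) in ND.
have ew : ell2 w by exact: ell2D eh (ell2Z _ es).
have eJ0 := ell2_jacobi abM' es; have eJw := ell2_jacobi abM' ew.
have eR0 := ell2_resolvent (xR s) eJ0; have eRw := ell2_resolvent (xR s) eJw.
pose Y := addz (scalez h%:C (Rs s (jacobi (a' s) (b' s) w)))
  (Rs s (jacobi (fun n => a (s + h) n - a s n - h * a' s n)
         (fun n => b (s + h) n - b s n - h * b' s n) v)).
have eY : ell2 Y by exact: ell2D (ell2Z _ eRw) eRd2.
have vE : v = addz v0 (scalez (-1) (addz (scalez h%:C (Rs s (jacobi (a' s) (b' s) v0))) Y)).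
  rewrite {1}pert; congr (addz _ (scalez _ _)).
  have -> : jacobi (fun n => a (s + h) n - a s n) (fun n => b (s + h) n - b s n) v =
    addz (scalez h%:C (jacobi (a' s) (b' s) v0)) (addz (scalez h%:C (jacobi (a' s) (b' s) w))
     (jacobi (fun n => a (s + h) n - a s n - h * a' s n)
         (fun n => b (s + h) n - b s n - h * b' s n) v)).
    apply/funext => n; rewrite /jacobi /addz /scalez /w /addz /scalez.
    by rewrite !rmorphB /= !rmorphM /=; ring.
  have e3 := ell2Z h%:C eJ0; have e4 := ell2Z h%:C eJw.
  rewrite (resolventD abs (xR s) e3 (ell2D e4 ed2)) (resolventD abs (xR s) e4 ed2).
  by rewrite !(resolventZ abs (xR s)).
have NY : nrm2 Y <= Z * (h ^+ 2) ^+ 2.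
  have h20 := sqr_ge0 h.
  have p1 := nrm2D_le (ell2Z h%:C eRw) eRd2.
  rewrite (nrm2Z _ eRw) sqc_real in p1; apply: (le_trans p1).
  have p2 : nrm2 (Rs s (jacobi (a' s) (b' s) w)) <= K * (10 * M ^+ 2 * W) * h ^+ 2.
    apply: (le_trans (HK _ eJw)); rewrite -mulrA ler_wpM2l ?(ltW K0)//.
    apply: (le_trans (nrm2_jacobi abM' ew)).
    have m0 : 0 <= 10 * M ^+ 2 by rewrite mulr_ge0 ?sqr_ge0.
    by rewrite -[leRHS]mulrA (ler_wpM2l m0).
  have p3 : nrm2 (Rs s (jacobi (fun n => a (s + h) n - a s n - h * a' s n)
         (fun n => b (s + h) n - b s n - h * b' s n) v)) <= K * (10 * C ^+ 2 * V) * (h ^+ 2) ^+ 2.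
    apply: (le_trans (HK _ ed2)); rewrite -mulrA ler_wpM2l ?(ltW K0)//.
    apply: (le_trans (nrm2_jacobi cC2 eh)).
    have -> : 10 * (C * h ^+ 2) ^+ 2 * nrm2 v = 10 * C ^+ 2 * nrm2 v * (h ^+ 2) ^+ 2 by ring.
    by rewrite ler_wpM2r ?sqr_ge0// ler_wpM2l// mulr_ge0.
  exact: perturbation_arith3 (ler_wpM2l h20 p2) p3.
have hRE : rdot g v - rdot g v0 - h * - rdot g (Rs s (jacobi (a' s) (b' s) v0)) = - rdot g Y.
  rewrite {1}vE; have e5 := ell2Z h%:C eR0.
  have -> : -1 = (-1)%:C :> R[i] by rewrite rmorphN1.
  rewrite (rdotDr eg es (ell2Z _ (ell2D e5 eY))) (rdotZr _ eg (ell2D e5 eY)).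
  rewrite (rdotDr eg e5 eY) (rdotZr _ eg eR0); ring.
rewrite hRE normrN.
have Ng := nrm2_ge0 eg.
have cs := rdot_CS eg eY.
have Z0 : 0 <= Z.
  have k0 := ltW K0; have M20 : 0 <= M ^+ 2 by exact: sqr_ge0.
  have V0 : 0 <= V by rewrite /V mulr_ge0 ?mulr_ge0.
  have c0 : 0 <= 10 * C ^+ 2 by rewrite mulr_ge0.
  have m0 : 0 <= 10 * M ^+ 2 by rewrite mulr_ge0.
  have W0 : 0 <= W by apply: (mulr_ge0 k0); exact: (mulr_ge0 c0 V0).
  have z1 := mulr_ge0 k0 (mulr_ge0 m0 W0).
  have z2 := mulr_ge0 k0 (mulr_ge0 c0 V0).
  by rewrite addr_ge0// mulr_ge0.
rewrite -(sqrtr_sqr (rdot g Y)) -[h ^+ 2](ger0_norm (sqr_ge0 h)) -(sqrtr_sqr (h ^+ 2)).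
rewrite -sqrtrM ?mulr_ge0// ler_wsqrtr//; apply: (le_trans cs).
by rewrite -mulrA ler_wpM2l.
Qed.

End TimeDerivative.

Section Toda.
Context {R : realType}.
Implicit Types (f df : R -> R).

Lemma derive_bound_sym f df (C s r : R) :
  (forall t, `|t - s| <= r -> is_derive t (1 : R) f (df t)) ->
  (forall t, `|t - s| <= r -> `|df t| <= C) ->
  forall t, `|t - s| <= r -> `|f t - f s| <= C * `|t - s|.
Proof.
move=> H B t tr; have [ts|st] := leP t s.
  rewrite distrC (distrC t s) (ger0_norm (x := s - t)) ?subr_ge0//.
  have H' u : t <= u <= s -> `|u - s| <= r.
    move=> /andP[u1 u2]; apply: le_trans tr.
    by rewrite distrC (distrC t s) !ger0_norm; lra.
  by apply: (@derive_bound_le _ f df) => // u /H'; [exact: H|exact: B].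
rewrite (ger0_norm (x := t - s)) ?subr_ge0 ?(ltW st)//.
have H' u : s <= u <= t -> `|u - s| <= r.
  move=> /andP[u1 u2]; apply: le_trans tr.
  by rewrite !ger0_norm; lra.
by apply: (@derive_bound_le _ f df) => //; [exact: ltW|move=> u /H'; exact: H|move=> u /H'; exact: B].
Qed.

Lemma derive_second_order f df (C s r : R) : 0 <= C ->
  (forall t, `|t - s| <= r -> is_derive t (1 : R) f (df t)) ->
  (forall t, `|t - s| <= r -> `|df t - df s| <= C * `|t - s|) ->
  forall t, `|t - s| <= r -> `|f t - f s - (t - s) * df s| <= C * (t - s) ^+ 2.
Proof.
move=> C0 H B t tr.
pose g u := f u - (u - s) * df s.
have -> : f t - f s - (t - s) * df s = g t - g s by rewrite /g; ring.
have dg u : `|u - s| <= `|t - s| -> is_derive u (1 : R) g (df u - df s).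
  move=> ut; have d1 := H u (le_trans ut tr).
  have d2 : is_derive u (1 : R) (fun u => (u - s) * df s) (df s).
    apply: is_derive_quadratic; exists 0, 1; split => // h _.
    have -> : (u + h - s) * df s - (u - s) * df s - h * df s = 0 by ring.
    by rewrite normr0 mul0r.
  exact: is_deriveB d1 d2.
have bg u : `|u - s| <= `|t - s| -> `|df u - df s| <= C * `|t - s|.
  move=> ut; apply: (le_trans (B u (le_trans ut tr))); exact: ler_wpM2l.
apply: (le_trans (derive_bound_sym dg bg (lexx _))).
by rewrite -mulrA -expr2 real_normK ?num_real.
Qed.

Context (a b : R -> int -> R) (toda : toda_solution a b).
Context (a_gt0 : forall t n, 0 < a t n).
Context (B : R) (bB : forall t n, `|b t n| <= B).

Definition toda_da (t : R) (n : int) : R := a t n * (b t (n + 1) - b t n).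
Definition toda_db (t : R) (n : int) : R := 2 * (a t n ^+ 2 - a t (n - 1) ^+ 2).

Let B0 : 0 <= B. Proof. exact: le_trans (normr_ge0 _) (bB 0 0). Qed.

Let bdiff t n m : `|b t n - b t m| <= 2 * B.
Proof. by apply: (le_trans (ler_normB _ _)); have := bB t n; have := bB t m; lra. Qed.

(** The off-diagonal coefficients grow at most exponentially, uniformly in n,
    because the diagonal ones stay bounded. *)
Lemma toda_offdiagonal_local (s A r : R) : (forall n, a s n <= A) ->
  0 <= r -> 4 * B * r <= 1 ->
  forall t n, `|t - s| <= r -> a t n <= 2 * A.
Proof.
move=> aA r0 Br t n tr.
have sr : s - r <= s + r by lra.
have da u : is_derive u (1 : R) (fun t => a t n) (toda_da u n) by case: (toda u n).
have ca : {within `[s - r, s + r], continuous (fun t => a t n)}.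
  apply: continuous_in_subspaceT => u _; exact: is_derive_continuous (da u).
have [c /[!in_itv]/= cin cmax] := EVT_max sr ca.
have cr : `|c - s| <= r by rewrite ler_norml; case/andP: cin => *; apply/andP; split; lra.
have max u : `|u - s| <= r -> a u n <= a c n.
  rewrite ler_norml => /andP[u1 u2]; apply: cmax; rewrite in_itv /=.
  by apply/andP; split; lra.
have bound u : `|u - s| <= r -> `|toda_da u n| <= a c n * (2 * B).
  move=> ur; rewrite /toda_da normrM (gtr0_norm (a_gt0 _ _)).
  apply: ler_pM; [exact: ltW|exact: normr_ge0|exact: max|exact: bdiff].
have h := derive_bound_sym (fun u _ => da u) bound cr.
have ac := a_gt0 c n.
have h2 : a c n * (2 * B) * `|c - s| <= a c n / 2.
  have h3 : a c n * (2 * B) * `|c - s| <= a c n * (2 * B) * r.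
    by rewrite ler_wpM2l// mulr_ge0 ?mulr_ge0// ltW.
  have := ler_wpM2l (ltW ac) Br; lra.
have := le_trans h h2; rewrite ler_norml => /andP[_ h4].
have := aA n; have := max t tr; lra.
Qed.

Context (a_bounded : forall t, exists A, forall n, a t n <= A).

(** The hypotheses of [is_derive_resolvent_time] hold near any time. *)
Lemma toda_local_bounds (s : R) : exists tau M C : R, [/\ 0 < tau,
  forall t, `|t - s| < tau -> coeffs_le (a t) (b t) M,
  coeffs_le (toda_da s) (toda_db s) M,
  forall t, `|t - s| < tau ->
    coeffs_le (fun n => a t n - a s n) (fun n => b t n - b s n) (C * `|t - s|) &
  forall t, `|t - s| < tau ->
    coeffs_le (fun n => a t n - a s n - (t - s) * toda_da s n)
      (fun n => b t n - b s n - (t - s) * toda_db s n) (C * (t - s) ^+ 2)].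
Proof.
have [A0 aA0] := a_bounded s.
have A0pos : 0 < A0 by exact: lt_le_trans (a_gt0 s 0) (aA0 0).
pose r : R := (4 * B + 1)^-1.
have r0 : 0 < r by rewrite invr_gt0 ltr_wpDl ?mulr_ge0.
have Br : 4 * B * r <= 1.
  by rewrite ler_pdivrMr ?mul1r; [lra|rewrite ltr_wpDl ?mulr_ge0].
have aL := toda_offdiagonal_local aA0 (ltW r0) Br.
pose A := 2 * A0; have Ap : 0 < A by rewrite mulr_gt0.
have aA t n : `|t - s| <= r -> `|a t n| <= A.
  by move=> tr; rewrite gtr0_norm//; exact: aL.
have daB t n : `|t - s| <= r -> `|toda_da t n| <= 2 * A * B.
  move=> tr; rewrite /toda_da normrM.
  apply: (le_trans (ler_pM (normr_ge0 _) (normr_ge0 _) (aA t n tr) (bdiff t (n + 1) n))).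
  by apply: eqW_le; ring.
have dbB t n : `|t - s| <= r -> `|toda_db t n| <= 4 * A ^+ 2.
  move=> tr; rewrite /toda_db normrM (ger0_norm (ler0n R 2)).
  have h m : `|a t m ^+ 2| <= A ^+ 2.
    by rewrite normrX ler_pXn2r ?nnegrE ?(ltW Ap)// aA.
  have := ler_normB (a t n ^+ 2) (a t (n - 1) ^+ 2).
  have := h n; have := h (n - 1); lra.
have dera n u : is_derive u (1 : R) (fun t => a t n) (toda_da u n) by case: (toda u n).
have derb n u : is_derive u (1 : R) (fun t => b t n) (toda_db u n) by case: (toda u n).
have aLip t n : `|t - s| <= r -> `|a t n - a s n| <= 2 * A * B * `|t - s|.
  move=> tr; apply: (@derive_bound_sym _ (toda_da^~ n) _ s r) => // u ur; exact: daB.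
have bLip t n : `|t - s| <= r -> `|b t n - b s n| <= 4 * A ^+ 2 * `|t - s|.
  move=> tr; apply: (@derive_bound_sym _ (toda_db^~ n) _ s r) => // u ur; exact: dbB.
pose Ca := 4 * A * B ^+ 2 + 8 * A ^+ 3.
pose Cb := 16 * A ^+ 2 * B.
have p1 : 0 <= A * B ^+ 2 by rewrite mulr_ge0 ?sqr_ge0 ?(ltW Ap).
have p2 : 0 <= A ^+ 3 by rewrite exprn_ge0 ?(ltW Ap).
have p3 : 0 <= A ^+ 2 * B by rewrite mulr_ge0 ?sqr_ge0.
have p4 : 0 <= A * B by rewrite mulr_ge0 ?(ltW Ap).
have Ca0 : 0 <= Ca by rewrite /Ca; lra.
have Cb0 : 0 <= Cb by rewrite /Cb; lra.
have ss : `|s - s| <= r by rewrite subrr normr0 ltW.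
have daLip t n : `|t - s| <= r -> `|toda_da t n - toda_da s n| <= Ca * `|t - s|.
  move=> tr; rewrite /toda_da.
  have -> : a t n * (b t (n + 1) - b t n) - a s n * (b s (n + 1) - b s n) =
    (a t n - a s n) * (b t (n + 1) - b t n) +
    a s n * ((b t (n + 1) - b s (n + 1)) - (b t n - b s n)) by ring.
  apply: (le_trans (ler_normD _ _)); rewrite !normrM.
  have h1 := ler_pM (normr_ge0 _) (normr_ge0 _) (aLip t n tr) (bdiff t (n + 1) n).
  have h2 := le_trans (ler_normB _ _) (lerD (bLip t (n + 1) tr) (bLip t n tr)).
  have h3 := ler_pM (normr_ge0 _) (normr_ge0 _) (aA s n ss) h2.
  apply: (le_trans (lerD h1 h3)); apply: eqW_le; rewrite /Ca; ring.
have dbLip t n : `|t - s| <= r -> `|toda_db t n - toda_db s n| <= Cb * `|t - s|.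
  move=> tr; rewrite /toda_db.
  have h m : `|a t m ^+ 2 - a s m ^+ 2| <= 4 * A ^+ 2 * B * `|t - s|.
    rewrite subr_sqr normrM.
    have h1 := le_trans (ler_normD _ _) (lerD (aA t m tr) (aA s m ss)).
    have := ler_pM (normr_ge0 _) (normr_ge0 _) (aLip t m tr) h1.
    by move=> /le_trans; apply; apply: eqW_le; ring.
  have -> : 2 * (a t n ^+ 2 - a t (n - 1) ^+ 2) - 2 * (a s n ^+ 2 - a s (n - 1) ^+ 2) =
    2 * ((a t n ^+ 2 - a s n ^+ 2) - (a t (n - 1) ^+ 2 - a s (n - 1) ^+ 2)) by ring.
  rewrite normrM (ger0_norm (ler0n R 2)).
  have h2 := le_trans (ler_normB _ _) (lerD (h n) (h (n - 1))).
  apply: (le_trans (ler_wpM2l (ler0n R 2) h2)); apply: eqW_le; rewrite /Cb; ring.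
pose M := A + B + 2 * A * B + 4 * A ^+ 2.
pose C := 2 * A * B + 4 * A ^+ 2 + Ca + Cb.
have A20 := sqr_ge0 A; have Bge0 : 0 <= B by exact: B0.
exists r, M, C; split => //.
- move=> t /ltW tr n; split.
    by apply: (le_trans (aA t n tr)); rewrite /M; lra.
  by apply: (le_trans (bB t n)); rewrite /M; lra.
- move=> n; split.
    by apply: (le_trans (daB s n ss)); rewrite /M; lra.
  by apply: (le_trans (dbB s n ss)); rewrite /M; lra.
- move=> t /ltW tr n; split.
    by apply: (le_trans (aLip t n tr)); rewrite ler_wpM2r// /C; lra.
  by apply: (le_trans (bLip t n tr)); rewrite ler_wpM2r// /C; lra.
- move=> t /ltW tr n; split.
    apply: (le_trans (derive_second_order Ca0 (fun u _ => dera n u) (daLip^~ n) tr)).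
    by rewrite ler_wpM2r ?sqr_ge0// /C; lra.
  apply: (le_trans (derive_second_order Cb0 (fun u _ => derb n u) (dbLip^~ n) tr)).
  by rewrite ler_wpM2r ?sqr_ge0// /C; lra.
Qed.

End Toda.

Section TodaGreen.
Context {R : realType} (a b : R -> int -> R) (toda : toda_solution a b).
Context (coeffs : forall t, jacobi_coeffs (a t) (b t)).
Context (B : R) (bB : forall t n, `|b t n| <= B).
Context (x : R) (xR : forall t, resolvent_set (a t) (b t) x%:C).
Implicit Types (t s : R) (m n : int) (u f : int -> R[i]).

Notation Rs t := (resolvent (a t) (b t) x%:C).

Definition greenmn t m n : R := complex.Re (Rs t (delta R n) m).

Let a_gt0 t n : 0 < a t n.
Proof. by have [h _ _] := coeffs t. Qed.

Let a_bounded t : exists A, forall n, a t n <= A.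
Proof.
have [_ [A hA] _] := coeffs t; exists A => n.
by apply: le_trans (hA n); exact: ler_norm.
Qed.

Let cle t : exists M, coeffs_le (a t) (b t) M.
Proof. exact: coeffs_le_exists. Qed.

(** The skew-symmetric operator P of the Lax pair J' = P J - J P. *)
Definition lax (c : int -> R) u : int -> R[i] :=
  fun n => (c n)%:C * u (n + 1) - (c (n - 1))%:C * u (n - 1).

Lemma ell2_lax t u : ell2 u -> ell2 (lax (a t) u).
Proof.
move=> eu; have [M abM] := cle t.
have e1 := ell2_mul (fun n => proj1 (abM n)) (ell2_shift 1 eu).
have e2 := ell2_shift (-1) (ell2_mul (fun n => proj1 (abM n)) eu).
have := ell2D e1 (ell2Z (-1) e2).
by apply: eq_ell2 => n; rewrite /lax /addz /scalez /mulz /shiftz mulN1r.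
Qed.

Lemma lax_equation t u :
  jacobi (toda_da a b t) (toda_db a t) u =
  addz (lax (a t) (jacobi_shift (a t) (b t) x%:C u))
    (scalez (-1) (jacobi_shift (a t) (b t) x%:C (lax (a t) u))).
Proof.
apply/funext => n.
rewrite /jacobi /toda_da /toda_db /addz /scalez /lax /jacobi_shift /jacobi.
rewrite ?addrK ?subrK !rmorphM /= !rmorphB /= !rmorphXn /= rmorph_nat.
ring.
Qed.

Lemma lax_delta t n : lax (a t) (delta R n) =
  addz (scalez (a t (n - 1))%:C (delta R (n - 1)))
       (scalez (- a t n)%:C (delta R (n + 1))).
Proof.
apply/funext => m; rewrite /lax /addz /scalez /delta.
rewrite (_ : (m - 1 == n) = (m == n + 1)); last by rewrite subr_eq.
rewrite (_ : (m == n - 1) = (m + 1 == n)); last by rewrite -subr_eq opprK.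
case: (eqVneq (m + 1) n) => [<-|_].
  rewrite addrK; case: eqVneq => [mE|_]; last by rewrite mulr0 subr0 mulr0 addr0.
  by move/eqP: mE; rewrite -addrA -[X in X == _]addr0 (inj_eq (addrI m)).
case: eqVneq => [->|_]; last by rewrite !mulr0 subr0 addr0.
by rewrite addrK !mulr0 sub0r add0r rmorphN mulNr.
Qed.

Lemma greenmn_sym t m n : greenmn t m n = greenmn t n m.
Proof.
have [M abM] := cle t.
have := rdot_resolvent abM (xR t) (@ell2_delta R m) (@ell2_delta R n).
by rewrite (rdotC (Rs t (delta R m))) !rdot_delta => E; rewrite /greenmn E.
Qed.

Lemma greenmn_row t m n :
  a t m * greenmn t (m + 1) n + (b t m - x) * greenmn t m n +
  a t (m - 1) * greenmn t (m - 1) n = (m == n)%:R.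
Proof.
have [_ E] := resolventP (xR t) (@ell2_delta R n).
move: (congr1 (fun u => complex.Re (u m)) E); rewrite /jacobi_shift /jacobi /greenmn.
have -> : complex.Re (delta R n m) = (m == n)%:R by rewrite /delta; case: eqP.
move=> <-; case: (Rs t _ (m + 1)) => p1 q1; case: (Rs t _ m) => p q.
by case: (Rs t _ (m - 1)) => p2 q2 /=; ring.
Qed.

(** By the Lax equation the resolvent R satisfies R' = P R - R P. *)
Lemma is_derive_greenmn t m n :
  is_derive t (1 : R) (fun s => greenmn s m n)
    (a t m * greenmn t (m + 1) n - a t (m - 1) * greenmn t (m - 1) n
     - a t (n - 1) * greenmn t m (n - 1) + a t n * greenmn t m (n + 1)).
Proof.
have [tau [M [C [tau0 h1 h2 h3 h4]]]] := toda_local_bounds toda a_gt0 bB a_bounded t.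
have [em en] := (@ell2_delta R m, @ell2_delta R n).
have := is_derive_resolvent_time tau0 h1 h2 h3 h4 xR en em.
have [M' abM] := cle t.
have [eu uf] := resolventP (xR t) en; set u := Rs t _ in eu uf *.
have ep := ell2_lax t eu; have ed := ell2_lax t en.
have eJ := ell2_jacobi_shift abM x%:C ep.
rewrite lax_equation uf (resolventD abM (xR t) ed (ell2Z (-1) eJ)).
rewrite (resolventZ abM (xR t) _ eJ) (resolventK abM (xR t) ep) lax_delta.
have [e1 e2] := (@ell2_delta R (n - 1), @ell2_delta R (n + 1)).
rewrite (resolventD abM (xR t) (ell2Z _ e1) (ell2Z _ e2)).
rewrite (resolventZ abM (xR t) _ e1) (resolventZ abM (xR t) _ e2) rdot_delta.
rewrite (_ : (fun s => rdot (delta R m) (Rs s (delta R n))) = fun s => greenmn s m n); last first.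
  by apply/funext => s; rewrite rdot_delta.
move=> d; apply: (is_derive_eq d).
rewrite /greenmn -/u /addz /scalez /lax.
case: (u (m + 1)) => p1 q1; case: (u (m - 1)) => p2 q2.
by case: (Rs t _ m) => p3 q3; case: (Rs t _ m) => p4 q4 /=; ring.
Qed.

(** Both columns solve the homogeneous equation to the right of site 0, and
    the square summable solutions there are proportional; pairing the column
    at -1 with the column at 0 cut off at 0 gives the vanishing Wronskian. *)
Lemma greenmn_rank_one t :
  greenmn t 1 0 * greenmn t (-1) 0 = greenmn t 0 0 * greenmn t 1 (-1).
Proof.
have [M abM] := cle t.
have [e0 e1] := (@ell2_delta R 0, @ell2_delta R (-1)).
have [eu uf] := resolventP (xR t) e0; have [ev vf] := resolventP (xR t) e1.
have ru := resolvent_real abM (xR t) e0 (@realz_delta R 0).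
rewrite (greenmn_sym t (-1) 0) /greenmn.
set u := Rs t (delta R 0) in eu uf ru *; set v := Rs t (delta R (-1)) in ev vf *.
pose chi (n : int) : R := if 0 < n then 1 else 0.
have chi1 n : `|chi n| <= 1 by rewrite /chi; case: ifP; rewrite ?normr1// normr0.
pose w := mulz chi u.
have ew : ell2 w := ell2_mul chi1 eu.
pose c0 : R := a t 0 * complex.Re (u 1); pose c1 : R := - (a t 0 * complex.Re (u 0)).
have e2 : ell2 (delta R 1) by exact: ell2_delta.
have Jw : jacobi_shift (a t) (b t) x%:C w =
    addz (scalez c0%:C (delta R 0)) (scalez c1%:C (delta R 1)).
  apply/funext => n.
  have un := congr1 (fun f => f n) uf; rewrite /jacobi_shift /jacobi in un.
  rewrite /jacobi_shift /jacobi /w /mulz /addz /scalez /chi.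
  have [n1|n1] := ltP 1 n.
    have d0 : delta R 0 n = 0 by rewrite /delta; case: eqP n1 => // ->.
    have d1 : delta R 1 n = 0 by rewrite /delta; case: eqP n1 => // ->.
    have [p1 p2 p3] : [/\ 0 < n + 1, 0 < n & 0 < n - 1] by split; lia.
    rewrite p1 p2 p3 d0 d1 !mulr0 addr0 !mul1r -[RHS]d0 -un; ring.
  have [nE|[nE|n0]] : n = 1 \/ n = 0 \/ n < 0 by lia.
  - rewrite nE in un *; rewrite subrr /= in un *.
    rewrite (realzE 0 ru) in un.
    have d0 : delta R 0 1 = 0 by rewrite /delta.
    rewrite d0 /delta eqxx !mulr0 !mul0r !mulr0 !mul1r mulr1 add0r addr0.
    rewrite d0 in un; rewrite /c1 rmorphN rmorphM /=.
    by apply/eqP; rewrite -subr_eq0 opprK; apply/eqP; rewrite -[RHS]un; ring.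
  - rewrite nE add0r sub0r /= /delta /c0 (realzE 1 ru) rmorphM /=.
    by ring.
  - have [p1 p2 p3] : [/\ (0 < n + 1) = false, (0 < n) = false & (0 < n - 1) = false].
      by split; apply/negbTE; lia.
    have [q1 q2] : (n == 0) = false /\ (n == 1) = false by split; apply/negbTE; lia.
    by rewrite p1 p2 p3 /delta q1 q2 !mul0r !mulr0 !addr0 subr0.
have H := rdot_jacobi_shift abM x ew ev.
rewrite Jw vf in H.
rewrite (rdotDl (ell2Z _ e0) (ell2Z _ e2) ev) (rdotZl _ e0 ev) (rdotZl _ e2 ev) in H.
rewrite !rdot_delta rdotC rdot_delta in H.
have w1 : w (-1) = 0 by rewrite /w /mulz /chi /= mul0r.
rewrite w1 /= /c0 /c1 in H.
have a0 : a t 0 != 0 by rewrite gt_eqF.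
by apply: (mulfI a0); move: H; lra.
Qed.

Notation G := (fun t => greenmn t 0 0).

(** If G = y z for solutions y, z of the Schroedinger equation in time with
    the potential below, then greenH is (y z)' / 2 and greenK is y' z', written
    in terms of resolvent entries. *)
Definition greenH t : R :=
  a t 0 * greenmn t 1 0 - a t (-1) * greenmn t (-1) 0.

Definition greenK t : R :=
  2 * (x - b t 0) + (x - b t 0) ^+ 2 * greenmn t 0 0
  - 4 * a t 0 * a t (-1) * greenmn t 1 (-1).

(** The potential of the Schroedinger equation in time satisfied by the site-0
    component of a solution of J u = x u evolving by the Lax flow. *)
Definition potential t : R :=
  (x - b t 0) ^+ 2 - 2 * a t 0 ^+ 2 - 2 * a t (-1) ^+ 2.

Lemma greenH_disc t : greenH t ^+ 2 - greenmn t 0 0 * greenK t = 1.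
Proof.
have r := greenmn_row t 0 0; rewrite eqxx add0r sub0r in r.
have h := greenmn_rank_one t.
have E : a t 0 * greenmn t 1 0 + a t (-1) * greenmn t (-1) 0 =
    1 + (x - b t 0) * greenmn t 0 0 by move: r => /=; lra.
rewrite /greenH /greenK.
have -> : (a t 0 * greenmn t 1 0 - a t (-1) * greenmn t (-1) 0) ^+ 2 =
  (a t 0 * greenmn t 1 0 + a t (-1) * greenmn t (-1) 0) ^+ 2 -
  4 * a t 0 * a t (-1) * (greenmn t 1 0 * greenmn t (-1) 0) by ring.
by rewrite E h; ring.
Qed.

Lemma is_derive_greenG t : is_derive t (1 : R) G (2 * greenH t).
Proof.
apply: (is_derive_eq (is_derive_greenmn t 0 0)).
rewrite add0r sub0r (greenmn_sym t 0 (-1)) (greenmn_sym t 0 1) /greenH; ring.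
Qed.

Let da t n : is_derive t (1 : R) (fun t => a t n) (a t n * (b t (n + 1) - b t n)).
Proof. by case: (toda t n). Qed.

Let db t n : is_derive t (1 : R) (fun t => b t n) (2 * (a t n ^+ 2 - a t (n - 1) ^+ 2)).
Proof. by case: (toda t n). Qed.

Lemma is_deriveMr (f g : R -> R) t (df dg : R) :
  is_derive t (1 : R) f df -> is_derive t (1 : R) g dg ->
  is_derive t (1 : R) (fun t => f t * g t) (df * g t + f t * dg).
Proof.
move=> d1 d2; apply: (is_derive_eq (is_deriveM d1 d2)).
by rewrite /GRing.scale /=; ring.
Qed.

Lemma is_derive_greenH t :
  is_derive t (1 : R) greenH (potential t * greenmn t 0 0 + greenK t).
Proof.
have d1 := is_deriveMr (da t 0) (is_derive_greenmn t 1 0).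
have d2 := is_deriveMr (da t (-1)) (is_derive_greenmn t (-1) 0).
apply: (is_derive_eq (is_deriveB d1 d2)).
have r0 := greenmn_row t 0 0.
have r1 := greenmn_row t 1 0.
have r2 := greenmn_row t 0 1.
have r3 := greenmn_row t (-1) 0.
have r4 := greenmn_row t 0 (-1).
rewrite /= ?add0r ?sub0r ?addNr ?subrr in r0 r1 r2 r3 r4 *.
rewrite (greenmn_sym t 0 1) (greenmn_sym t (-1) 1) in r2.
rewrite (greenmn_sym t 0 (-1)) in r4.
rewrite (greenmn_sym t (-1) 1).
rewrite /potential /greenK.
(* the claim is a combination of the row equations with these factors *)
have s0 := congr1 ( *%R (2 * (x - b t 0))) r0.
have s1 := congr1 ( *%R (a t 0)) r1; have s2 := congr1 ( *%R (a t 0)) r2.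
have s3 := congr1 ( *%R (a t (-1))) r3; have s4 := congr1 ( *%R (a t (-1))) r4.
move: s0 s1 s2 s3 s4; clear.
move: (greenmn t (1 + 1) 0) (greenmn t 1 0) (greenmn t 0 0) (greenmn t (-1) 0)
  (greenmn t (-1 - 1) 0) (greenmn t 1 1) (greenmn t 1 (-1)) (greenmn t (-1) (-1)).
move: (a t 1) (a t 0) (a t (-1)) (a t (-1 - 1)) (b t 1) (b t 0) (b t (-1)).
by move=> *; lra.
Qed.

Lemma is_derive_greenK t :
  is_derive t (1 : R) greenK (2 * potential t * greenH t).
Proof.
have cst (c : R) : is_derive t (1 : R) (fun=> c) 0 := is_derive_cst c t 1.
have dx := is_deriveB (cst x) (db t 0).
have d1 := is_deriveMr (cst 2) dx.
have d2 := is_deriveMr (is_deriveMr dx dx) (is_derive_greenG t).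
have d3 := is_deriveMr (is_deriveMr (is_deriveMr (cst 4) (da t 0)) (da t (-1)))
  (is_derive_greenmn t 1 (-1)).
apply: (is_derive_eq (is_deriveB (is_deriveD d1 d2) d3)).
have r0 := greenmn_row t 0 0.
have r1 := greenmn_row t 1 (-1).
have r2 := greenmn_row t (-1) 1.
rewrite /= ?add0r ?sub0r ?addNr ?subrr in r0 r1 r2 *.
rewrite (greenmn_sym t 0 (-1)) in r1.
rewrite (greenmn_sym t 0 1) (greenmn_sym t (-1) 1) in r2.
rewrite (greenmn_sym t 0 (-1)) (greenmn_sym t 1 (-1 - 1)).
rewrite /potential /greenH (_ : ((fun=> x) - b^~ 0) t = x - b t 0)//.
(* the claim is a combination of the row equations with these factors *)
have s0 := congr1 ( *%R (4 * (a t 0 ^+ 2 - a t (-1) ^+ 2))) r0.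
have s1 := congr1 ( *%R (4 * a t 0 * a t (-1))) r1.
have s2 := congr1 ( *%R (4 * a t 0 * a t (-1))) r2.
move: s0 s1 s2; clear.
move: (greenmn t (1 + 1) (-1)) (greenmn t 1 0) (greenmn t 0 0) (greenmn t (-1) 0)
  (greenmn t (-1 - 1) 1) (greenmn t 1 (-1)).
move: (a t 1) (a t 0) (a t (-1)) (a t (-1 - 1)) (b t 1) (b t 0) (b t (-1)).
by move=> *; lra.
Qed.

End TodaGreen.

(** * Dirichlet data at a gap edge *)

Section Class.
Context {R : realType} (E : set R) (a b : int -> R).
Context (ab : reflectionless_class E (a, b)).

Lemma class_resolvent z : (forall x, E x -> z != x%:C) -> resolvent_set a b z.
Proof.
move=> zE; have [_ /= sp _] := ab; apply: contrapT => /sp [x /zE /eqP].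
by move=> h /esym.
Qed.

Lemma class_upper z : 0 < complex.Im z -> resolvent_set a b z.
Proof.
move=> z0; apply: class_resolvent => x _; apply: contraTneq z0 => ->.
by rewrite /= ltxx.
Qed.

Lemma class_real x : ~ E x -> resolvent_set a b x%:C.
Proof.
move=> nEx; apply: class_resolvent => y Ey; apply: contra_not_neq nEx => -[->].
exact: Ey.
Qed.

Lemma class_coeffs_le : exists M, coeffs_le a b M.
Proof. by have [h _ _] := ab; exact: coeffs_le_exists h. Qed.

Lemma class_diagonal_bound (cE : compact E) n : inf E <= b n <= sup E.
Proof.
have [M abM] := class_coeffs_le.
have out x : ~ (inf E <= x <= sup E) -> resolvent_set a b x%:C.
  by move=> h; apply: class_real => /(E_bounds cE).
apply/andP; split.
  have := @diagonal_bound_ray _ a b M abM (inf E) (-1) n.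
  rewrite sqrrN expr1n mulN1r oppr_le0 subr_ge0; apply => // t t0.
  by apply: out => /andP[h _]; move: h t0; lra.
have := @diagonal_bound_ray _ a b M abM (sup E) 1 n.
rewrite expr1n mul1r subr_le0; apply => // t t0.
by apply: out => /andP[_ h]; move: h t0; lra.
Qed.

Context (l r : R) (lr : l < r) (gapE : forall x, l < x < r -> ~ E x).

Lemma class_near x : l < x < r -> \forall y \near x, resolvent_set a b y%:C.
Proof.
move=> /andP[lx xr].
have e0 : 0 < Num.min (x - l) (r - x) by rewrite lt_min !subr_gt0 lx.
apply: (near_resolvent_set e0) => y; rewrite lt_min !ltr_norml.
move=> /andP[/andP[h1 h2] /andP[h3 h4]]; apply: class_real; apply: gapE.
by apply/andP; split; lra.
Qed.

Lemma greenR_le x y : l < x -> x <= y -> y < r ->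
  greenR a b x <= greenR a b y.
Proof.
have [M abM] := class_coeffs_le.
move=> lx; rewrite le_eqVlt => /predU1P[->//|xy] yr.
have d u : x <= u <= y -> is_derive u (1 : R) (greenR a b)
    (nrm2 (resolvent a b u%:C (delta R 0))).
  move=> /andP[u1 u2]; apply: (is_derive_green abM); apply: class_near.
  by apply/andP; split; lra.
have [c /andP[c1 c2] Ec] := MVT_is_derive xy d.
rewrite -subr_ge0 Ec mulr_ge0//; last by rewrite subr_ge0 ltW.
apply: nrm2_ge0; apply: ell2_resolvent (ell2_delta 0).
by apply: class_real; apply: gapE; apply/andP; split; lra.
Qed.

Lemma green_lt0 x : l < x < r -> (green a b 0 x%:C < 0) = (greenR a b x < 0).
Proof.
have [M abM] := class_coeffs_le.
by move=> /gapE/class_real xR; rewrite (green_real abM xR) ltcR.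
Qed.

Lemma green_gt0 x : l < x < r -> (0 < green a b 0 x%:C) = (0 < greenR a b x).
Proof.
have [M abM] := class_coeffs_le.
by move=> /gapE/class_real xR; rewrite (green_real abM xR) ltcR.
Qed.

(** A continuous increasing function without a zero has a constant sign. *)
Lemma exists_dirichlet_datum : exists mu, is_dirichlet_datum a b l r mu.
Proof.
have [M abM] := class_coeffs_le.
have [[mu lmu gmu]|nz] := pselect (exists2 mu, l < mu < r & greenR a b mu = 0).
  exists mu; apply: Or31; split => //.
  by rewrite (green_real abM (class_real (gapE lmu))) gmu.
pose x0 := (l + r) / 2.
have x0lr : l < x0 < r by have := lr; rewrite /x0 => ?; apply/andP; split; lra.
have cont u v : l < u -> v < r -> {within `[u, v], continuous (greenR a b)}.
  move=> lu vr; apply: continuous_in_subspaceT => y /[!inE] /=.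
  rewrite in_itv /= => /andP[y1 y2].
  apply: is_derive_continuous (is_derive_green abM (class_near _)).
  by apply/andP; split; lra.
have sign (s1 s2 : R) : l < s1 < r -> l < s2 < r -> s1 <= s2 ->
    greenR a b s1 < 0 -> 0 < greenR a b s2 -> False.
  move=> /andP[l1 r1] /andP[l2 r2] s12 g1 g2.
  have [c] := @IVT _ (greenR a b) s1 s2 0 s12 (cont _ _ l1 r2)
    ltac:(by rewrite ge_min le_max (ltW g1) (ltW g2) orbT).
  rewrite in_itv /= => /andP[c1 c2] gc; apply: nz; exists c => //.
  by apply/andP; split; lra.
have nz' y : l < y < r -> greenR a b y != 0.
  by move=> ylr; apply/eqP => gy; apply: nz; exists y.
have mono x y : l < x < r -> l < y < r -> x <= y -> greenR a b x <= greenR a b y.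
  by move=> /andP[h1 _] /andP[_ h2] xy; exact: greenR_le.
have [g0|g0] := ltP (greenR a b x0) 0.
  exists r; apply: Or32; split => // y ylr; rewrite green_lt0//.
  have [yx|xy] := leP y x0; first by apply: le_lt_trans g0; exact: mono.
  rewrite ltNge le_eqVlt eq_sym (negbTE (nz' _ ylr)) /=; apply/negP => gy.
  exact: (sign x0 y x0lr ylr (ltW xy) g0 gy).
have {}g0 : 0 < greenR a b x0 by rewrite lt_neqAle eq_sym nz'.
exists l; apply: Or33; split => // y ylr; rewrite green_gt0//.
have [xy|yx] := leP x0 y; first by apply: (lt_le_trans g0); exact: mono.
rewrite ltNge le_eqVlt (negbTE (nz' _ ylr)) /=; apply/negP => gy.
exact: (sign y x0 ylr x0lr (ltW yx) gy g0).
Qed.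

Lemma dirichlet_datum_right : dirichlet_datum a b l r = r ->
  forall x, l < x < r -> greenR a b x < 0.
Proof.
have := xgetPex l exists_dirichlet_datum; rewrite -/(dirichlet_datum a b l r).
case=> [[/andP[_ h] _] E1|[_ h] _ x xlr|[h _] E1].
- by move: h; rewrite E1 ltxx.
- by rewrite -green_lt0//; exact: h.
- by have /eqP := lt_eqF lr; rewrite (etrans (esym h) E1).
Qed.

Lemma dirichlet_datum_left : dirichlet_datum a b l r = l ->
  forall x, l < x < r -> 0 < greenR a b x.
Proof.
have := xgetPex l exists_dirichlet_datum; rewrite -/(dirichlet_datum a b l r).
case=> [[/andP[h _] _] E1|[h _] E1|[_ h] _ x xlr].
- by move: h; rewrite E1 ltxx.
- by have /eqP := lt_eqF lr; rewrite (etrans (esym E1) h).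
- by rewrite -green_gt0//; exact: h.
Qed.

End Class.

Section EdgeLimit.
Context {R : realType} (E : set R) (I : countType) (Em Ep : I -> R) (j : I).
Context (cE : compact E) (gaps : gap_enumeration E Em Ep).
Context (craig : craig_condition E Em Ep).

(** The sign sg points out of the gap, so that lam - sg * h is the point of the
    gap at distance h from the edge, and sg times the Green function decreases
    with this distance. *)
Definition outward_edge (sg lam : R) :=
  sg = 1 /\ lam = Ep j \/ sg = -1 /\ lam = Em j.

Lemma outward_edge_in_gap sg lam h : outward_edge sg lam ->
  0 < h < Ep j - Em j -> Em j < lam - sg * h < Ep j.
Proof. by move=> [[-> ->]|[-> ->]] /andP[h1 h2]; apply/andP; split; lra. Qed.

Lemma outward_edge_sqr sg lam : outward_edge sg lam -> sg ^+ 2 = 1.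
Proof. by move=> [[-> _]|[-> _]]; rewrite ?sqrrN expr1n. Qed.

Lemma outward_edge_density sg lam : outward_edge sg lam ->
  exists2 d : R, 0 < d & forall h : R, 0 < h < d ->
    exists A : set R, [/\ measurable A, A `<=` E, A `<=` `[lam - h, lam + h] &
      ((h / 2)%:E <= lebesgue_measure A)%E].
Proof.
have mE : measurable E by exact: compact_measurable.
move=> [[_ ->]|[_ ->]].
- have [d d0 H] := density_right cE gaps craig j; exists d => // h hd.
  exists (E `&` `[Ep j, Ep j + h]); split; [exact: measurableI|by move=> x []| |exact: H].
  case/andP: hd => h0 _.
  by move=> x [_]; rewrite /= !in_itv /= => /andP[x1 x2]; apply/andP; split; lra.
- have [d d0 H] := density_left cE gaps craig j; exists d => // h hd.
  exists (E `&` `[Em j - h, Em j]); split; [exact: measurableI|by move=> x []| |exact: H].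
  case/andP: hd => h0 _.
  by move=> x [_]; rewrite /= !in_itv /= => /andP[x1 x2]; apply/andP; split; lra.
Qed.

Lemma signed_greenR_le (a b : int -> R) sg lam h1 h2 :
  reflectionless_class E (a, b) -> outward_edge sg lam ->
  0 < h1 -> h1 <= h2 -> h2 < Ep j - Em j ->
  sg * greenR a b (lam - sg * h2) <= sg * greenR a b (lam - sg * h1).
Proof.
move=> ab edge h10 h12 h2g.
have gapE x : Em j < x < Ep j -> ~ E x := @gap_notin _ _ _ _ _ gaps j x.
have /andP[l1 r1] : Em j < lam - sg * h1 < Ep j.
  by apply: outward_edge_in_gap => //; rewrite h10 (le_lt_trans h12).
have /andP[l2 r2] : Em j < lam - sg * h2 < Ep j.
  by apply: outward_edge_in_gap => //; rewrite h2g (lt_le_trans h10).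
case: edge l1 r1 l2 r2 => [[-> _]|[-> _]] l1 r1 l2 r2.
  by rewrite !mul1r in l1 r1 l2 r2 *; apply: (greenR_le ab gapE) => //; lra.
by rewrite !mulN1r lerN2; apply: (greenR_le ab gapE) => //; lra.
Qed.

(** By monotonicity a one-sided bound gives a finite limit at the edge, which
    is 0 by [edge_limit_zero]. *)
Lemma green_edge_dichotomy (a b : int -> R) sg lam c :
  reflectionless_class E (a, b) -> outward_edge sg lam ->
  (forall h, 0 < h < Ep j - Em j -> sg * greenR a b (lam - sg * h) <= c) ->
  forall e, 0 < e -> exists2 d, 0 < d & forall h, 0 < h < d ->
    `|greenR a b (lam - sg * h)| <= e.
Proof.
move=> ab edge bound.
have sg1 := outward_edge_sqr edge.
have nsg : `|sg| = 1.
  by apply/eqP; rewrite -(@eqrXn2 _ 2)// -normrX sg1 normr1 expr1n.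
have lt := gap_lt gaps j.
have ingap h := @outward_edge_in_gap sg lam h edge.
have gapE x : Em j < x < Ep j -> ~ E x := @gap_notin _ _ _ _ _ gaps j x.
pose gam := Ep j - Em j; have gam0 : 0 < gam by rewrite subr_gt0.
pose psi h := sg * greenR a b (lam - sg * h).
have psiE h : greenR a b (lam - sg * h) = sg * psi h.
  by rewrite /psi mulrA -expr2 sg1 mul1r.
have mono h1 h2 : 0 < h1 -> h1 <= h2 -> h2 < gam -> psi h2 <= psi h1.
  by move=> h10 h12 h2g; exact: (signed_greenR_le ab edge h10 h12 h2g).
pose S := [set psi h | h in [set h | 0 < h < gam]].
have Ssup : has_sup S.
  split; first by exists (psi (gam / 2)), (gam / 2) => //=; apply/andP; split; lra.
  by exists c => _ [h hg <-]; exact: bound.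
pose g := sup S.
have lim e : 0 < e -> exists2 d, 0 < d & forall h, 0 < h < d ->
    `|greenR a b (lam - sg * h) - sg * g| <= e.
  move=> e0; have [_ [h0 /andP[h00 h0g] <-] gh] := sup_adherent e0 Ssup.
  exists h0 => // h /andP[hp hh].
  have hg : 0 < h < gam by rewrite hp (lt_trans hh).
  have le1 : psi h <= g by apply: sup_upper_bound => //; exists h.
  have le2 := mono _ _ hp (ltW hh) h0g.
  rewrite psiE -mulrBr normrM nsg mul1r ler_norml -/g in gh *.
  by apply/andP; split; lra.
have [d1 d10 dense] := outward_edge_density edge.
pose d0 := Num.min gam d1.
have d00 : 0 < d0 by rewrite lt_min gam0.
have [M abM] := class_coeffs_le ab.
have [_ _ refl] := ab.
have g0 : sg * g = 0.
  apply: (edge_limit_zero abM (class_upper ab) (refl 0) sg1 d00 _ _ lim).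
    move=> h /andP[h0]; rewrite lt_min => /andP[hg _].
    by apply: (class_real ab); apply: gapE; apply: ingap; rewrite h0.
  by move=> h /andP[h0]; rewrite lt_min => /andP[_ hd]; apply: dense; rewrite h0.
move=> e /lim[d dp H]; exists d => // h /H.
by rewrite g0 subr0.
Qed.

End EdgeLimit.

Theorem proposition4p1 (R : realType) (E : set R) (I : countType)
    (Em Ep : I -> R) (a b : R -> int -> R) (j : I) (lam : R)
    (E_compact : compact E)
    (E_pos : (0 < @lebesgue_measure R E)%E)
    (E_gaps : gap_enumeration E Em Ep)
    (E_craig : craig_condition E Em Ep)
    (ab_class : forall t : R, reflectionless_class E (a t, b t))
    (ab_toda : toda_solution a b)
    (ab_nonconstant : exists s t : R, (a s, b s) <> (a t, b t))
    (lam_edge : lam = Em j \/ lam = Ep j) :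
  discrete_subset
    [set t : R | dirichlet_datum (a t) (b t) (Em j) (Ep j) = lam].
Proof.
have lt := gap_lt E_gaps j.
have gapE x : Em j < x < Ep j -> ~ E x := @gap_notin _ _ _ _ _ E_gaps j x.
have [sg edge] : exists sg, outward_edge Em Ep j sg lam.
  by case: lam_edge => ->; [exists (-1); right|exists 1; left].
have ingap h := @outward_edge_in_gap _ _ _ _ j sg lam h edge.
have sg1 := outward_edge_sqr edge.
have nsg : `|sg| = 1.
  by apply/eqP; rewrite -(@eqrXn2 _ 2)// -normrX sg1 normr1 expr1n.
pose gam := Ep j - Em j; have gam0 : 0 < gam by rewrite subr_gt0.
set S := [set t | _ = lam].
(* at a time of S the Green function has constant sign on the gap, which is
   the one-sided bound *)
have vanish t : S t -> forall e, 0 < e -> exists2 d, 0 < d &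
    forall h, 0 < h < d -> `|greenR (a t) (b t) (lam - sg * h)| <= e.
  move=> St; apply: (green_edge_dichotomy E_compact E_gaps E_craig (ab_class t) edge (c := 0)).
  move=> h /ingap hin; move: St; rewrite /S /=.
  case: edge hin => [[-> ->]|[-> ->]] hin St.
    rewrite !mul1r in hin *.
    exact: (ltW (dirichlet_datum_right (ab_class t) lt gapE St hin)).
  rewrite !mulN1r in hin *; rewrite oppr_le0.
  exact: (ltW (dirichlet_datum_left (ab_class t) lt gapE St hin)).
pose B := `|inf E| + `|sup E|.
have bB t n : `|b t n| <= B.
  have /andP[b1 b2] := class_diagonal_bound (ab_class t) E_compact n.
  have := ler_norm (sup E); have := ler_norm (- inf E); rewrite normrN /B.
  have := normr_ge0 (sup E); have := normr_ge0 (inf E).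
  by rewrite ler_norml => *; apply/andP; split; lra.
have B0 : 0 <= B by rewrite addr_ge0.
have coeffs t : jacobi_coeffs (a t) (b t) by have [h _ _] := ab_class t.
have a_gt0 t n : 0 < a t n by have [h _ _] := coeffs t.
move=> t0 St0.
have [_ [A0 aA0'] _] := coeffs t0.
have aA0 n : a t0 n <= A0 by apply: le_trans (aA0' n); exact: ler_norm.
have A00 : 0 <= A0 by apply: ltW; exact: lt_le_trans (a_gt0 t0 0) (aA0 0).
(* on the time interval of radius r the a_n at most double *)
pose r : R := (4 * B + 1)^-1.
have r0 : 0 < r by rewrite invr_gt0 ltr_wpDl ?mulr_ge0.
have Br : 4 * B * r <= 1.
  by rewrite ler_pdivrMr ?mul1r; [lra|rewrite ltr_wpDl ?mulr_ge0].
have aL := toda_offdiagonal_local ab_toda a_gt0 bB aA0 (ltW r0) Br.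
pose X := `|Em j| + `|Ep j|.
pose Q := (X + B) ^+ 2 + 4 * (2 * A0) ^+ 2.
have Q0 : 0 <= Q by rewrite addr_ge0 ?sqr_ge0// mulr_ge0 ?sqr_ge0.
have potQ t x : `|t - t0| <= r -> Em j < x < Ep j -> `|potential a b x t| <= Q.
  move=> tr /andP[x1 x2].
  have hx : `|x - b t 0| <= X + B.
    apply: (le_trans (ler_normB _ _)); apply: (lerD _ (bB t 0)).
    have := ler_norm (Ep j); have := ler_norm (- Em j); rewrite normrN /X.
    have := normr_ge0 (Ep j); have := normr_ge0 (Em j).
    by rewrite ler_norml => *; apply/andP; split; lra.
  have hq : (x - b t 0) ^+ 2 <= (X + B) ^+ 2.
    rewrite -(real_normK (num_real (x - b t 0))) ler_pXn2r ?nnegrE//.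
    exact: le_trans hx.
  have ha n : a t n ^+ 2 <= (2 * A0) ^+ 2.
    by rewrite ler_pXn2r ?nnegrE ?mulr_ge0 ?(ltW (a_gt0 _ _))// aL.
  have := ha 0; have := ha (-1); have := sqr_ge0 (a t 0); have := sqr_ge0 (a t (-1)).
  have := sqr_ge0 (x - b t 0).
  by rewrite /potential /Q ler_norml => *; apply/andP; split; lra.
(* two times of S closer than tau satisfy 400 Q T^2 <= 1 *)
pose tau := Num.min r (400 * Q + 1)^-1.
have D0 : 0 < 400 * Q + 1 by exact: (ltr_wpDl (mulr_ge0 (ler0n R 400) Q0) ltr01).
have tau0 : 0 < tau by rewrite lt_min r0 invr_gt0.
have unique t1 : S t1 -> `|t1 - t0| < tau -> t1 = t0.
  move=> St1 t1tau; apply: contrapT => t10.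
  pose p := Num.min t0 t1; pose T := `|t1 - t0|.
  have T0 : 0 < T by rewrite normr_gt0 subr_eq0; exact/eqP.
  have [pS qS] : S p /\ S (p + T).
    rewrite /p /T; case: (leP t0 t1) => h.
      by rewrite ger0_norm ?subr_ge0// addrC subrK.
    by rewrite distrC ger0_norm ?subr_ge0 ?(ltW h)// addrC subrK.
  have Tr : T <= r by apply: ltW (lt_le_trans t1tau _); rewrite ge_min lexx.
  have near t : p <= t <= p + T -> `|t - t0| <= r.
    move=> /andP[p1 p2]; apply: le_trans Tr; move: p1 p2; rewrite /p /T.
    case: (leP t0 t1) => h.
      by rewrite (ger0_norm (x := t1 - t0)) ?subr_ge0// => *; rewrite ger0_norm; lra.
    rewrite (distrC t1) (ger0_norm (x := t0 - t1)) ?subr_ge0 ?(ltW h)// => *.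
    by rewrite distrC ger0_norm; lra.
  have QT : 400 * (Q * T ^+ 2) <= 1.
    have T1 : (400 * Q + 1) * T <= 1.
      rewrite -ler_pdivlMl// mulr1; apply: ltW (lt_le_trans t1tau _).
      by rewrite ge_min lexx orbT.
    have h1 : 400 * Q * T <= 1 by move: T1 T0; rewrite mulrDl mul1r; lra.
    have h2 : T <= 1.
      by move: T1 (mulr_ge0 Q0 (ltW T0)); rewrite mulrDl mul1r; lra.
    by have := ler_pM (mulr_ge0 (mulr_ge0 (ler0n R 400) Q0) (ltW T0)) (ltW T0) h1 h2; rewrite expr2; lra.
  have e0 : 0 <= 100^-1 :> R by rewrite invr_ge0 ler0n.
  have e1 : 100 * 100^-1 <= 1 :> R by rewrite divff ?lexx ?pnatr_eq0.
  have eT : 0 < 100^-1 * T by rewrite mulr_gt0// invr_gt0.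
  have [d1 d10 H1] := vanish _ pS _ eT.
  have [d2 d20 H2] := vanish _ qS _ eT.
  pose m := p + T / 2.
  have mid h : 0 < h < gam -> h < d1 -> h < d2 ->
      T / 4 <= `|greenR (a m) (b m) (lam - sg * h)| <= T.
    move=> hg hd1 hd2; have /andP[h0 _] := hg; set x := lam - sg * h.
    have xin : Em j < x < Ep j by exact: ingap.
    have xR t : resolvent_set (a t) (b t) x%:C.
      by apply: (class_real (ab_class t)); exact: gapE.
    have dG t : p <= t <= p + T -> is_derive t (1 : R)
        (fun t => greenmn a b x t 0 0) (2 * greenH a b x t).
      by move=> _; exact: (is_derive_greenG ab_toda coeffs bB xR).
    have dH t : p <= t <= p + T -> is_derive t (1 : R) (greenH a b x)
        (potential a b x t * greenmn a b x t 0 0 + greenK a b x t).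
      by move=> _; exact: (is_derive_greenH ab_toda coeffs bB xR).
    have dK t : p <= t <= p + T -> is_derive t (1 : R) (greenK a b x)
        (2 * potential a b x t * greenH a b x t).
      by move=> _; exact: (is_derive_greenK ab_toda coeffs bB xR).
    have qQ t : p <= t <= p + T -> `|potential a b x t| <= Q.
      by move=> /near tr; exact: potQ.
    have h1 : 0 < h < d1 by rewrite h0.
    have h2 : 0 < h < d2 by rewrite h0.
    exact: (midpoint_bounds T0 Q0 QT e0 e1 dG dH dK qQ (greenH_disc coeffs xR p)
      (H1 h h1) (H2 h h2)).
  pose hm := Num.min gam (Num.min d1 d2) / 2.
  have hm0 : 0 < hm by rewrite divr_gt0// !lt_min gam0 d10.
  have hmlt : hm < Num.min gam (Num.min d1 d2) by move: hm0; rewrite /hm; lra.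
  move: (hmlt); rewrite !lt_min => /and3P[hmg hm1 hm2].
  have T8 : 0 < T / 8 by rewrite divr_gt0.
  have bound h : 0 < h < Ep j - Em j -> sg * greenR (a m) (b m) (lam - sg * h) <= T.
    move=> /andP[h0 hg].
    have near_edge h' : 0 < h' -> h' <= hm ->
        sg * greenR (a m) (b m) (lam - sg * h') <= T.
      move=> h'0 h'm.
      have /andP[_ hi] : T / 4 <= `|greenR (a m) (b m) (lam - sg * h')| <= T.
        apply: mid; [rewrite h'0|..].
        - exact: le_lt_trans h'm hmg.
        - exact: le_lt_trans h'm hm1.
        - exact: le_lt_trans h'm hm2.
      by apply: le_trans (ler_norm _) _; rewrite normrM nsg mul1r.
    have [hhm|/ltW hhm] := leP h hm; first exact: near_edge.
    apply: le_trans (near_edge hm hm0 (lexx _)).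
    exact: (signed_greenR_le E_gaps (ab_class m) edge hm0 hhm hg).
  have [d d0 H] := green_edge_dichotomy E_compact E_gaps E_craig (ab_class m) edge bound T8.
  pose h := Num.min d hm / 2.
  have h0 : 0 < h by rewrite divr_gt0// lt_min d0.
  have hlt : h < Num.min d hm by move: h0; rewrite /h; lra.
  move: hlt; rewrite lt_min => /andP[hd hhm].
  have hd' := H h ltac:(by rewrite h0).
  have /andP[lo _] := mid h ltac:(by rewrite h0 (lt_trans hhm)) (lt_trans hhm hm1) (lt_trans hhm hm2).
  by have := le_trans lo hd'; lra.
split; first by rewrite inE.
exists (ball t0 tau); first exact: nbhsx_ballx.
apply/seteqP; split=> [t [tb St]|_ ->]; last first.
  by split; [exact: ballxx|exact: St0].
by move: tb; rewrite -ball_normE /= distrC => tb; exact: (unique t St tb).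
Qed.
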